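(* Let $v_h\in V_h$, and let $\xi$ be given for $t>0$ by $$\xi(t)=-\frac1{2\pi i}\int_{\Gamma}e^{zt}\,\hat E_h(z)\,\bar A_h\,Q_h\,\widehat{u_{ht}}(z)\,dz,\qquad \Gamma=\Gamma_{\theta,1/t},$$ where $\hat E_h(z)=\beta(z)(z\beta(z)I+\bar A_h)^{-1}$ and $\widehat{u_{ht}}(z)=z\beta(z)(z\beta(z)I+A_h)^{-1}v_h-v_h$; that is, $\xi=\bar u_h-u_h$ is the difference between the finite volume element solution and the Galerkin finite element solution of the evolution problem $u'+\mathcal J^\alpha Au=0$, both with initial value $v_h$. Then there is a positive constant $C$, independent of $h$, such that for $t>0$: $$\|\xi(t)\|+h\|\nabla\xi(t)\|\le C\,h^2\,\|\bar A_hv_h\|.$$ If $|\beta(z)|\le C|z|^\mu$ for all $z\in\Sigma_\theta$, for some real $\mu<1$, then $$\|\xi(t)\|+h\|\nabla\xi(t)\|\le C\,t^{-(\mu+1)/2}\,h^2\,\|\nabla v_h\|.$$ If $|\beta(z)|\le C|z|^\mu$ for all $z\in\Sigma_\theta$, for some real $\mu<1$, and $Q_h$ satisfies $\|Q_h\chi\|\le Ch^2\|\chi\|$ for all $\chi\in V_h$ (with $C$ independent of $h$), then $$\|\xi(t)\|+h\|\nabla\xi(t)\|\le C\,t^{-(\mu+1)}\,h^2\,\|v_h\|.$$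
   Context: Setting: $\Omega\subset\mathbb R^2$ is a bounded convex polygonal domain, $A=-\Delta$ with homogeneous Dirichlet boundary conditions; $(\cdot,\cdot)$ and $\|\cdot\|$ are the inner product and norm of $L^2(\Omega)$. Discretization: $\{\mathcal T_h\}_{0<h<1}$ is a regular (shape-regular) family of triangulations of $\Omega$, $h$ the maximal triangle diameter; $V_h$ is the space of continuous functions on $\overline\Omega$, linear on each triangle and vanishing on $\partial\Omega$ (complexified where needed). For each vertex $P_i$ of $\mathcal T_h$, the control volume $K_{P_i}^*$ is the polygon around $P_i$ obtained by joining successively the midpoints of the edges emanating from $P_i$ and the barycenters of the triangles having $P_i$ as vertex. $\Pi_h^*\chi=\sum_{P_i}\chi(P_i)\eta_i$, the sum over interior vertices, with $\eta_i$ the characteristic function of $K_{P_i}^*$, and $(\psi,\chi)_h:=(\psi,\Pi_h^*\chi)$ for $\psi,\chi\in V_h$; this is an inner product on $V_h$ whose norm is equivalent to $\|\cdot\|$ uniformly in $h$. The operators $A_h,\bar A_h,Q_h:V_h\to V_h$ are defined, for all $\psi,\chi\in V_h$, by $(A_h\psi,\chi)=(\nabla\psi,\nabla\chi)$, $(\bar A_h\psi,\chi)_h=(\nabla\psi,\nabla\chi)$, $(\nabla Q_h\chi,\nabla\psi)=(\chi,\psi)_h-(\chi,\psi)$. Evolution problem: $\mathcal J^\alpha$ is a time integral/differential operator ($0<\alpha<1$) such that the Laplace transform of $u'+\mathcal J^\alpha Au=0$, $u(0)=v$, is $z\hat u+g(z)A\hat u=v$ for a function $g$; put $\beta(z)=1/g(z)$.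 (Examples: $\mathcal J^\alpha=\mathcal I^\alpha$, the Riemann-Liouville integral $\mathcal I^\alpha\varphi(t)=\int_0^t\frac{(t-s)^{\alpha-1}}{\Gamma(\alpha)}\varphi(s)ds$, with $\beta(z)=z^\alpha$; $\mathcal J^\alpha=I+\mathcal I^\alpha$ with $\beta(z)=z^\alpha/(1+z^\alpha)$; $\mathcal J^\alpha=I+\gamma\partial_t^\alpha$, $\gamma>0$, $\partial_t^\alpha$ the Riemann-Liouville derivative, with $\beta(z)=1/(1+\gamma z^\alpha)$.) The finite volume element solution $\bar u_h$ and the finite element solution $u_h$ satisfy $\bar u_h'+\mathcal J^\alpha\bar A_h\bar u_h=0$ and $u_h'+\mathcal J^\alpha A_hu_h=0$ with $\bar u_h(0)=u_h(0)=v_h$. Sectors and contour: for $\theta\in(\pi/2,\pi)$, $\Sigma_\theta=\{z\in\mathbb C:z\ne0,|\arg z|<\theta\}$ and, for $\delta>0$, $\Gamma_{\theta,\delta}=\{\rho e^{\pm i\theta}:\rho\ge\delta\}\cup\{\delta e^{i\psi}:|\psi|\le\theta\}$, oriented with increasing imaginary part. Standing assumption: $g$ and $\beta$ are analytic and nonvanishing on $\mathbb C\setminus(-\infty,0]$, and $\theta\in(\pi/2,\pi)$ is chosen such that, for some $\theta'\in(\pi/2,\pi)$, $z\beta(z)\in\Sigma_{\theta'}$ for all $z\in\Sigma_\theta$. $C$ may depend on $\alpha$, $\theta$, $\theta'$, $T$ (times restricted to $(0,T]$), $\mu$ and the constants in the hypotheses, but is independent of $h$, $t$ and $v_h$. 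*)

(* Defs.v *)
From HB Require Import structures.
From mathcomp Require Import all_boot all_order all_algebra finmap complex.
From mathcomp Require Import all_classical all_reals all_analysis.

Set Implicit Arguments.
Unset Strict Implicit.
Unset Printing Implicit Defensive.
Import Order.TTheory GRing.Theory Num.Theory.
Import numFieldNormedType.Exports.
Local Open Scope classical_set_scope.
Local Open Scope ring_scope.
Local Open Scope complex_scope.

Section Plane.
Variable R : realType.
Implicit Types (x y p : R * R) (A : set (R * R)) (P : {fset R * R}).

(* The product norm of the library on [R * R] is the sup norm. *)
Definition edist x y : R :=
  Num.sqrt ((x.1 - y.1) ^+ 2 + (x.2 - y.2) ^+ 2).

Definition diameter A : R :=
  sup [set r | exists x y, [/\ A x, A y & r = edist x y]].

(* The supremum of the diameters of the discs contained in [A]. *)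
Definition inner_diameter A : R :=
  sup [set d | exists c r,
    [/\ 0 <= r, d = 2 * r & forall x, edist c x <= r -> A x]].

Definition conv P : set (R * R) :=
  [set x | exists w : R * R -> R,
    [/\ forall p, p \in P -> 0 <= w p,
        \sum_(p <- P) w p = 1,
        x.1 = \sum_(p <- P) w p * p.1 &
        x.2 = \sum_(p <- P) w p * p.2]].

Definition convex_polygonal_domain (Omega : set (R * R)) :=
  Omega !=set0 /\ exists P, Omega = (conv P)°.

(* A triangulation is given by the vertex sets of its (closed) triangles. *)
Definition triangulation (Omega : set (R * R)) (T : {fset {fset R * R}}) :=
  [/\ forall K, K \in T -> #|` K| = 3%N /\ (conv K)° !=set0,
      forall K L, K \in T -> L \in T ->
        conv K `&` conv L = conv (K `&` L)%fset &
      \bigcup_(K in [set` T]) conv K = closure Omega].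

Definition mesh_size (T : {fset {fset R * R}}) : R :=
  \big[Num.max/0]_(K <- T) diameter (conv K).

Definition shape_regular (Hs : set R) (Th : R -> {fset {fset R * R}}) :=
  exists sigma : R, forall h, Hs h -> forall K, K \in Th h ->
    diameter (conv K) <= sigma * inner_diameter (conv K).

Definition midpoint x y : R * R := ((x.1 + y.1) / 2, (x.2 + y.2) / 2).

Definition barycenter P : R * R :=
  ((\sum_(p <- P) p.1) / #|` P|%:R, (\sum_(p <- P) p.2) / #|` P|%:R).

(* In each triangle [K] with vertex [p], joining the midpoints of the two edges
   at [p] to the barycenter cuts off at [p] a convex quadrilateral; its vertex
   [p] is [midpoint p p]. *)
Definition control_volume (T : {fset {fset R * R}}) p : set (R * R) :=
  \bigcup_(K in [set K | K \in T /\ p \in K])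
    conv (barycenter K |` [fset midpoint p q | q in K])%fset.

Definition vertices (T : {fset {fset R * R}}) : {fset R * R} :=
  (\bigcup_(K <- T) K)%fset.

End Plane.

Section ComplexCalculus.
Variable R : realType.
Implicit Types (f g : R[i] -> R[i]) (z : R[i]).

Definition cis (psi : R) : R[i] := cos psi +i* sin psi.

Definition cexp z : R[i] := (expR (complex.Re z))%:C * cis (complex.Im z).

Definition sector (theta : R) : set R[i] :=
  [set z | exists rho psi : R,
    [/\ 0 < rho, `|psi| < theta & z = rho%:C * cis psi]].

Definition slit_plane : set R[i] := [set z | ~ (complex.Im z = 0 /\ complex.Re z <= 0)].

Definition analytic_on (D : set R[i]) f :=
  forall z, D z -> derivable (f : R[i]^o -> R[i]^o) z 1.

Definition Cintegral d (X : measurableType d) (mu : {measure set X -> \bar R})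
    (D : set X) (F : X -> R[i]) : R[i] :=
  Rintegral mu D (fun x => complex.Re (F x)) +i* Rintegral mu D (fun x => complex.Im (F x)).

(* The integral over Gamma_{theta,delta}, with increasing imaginary part. *)
Definition contour_integral (theta delta : R) (F : R[i] -> R[i]) : R[i] :=
  let leb := @lebesgue_measure R in
  let ray psi := Cintegral leb `[delta, +oo[
    (fun rho => F (rho%:C * cis psi) * cis psi) in
  let arc := Cintegral leb `[- theta, theta]
    (fun psi => F (delta%:C * cis psi) * ((0 +i* 1) * (delta%:C * cis psi))) in
  - ray (- theta) + arc + ray theta.

End ComplexCalculus.

Section FiniteElements.
Variable R : realType.
Variable Omega : set (R * R).
Local Notation fct := (R * R -> R[i]).
Implicit Types (T : {fset {fset R * R}}) (f g v w chi psi : fct).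

Definition leb2 := ((@lebesgue_measure R) \x (@lebesgue_measure R))%E.

Definition ip f g : R[i] := Cintegral leb2 Omega (fun x => f x * conjc (g x)).

Definition l2norm f : R := Num.sqrt (complex.Re (ip f f)).

(* Classical partial derivatives; for a piecewise linear function they exist off
   the edges, hence almost everywhere. *)
Definition partial1 f : fct := fun x =>
  derive1 (fun s => complex.Re (f (s, x.2))) x.1
    +i* derive1 (fun s => complex.Im (f (s, x.2))) x.1.

Definition partial2 f : fct := fun x =>
  derive1 (fun s => complex.Re (f (x.1, s))) x.2
    +i* derive1 (fun s => complex.Im (f (x.1, s))) x.2.

Definition ip_grad f g : R[i] :=
  ip (partial1 f) (partial1 g) + ip (partial2 f) (partial2 g).

Definition l2norm_grad f : R := Num.sqrt (complex.Re (ip_grad f f)).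

(* The complex P1 space; its elements, defined on the closure of [Omega] and zero
   on the boundary, are extended by zero to the plane. *)
Definition Vh T : set fct :=
  [set f | [/\ {within closure Omega, continuous (f : R * R -> R[i]^o)},
               forall x, ~ Omega x -> f x = 0 &
               forall K, K \in T -> exists a b c : R[i], forall x, conv K x ->
                 f x = a + b * x.1%:C + c * x.2%:C]].

Definition Pi_star T chi : fct := fun x =>
  \sum_(p <- vertices T | `[< Omega p >])
    chi p * (\1_(control_volume T p) x)%:C.

Definition ip_h T psi chi : R[i] := ip psi (Pi_star T chi).

(* The operators are defined by (unique) description, with value [0] when no
   element of [Vh T] qualifies. *)
Definition A_h T psi : fct :=
  xget 0 [set w | Vh T w /\
    forall chi, Vh T chi -> ip w chi = ip_grad psi chi].

Definition Abar_h T psi : fct :=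
  xget 0 [set w | Vh T w /\
    forall chi, Vh T chi -> ip_h T w chi = ip_grad psi chi].

Definition Q_h T chi : fct :=
  xget 0 [set w | Vh T w /\
    forall psi, Vh T psi -> ip_grad w psi = ip_h T chi psi - ip chi psi].

(* [(lambda I + L)^-1 f] in [Vh T]. *)
Definition resolvent T (L : fct -> fct) (lambda : R[i]) f : fct :=
  xget 0 [set w | Vh T w /\ forall x, lambda * w x + L w x = f x].

Definition E_hat T (beta : R[i] -> R[i]) (z : R[i]) f : fct := fun x =>
  beta z * resolvent T (Abar_h T) (z * beta z) f x.

Definition ut_hat T (beta : R[i] -> R[i]) v (z : R[i]) : fct := fun x =>
  z * beta z * resolvent T (A_h T) (z * beta z) v x - v x.

Definition xi T (theta : R) (beta : R[i] -> R[i]) v (t : R) : fct := fun x =>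
  - (2 * pi%:C * (0 +i* 1))^-1 *
  contour_integral theta t^-1 (fun z =>
    cexp (z * t%:C) *
    E_hat T beta z (Abar_h T (Q_h T (ut_hat T beta v z))) x).

End FiniteElements.

Section Assumptions.
Variable R : realType.

Definition analytic_nonvanishing (f : R[i] -> R[i]) :=
  analytic_on (@slit_plane R) f /\ forall z, slit_plane z -> f z != 0.

Definition standing_assumption (theta theta' : R) (g beta : R[i] -> R[i]) :=
  [/\ forall z, slit_plane z -> beta z = (g z)^-1,
      analytic_nonvanishing g, analytic_nonvanishing beta &
      forall z, sector theta z -> sector theta' (z * beta z)].

Definition beta_growth (theta mu B : R) (beta : R[i] -> R[i]) :=
  forall z, sector theta z -> Normc.normc (beta z) <= B * Normc.normc z `^ mu.

End Assumptions.

(* Main.v *)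
Require Import Defs.
From HB Require Import structures.
From mathcomp Require Import all_boot all_order all_algebra finmap complex.
From mathcomp Require Import all_classical all_reals all_analysis.
From mathcomp Require Import measurable_realfun ring lra.
Set Implicit Arguments.
Unset Strict Implicit.
Unset Printing Implicit Defensive.
Import Order.TTheory GRing.Theory Num.Theory.
Import numFieldNormedType.Exports.
Local Open Scope classical_set_scope.
Local Open Scope ring_scope.
Local Open Scope complex_scope.

(** On the finite element space, the inner products of the statement depend on
    the values at the vertices only: on each triangle they are given by a matrix of
    order three, fixed up to the area for the two [L^2] products ([ip_mass],
    [ip_lump], [ip_grad_form]). By the symmetry of the triangle, the consistent and
    the lumped mass matrix are both combinations of the identity and of the matrix
    with all entries 1, and they have the same row sums. Hence the two [L^2] norms
    are equivalent uniformly in [h], and the quadrature error [(f, g)_h - (f, g)]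
    is a multiple of the oscillation of the nodal values of [f] and [g] on the
    triangles. As the oscillation is at most [h] times the gradient, the error is
    bounded by [h^2 |grad f| |grad g|] and by [h |f| |grad g|]
    ([quadrature_error2], [quadrature_error1]).

    At a point [z] of the contour, put [lambda = z beta(z)]. The integrand of [xi]
    is [e^(z t) beta(z) w], where [w] comes from the data by three variational
    problems: [lambda (chi, psi) + (grad chi, grad psi) = - (grad v, grad psi)]
    for the transform [chi] of the derivative of [u_h], then
    [(grad q, grad psi) = (chi, psi)_h - (chi, psi)] for [q = Q_h chi], and
    [lambda (w, psi)_h + (grad w, grad psi) = (grad q, grad psi)]. Since [lambda]
    stays in a sector that avoids the negative real axis, each problem can be
    tested with its own solution without cancellation ([sector_coercive]).
    Combined with the quadrature error, this bounds [|w| + h |grad w|], multiplied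
    by [|lambda|], [|lambda|^(1/2)] or [1], by [h^2] times the norm of the data of
    the respective estimate ([w_estimate_smooth], [w_estimate_energy],
    [w_estimate_rough]). With [|beta| = |lambda| / |z|] and the growth of [beta],
    the norm of [beta(z) w] is at most a constant times [|z|^a], where [a] is [-1],
    [(mu - 1)/2] or [mu].

    Integrating [e^(z t) |z|^a] along the contour of inner radius [1/t] yields the
    power [t^-(a + 1)] ([contour_bound]). The norms can be taken under the integral
    because [xi] is a finite combination of the members of an orthonormal basis,
    with coefficients that are contour integrals of continuous functions
    ([coords_w], [xi_estimate]). The rays of the contour lie on the boundary of
    the sector where [beta] is controlled; the bounds extend to it by continuity
    ([zbeta_sector], [beta_growth_closed]). *)

(** * Affine changes of variables in the plane *)

Section ChangeOfVariables.
Variable R : realType.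
Local Notation leb := (@lebesgue_measure R).
Local Notation mR := (measurableTypeR R).
Local Notation leb2 := (@leb2 R).
Implicit Types (c d : R).

Lemma measurable_affine c d (D : set mR) :
  measurable_fun D ((fun t => c * t + d) : mR -> mR).
Proof.
apply: measurable_funTS.
by apply: (measurable_funD) => //; apply: measurable_funM.
Qed.

Lemma affine_preimage_itv c d a b : c != 0 ->
  leb ((fun t => c * t + d) @^-1` `]a, b]) = (`|c|^-1%:E * leb `]a, b])%E.
Proof.
move=> c0; rewrite lebesgue_measure_itv/= lte_fin.
have [cp|cn|/eqP] := ltgtP c 0; last by rewrite (negbTE c0).
- have -> : ((fun t => c * t + d) @^-1` `]a, b])%classic = `[(b - d) / c, (a - d) / c[%classic.
    apply/seteqP; split => t /=; rewrite !in_itv/= ler_ndivrMr// ltr_ndivlMr// => /andP[? ?]; lra.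
  rewrite lebesgue_measure_itv/= lte_fin ltr_ndivrMr// divfK// ltrD2r ltr0_norm//.
  case: ifPn; rewrite ?mule0// => ab.
  by rewrite -EFinB -EFinM; congr EFin; field; lra.
- have -> : ((fun t => c * t + d) @^-1` `]a, b])%classic = `](a - d) / c, (b - d) / c]%classic.
    apply/seteqP; split => t /=; rewrite !in_itv/= ler_pdivlMr// ltr_pdivrMr// => /andP[? ?]; lra.
  rewrite lebesgue_measure_itv/= lte_fin ltr_pdivlMr// divfK// ltrD2r gtr0_norm//.
  case: ifPn; rewrite ?mule0// => ab.
  by rewrite -EFinB -EFinM; congr EFin; field; lra.
Qed.

(** The pushforward of Lebesgue measure by the affine map, multiplied by [`|c|],
    agrees with Lebesgue measure on half-open intervals, hence everywhere. *)
Lemma ge0_integral_affine c d (F : mR -> \bar R) : c != 0 ->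
  measurable_fun setT F -> (forall x, 0 <= F x)%E ->
  (\int[leb]_x F x = `|c|%:E * \int[leb]_t F (c * t + d)%R)%E.
Proof.
move=> c0 mF F0.
have c0' : 0 <= `|c| by [].
have mphi : measurable_fun setT ((fun t => c * t + d) : mR -> mR) by exact: measurable_affine.
pose mu : {measure set mR -> \bar R} := mscale (NngNum c0')
  (measure_function_pushforward__canonical__measure_function_Measure leb mphi).
transitivity (\int[mu]_x F x)%E.
  apply: eq_measure_integral => A mA _.
  apply/lebesgue_measure_unique => //= _ [[a b]] _ <-.
  change (leb `]a, b] = `|c|%:E * leb ((fun t : R => (c * t + d)%R) @^-1` `]a, b]))%E.
  rewrite (affine_preimage_itv _ _ _ c0) muleA -EFinM divff ?mul1e//.
  by rewrite normr_eq0.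
rewrite /mu ge0_integral_mscale//=; congr (_ * _)%E.
by rewrite ge0_integral_pushforward// preimage_setT.
Qed.

Lemma integral_leb2 (F : mR * mR -> \bar R) : measurable_fun setT F ->
  (forall x, 0 <= F x)%E ->
  (\int[leb2]_x F x = \int[leb]_x \int[leb]_y F (x, y))%E.
Proof. by move=> mF F0; rewrite /leb2 fubini_tonelli1. Qed.

Lemma integral_leb2_swap (F : mR * mR -> \bar R) : measurable_fun setT F ->
  (forall x, 0 <= F x)%E ->
  (\int[leb2]_x F x = \int[leb]_y \int[leb]_x F (x, y))%E.
Proof. by move=> mF F0; rewrite /leb2 fubini_tonelli2. Qed.

Implicit Types (p u w : R * R).

Lemma measurable_affine2 (a b c : R) :
  measurable_fun setT ((fun x : mR * mR => a + x.1 * b + x.2 * c) : mR * mR -> mR).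
Proof.
apply: measurable_funD; first apply: measurable_funD => //.
- by apply: measurable_funM.
- by apply: measurable_funM.
Qed.

Lemma measurable_affine_comp p u w (F : mR * mR -> \bar R) : measurable_fun setT F ->
  measurable_fun setT (fun x : mR * mR =>
    F (p.1 + x.1 * u.1 + x.2 * w.1, p.2 + x.1 * u.2 + x.2 * w.2)).
Proof.
move=> mF; apply: (measurableT_comp (f := F)) => //.
by apply: measurable_fun_pair; exact: measurable_affine2.
Qed.

(** When the linear part has a nonzero upper left entry, the map is a composition of
    two maps that each change one coordinate only; each of them is handled on the
    slices given by the theorem of Tonelli. *)
Let cov_aux p u w (F : mR * mR -> \bar R) : u.1 != 0 ->
  u.1 * w.2 - u.2 * w.1 != 0 ->
  measurable_fun setT F -> (forall x, 0 <= F x)%E ->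
  (\int[leb2]_x F x = `|u.1 * w.2 - u.2 * w.1|%:E *
    \int[leb2]_x F (p.1 + x.1 * u.1 + x.2 * w.1, p.2 + x.1 * u.2 + x.2 * w.2)%R)%E.
Proof.
move=> u0 d0 mF F0.
set d := u.1 * w.2 - u.2 * w.1 in d0 *.
pose G (x : mR * mR) := F (x.1, d / u.1 * x.2 + (p.2 + (x.1 - p.1) * u.2 / u.1)).
have mG : measurable_fun setT G.
  rewrite /G.
  apply: (measurableT_comp (f := F)) => //.
  apply: measurable_fun_pair => //.
  apply: measurable_funD; first by apply: measurable_funM.
  apply: measurable_funD => //; apply: measurable_funM => //; apply: measurable_funM => //.
  by apply: measurable_funB.
have G0 x : (0 <= G x)%E by exact: F0.
have du0 : d / u.1 != 0 by rewrite mulf_neq0// invr_eq0.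
rewrite integral_leb2//.
transitivity (\int[leb]_x (`|d / u.1|%:E * \int[leb]_t G (x, t)))%E.
  apply: eq_integral => x _.
  rewrite (@ge0_integral_affine (d / u.1) (p.2 + (x - p.1) * u.2 / u.1))//.
  exact: measurableT_comp (pair1_measurable _).
rewrite ge0_integralZl//; last 2 first.
- exact: measurable_fun_fubini_tonelli_F.
- by move=> x _; apply: integral_ge0.
rewrite (fubini_tonelli G)//.
rewrite integral_leb2_swap//; last exact: measurable_affine_comp.
transitivity (`|d / u.1|%:E * \int[leb]_t (`|u.1|%:E * \int[leb]_s
  F (p.1 + s * u.1 + t * w.1, p.2 + s * u.2 + t * w.2)%R))%E.
  congr (_ * _)%E; apply: eq_integral => t _.
  rewrite (@ge0_integral_affine u.1 (p.1 + t * w.1) (fun s => G (s, t)))//; last first.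
    exact: measurableT_comp mG (pair2_measurable t).
  congr (_ * _)%E; apply: eq_integral => s _; rewrite /G/=.
  congr (F (_, _)); first by ring.
  by rewrite /d; field.
rewrite ge0_integralZl//; last 2 first.
- apply: (measurable_fun_fubini_tonelli_G (fun x : mR * mR => F (p.1 + x.1 * u.1 + x.2 * w.1, p.2 + x.1 * u.2 + x.2 * w.2))) => //.
  exact: measurable_affine_comp.
- by move=> x _; apply: integral_ge0.
by rewrite muleA -EFinM -normrM divfK.
Qed.

(** One of the two vectors [u], [w] has a nonzero first coordinate, as the determinant
    does not vanish; exchanging them reduces to the case of [u]. *)
Lemma ge0_integral_affine2 p u w (F : mR * mR -> \bar R) :
  u.1 * w.2 - u.2 * w.1 != 0 ->
  measurable_fun setT F -> (forall x, 0 <= F x)%E ->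
  (\int[leb2]_x F x = `|u.1 * w.2 - u.2 * w.1|%:E *
    \int[leb2]_x F (p.1 + x.1 * u.1 + x.2 * w.1, p.2 + x.1 * u.2 + x.2 * w.2)%R)%E.
Proof.
move=> d0 mF F0; have [u0|u0] := eqVneq u.1 0; last exact: cov_aux.
have w0 : w.1 != 0.
  by apply: contraNneq d0 => w0; rewrite u0 w0 mul0r mulr0 subrr.
have dE : w.1 * u.2 - w.2 * u.1 = - (u.1 * w.2 - u.2 * w.1) by ring.
rewrite (@cov_aux p w u)//; last by rewrite dE oppr_eq0.
rewrite dE normrN; congr (_ * _)%E.
rewrite integral_leb2//; last exact: measurable_affine_comp.
rewrite integral_leb2_swap//; last exact: measurable_affine_comp.
apply: eq_integral => t _; apply: eq_integral => s _.
by congr (F (_, _)); rewrite addrAC.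
Qed.

End ChangeOfVariables.

(** * Null sets and linear combinations of integrals *)

Section NullSets.
Local Open Scope ereal_scope.
Context d (T : measurableType d) (R : realType) (mu : {measure set T -> \bar R}).
Variables (N : set T) (mN : measurable N) (N0 : mu N = 0).
Import HBNNSimple.

(** A simple function below [f] can be set to zero on the null set without changing
    its integral, and is then below [g]. Measurability of [f] is not available where
    this is used: the derivatives of a finite element function are only understood off
    the edges. *)
Lemma sup_sintegral_off_null (f g : T -> \bar R) :
  (forall x, 0 <= g x) -> (forall x, ~ N x -> f x = g x) ->
  ereal_sup [set sintegral mu h | h in [set h : {nnsfun T >-> R} | forall x, (h x)%:E <= f x]]
  <= ereal_sup [set sintegral mu h | h in [set h : {nnsfun T >-> R} | forall x, (h x)%:E <= g x]].
Proof.
move=> g0 fg; apply: ge_ereal_sup => _ [h /= hf <-].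
pose h' := proj_nnsfun h (measurableC mN).
have h'E x : h' x = if x \in N then 0%R else h x.
  rewrite /h' /proj_nnsfun/= mindicE in_setC.
  by case: ifPn => _; rewrite ?mulr0 ?mulr1.
have -> : sintegral mu h = sintegral mu h'.
  rewrite -!integralT_nnsfun; apply: ae_eq_integral => //.
  - exact/measurable_EFinP.
  - exact/measurable_EFinP.
  exists N; split => // x /= /not_implyP[_ hx]; apply: contrapT => Nx; apply: hx.
  by have := h'E x; rewrite memNset // => e; congr EFin; exact: esym e. 
apply: ereal_sup_ubound; exists h' => // x.
rewrite -[leLHS]/((h' x)%:E).
have := h'E x; case: ifPn => [_ ->|xN ->]; first exact: g0.
by rewrite -fg//; move: xN; rewrite notin_setE.
Qed.

Lemma integral_off_null (D : set T) (f g : T -> \bar R) :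
  (forall x, ~ N x -> (f \_ D) x = g x) ->
  \int[mu]_(x in D) f x = \int[mu]_x g x.
Proof.
move=> fg; rewrite integral_mkcond; have {}fg x : ~ N x -> (f \_ D) x = g x by exact: fg.
move: (f \_ D) fg => {}f fg; rewrite /integral !patch_setT.
congr (_ - _); apply/eqP; rewrite eq_le; apply/andP; split;
  by apply: sup_sintegral_off_null => // x Nx; rewrite ?funeposE ?funenegE fg.
Qed.

End NullSets.

Section LinearCombinations.
Context d (T : measurableType d) (R : realType) (mu : {measure set T -> \bar R}).
Context (I : Type) (k : I -> T -> R) (w : I -> R).
Hypothesis mk : forall i, measurable_fun setT (k i).
Hypothesis k0 : forall i x, 0 <= k i x.
Hypothesis kw : forall i, (\int[mu]_x (k i x)%:E = (w i)%:E)%E.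

Lemma Rintegral_lincomb (r : seq I) (c : I -> R) :
  mu.-integrable setT (EFin \o (fun x => \sum_(i <- r) c i * k i x)) /\
  Rintegral mu setT (fun x => \sum_(i <- r) c i * k i x) = \sum_(i <- r) c i * w i.
Proof.
have ik i : mu.-integrable setT (EFin \o k i).
  apply/integrableP; split; first exact/measurable_EFinP.
  under eq_integral do rewrite /= ger0_norm//.
  by rewrite kw ltry.
have ick i : mu.-integrable setT (EFin \o (fun x => c i * k i x)).
  have -> : EFin \o (fun x => c i * k i x) = (fun x => (c i)%:E * (k i x)%:E)%E by [].
  by have := integrableZl measurableT (c i) (ik i); apply: eq_integrable.
elim: r => [|i r [IH1 IH2]].
  split; last by rewrite big_nil; under eq_Rintegral do rewrite big_nil; rewrite Rintegral_cst// mul0r.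
  by under [X in EFin \o X]eq_fun do rewrite big_nil; exact: integrable0.
split.
  under [X in EFin \o X]eq_fun do rewrite big_cons.
  exact: (integrableD measurableT (ick i) IH1).
rewrite big_cons; under eq_Rintegral do rewrite big_cons.
rewrite RintegralD// RintegralZl// IH2; congr (_ * _ + _).
by rewrite /Rintegral kw.
Qed.

(** All inner products of finite element functions are computed in this way: off a
    null set, the integrand is a finite combination of nonnegative kernels with known
    integrals. *)
Lemma Cintegral_lincomb (D N : set T) (r : seq I) (c : I -> R[i]) (F : T -> R[i]) :
  measurable N -> mu N = 0%E ->
  (forall x, ~ N x -> (if x \in D then F x else 0) = \sum_(i <- r) c i * (k i x)%:C) ->
  Cintegral mu D F = \sum_(i <- r) c i * (w i)%:C.
Proof.
move=> mN N0 FE.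
have part (p : R[i] -> R) : p 0 = 0 -> (forall a b, p (a + b) = p a + p b) ->
    (forall a (b : R), p (a * b%:C) = p a * b) ->
    Rintegral mu D (fun x => p (F x)) = \sum_(i <- r) p (c i) * w i.
  move=> p0 pD pZ; rewrite -(Rintegral_lincomb _ _).2 /Rintegral; congr fine.
  apply: (integral_off_null mN N0) => x Nx.
  have <- : p (if x \in D then F x else 0) = \sum_(i <- r) p (c i) * k i x.
    by rewrite FE// (big_morph p pD p0); apply: eq_bigr => i _.
  by rewrite patchE; case: ifP; rewrite ?p0.
have sumE (f : I -> R[i]) : \sum_(i <- r) f i =
    (\sum_(i <- r) complex.Re (f i)) +i* (\sum_(i <- r) complex.Im (f i)).
  elim: r {FE part} => [|i r IH]; first by rewrite !big_nil.
  by rewrite !big_cons IH; case: (f i).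
rewrite /Cintegral !part//= ?sumE.
- congr (_ +i* _); apply: eq_bigr => i _; case: (c i) => a b /=; ring.
- by case=> a b [].
- by case=> a b z /=; ring.
- by case=> a b [].
- by case=> a b z /=; ring.
Qed.

End LinearCombinations.

(** * The reference triangle *)

Section ReferenceTriangle.
Variable R : realType.
Local Notation leb := (@lebesgue_measure R).
Local Notation mR := (measurableTypeR R).
Local Notation leb2 := (@leb2 R).

(** The slices along one of the axes have at most one point. *)
Lemma leb2_line (a b c : R) : (a != 0) || (b != 0) ->
  measurable [set x : mR * mR | a * x.1 + b * x.2 + c = 0] /\
  leb2 [set x : mR * mR | a * x.1 + b * x.2 + c = 0] = 0%E.
Proof.
move=> ab; set L := [set x : mR * mR | _].
pose f (x : mR * mR) : R := a * x.1 + b * x.2 + c.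
have mf : measurable_fun setT f.
  apply: measurable_funD => //; apply: measurable_funD; exact: measurable_funM.
have mL : measurable L.
  have -> : L = setT `&` f @^-1` [set 0] by rewrite setTI.
  exact: mf.
split => //.
have mi : measurable_fun setT (fun x : mR * mR => (\1_L x)%:E : \bar R).
  by apply/measurable_EFinP; exact: measurable_indic.
have i0 x : (0 <= (\1_L x : R)%:E)%E by rewrite lee_fin.
have <- : (\int[leb2]_x (\1_L x)%:E = leb2 L)%E by rewrite integral_indic// setIT.
have slice (h : R -> mR * mR) (u : R) : (forall t, L (h t) -> t = u) ->
    (\int[leb]_t (\1_L (h t) : R)%:E = 0)%E.
  move=> hu; rewrite -(integral0 leb setT).
  apply: (@integral_off_null _ _ _ leb [set u]) => //.
    exact: lebesgue_measure_set1.
  move=> t tu; rewrite patch_setT indicE memNset// => /hu; exact: tu.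
have [b0|b0] := eqVneq b 0.
- rewrite b0 eqxx orbF in ab.
  rewrite integral_leb2_swap//; apply: integral0_eq => y _.
  apply: (slice _ (- c / a)) => t; rewrite /L/= b0 mul0r => E.
  by apply/(canRL (mulfK ab)); lra.
- rewrite integral_leb2//; apply: integral0_eq => x _.
  apply: (slice _ (- (a * x + c) / b)) => t; rewrite /L/= => E.
  by apply/(canRL (mulfK b0)); lra.
Qed.

(** The vertices of the reference triangle are (0,0), (1,0) and (0,1), in this order. *)
Definition rbary (x : R * R) (i : 'I_3) : R := nth 0 [:: 1 - x.1 - x.2; x.1; x.2] i.

Definition o0 : 'I_3 := @Ordinal 3 0 isT.
Definition o1 : 'I_3 := @Ordinal 3 1 isT.
Definition o2 : 'I_3 := @Ordinal 3 2 isT.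

Lemma I3P (P : 'I_3 -> Prop) : P o0 -> P o1 -> P o2 -> forall i, P i.
Proof.
by move=> p0 p1 p2 [[|[|[|//]]] Hi]; [move: p0|move: p1|move: p2];
  congr P; apply: val_inj.
Qed.

Lemma forall_I3 (P : pred 'I_3) : [forall i, P i] = [&& P o0, P o1 & P o2].
Proof.
apply/forallP/and3P => [H|[? ? ?]]; first by split; apply: H.
exact: I3P.
Qed.

Lemma big_I3 (V : nmodType) (F : 'I_3 -> V) : \sum_i F i = F o0 + F o1 + F o2.
Proof.
rewrite !big_ord_recl big_ord0 addr0 addrA.
by congr (F _ + F _ + F _); apply: val_inj.
Qed.

(** The three kernels below are functions of barycentric coordinates on a triangle:
    its indicator, the product of two hat functions, and the product of a hat function
    with the indicator of the dual cell of a vertex. The dual cell of the vertex [j]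
    is where the barycentric coordinate at [j] is the largest one. *)
Definition inside (l : 'I_3 -> R) : bool := [forall i, 0 < l i].
Definition unitk (l : 'I_3 -> R) : R := if inside l then 1 else 0.
Definition massk (i j : 'I_3) (l : 'I_3 -> R) : R := if inside l then l i * l j else 0.
Definition nearest (j : 'I_3) (l : 'I_3 -> R) : bool := [forall k, l k <= l j].
Definition lumpk (i j : 'I_3) (l : 'I_3 -> R) : R :=
  if inside l && nearest j l then l i else 0.

Section Measurability.
Variable lam : mR * mR -> 'I_3 -> R.
Hypothesis mlam : forall i, measurable_fun setT (lam ^~ i).

Lemma measurable_inside : measurable_fun setT (fun x => inside (lam x)).
Proof.
rewrite /inside; under eq_fun do rewrite forall_I3.
by apply: measurable_and; [|apply: measurable_and]; apply: measurable_fun_ltr.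
Qed.

Lemma measurable_nearest j : measurable_fun setT (fun x => nearest j (lam x)).
Proof.
rewrite /nearest; under eq_fun do rewrite forall_I3.
by apply: measurable_and; [|apply: measurable_and]; apply: measurable_fun_ler.
Qed.

Lemma measurable_unitk : measurable_fun setT (fun x => unitk (lam x)).
Proof. by apply: measurable_fun_ifT => //; exact: measurable_inside. Qed.

Lemma measurable_massk i j : measurable_fun setT (fun x => massk i j (lam x)).
Proof.
apply: measurable_fun_ifT => //; first exact: measurable_inside.
exact: measurable_funM.
Qed.

Lemma measurable_lumpk i j : measurable_fun setT (fun x => lumpk i j (lam x)).
Proof.
apply: measurable_fun_ifT => //; apply: measurable_and; first exact: measurable_inside.
exact: measurable_nearest.
Qed.

End Measurability.

Lemma unitk_ge0 l : 0 <= unitk l.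
Proof. by rewrite /unitk; case: ifP. Qed.

Lemma massk_ge0 i j l : 0 <= massk i j l.
Proof.
rewrite /massk; case: ifP => // /forallP l0.
by rewrite mulr_ge0 ?ltW.
Qed.

Lemma lumpk_ge0 i j l : 0 <= lumpk i j l.
Proof. by rewrite /lumpk; case: ifP => // /andP[/forallP l0 _]; exact: ltW. Qed.

Lemma measurable_rbary i : measurable_fun setT (fun x : mR * mR => rbary x i).
Proof.
elim/I3P: i; rewrite /rbary/=; last 2 first.
- exact: measurable_fst.
- exact: measurable_snd.
by apply: measurable_funB => //; apply: measurable_funB.
Qed.

Definition ref_int (k : ('I_3 -> R) -> R) : \bar R := (\int[leb2]_x (k (rbary x))%:E)%E.

Definition swap01 (i : 'I_3) := nth o0 [:: o1; o0; o2] i.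
Definition swap12 (i : 'I_3) := nth o0 [:: o0; o2; o1] i.

(** Measurability is asked for after composition with arbitrary measurable
    coordinates, so that it serves all triangles at once. *)
Definition ref_kernel (k : ('I_3 -> R) -> R) :=
  (forall l, 0 <= k l) /\ forall lam : mR * mR -> 'I_3 -> R,
  (forall i, measurable_fun setT (lam ^~ i)) -> measurable_fun setT (fun x => k (lam x)).

(** The affine maps that exchange two vertices of the reference triangle have
    determinant -1. *)
Lemma ref_int_sym (k : ('I_3 -> R) -> R) : ref_kernel k ->
  ref_int (fun l => k (l \o swap01)) = ref_int k /\
  ref_int (fun l => k (l \o swap12)) = ref_int k.
Proof.
move=> [k0 mk].
have mF : measurable_fun setT (fun x : mR * mR => (k (rbary x))%:E).
  by apply/measurable_EFinP; apply: mk => i; exact: measurable_rbary.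
have F0 x : (0 <= (k (rbary x))%:E)%E by rewrite lee_fin.
split; rewrite /ref_int.
- rewrite [RHS](@ge0_integral_affine2 _ (1, 0) (-1, 0) (-1, 1))//=.
  rewrite (_ : -1 * 1 - 0 * -1 = -1); last by ring.
  rewrite normrN1 mul1e; apply: eq_integral => x _.
  congr (k _)%:E; apply/funext; elim/I3P; rewrite /rbary/=; ring.
- rewrite [RHS](@ge0_integral_affine2 _ (0, 0) (0, 1) (1, 0))//=.
  rewrite (_ : 0 * 0 - 1 * 1 = -1); last by ring.
  rewrite normrN1 mul1e; apply: eq_integral => x _.
  congr (k _)%:E; apply/funext; elim/I3P; rewrite /rbary/=; ring.
Qed.

Lemma leb2_square (a b : R) : a < b ->
  leb2 (`[a, b]%classic `*` `[a, b]%classic) = ((b - a) ^+ 2)%:E.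
Proof.
move=> ab.
have E : leb `[a, b]%classic = (b - a)%:E.
  by rewrite lebesgue_measure_itv/= lte_fin ab EFinB.
rewrite /Defs.leb2 product_measure1E// expr2 EFinM.
exact: (congr2 (fun x y : \bar R => (x * y)%E) E E).
Qed.

Lemma measurable_square (a b : R) :
  measurable ((`[a, b]%classic `*` `[a, b]%classic) : set (mR * mR)).
Proof. exact: measurableX. Qed.

Lemma ref_int_fin (k : ('I_3 -> R) -> R) : ref_kernel k ->
  (forall l, ~~ inside l -> k l = 0) ->
  (forall l, inside l -> l o0 + l o1 + l o2 = 1 -> k l <= 1) ->
  ref_int k \is a fin_num.
Proof.
move=> [k0 mk] kn k1.
rewrite ge0_fin_numE; last by apply: integral_ge0 => x _; rewrite lee_fin.
pose B : set (mR * mR) := `[0, 1]%classic `*` `[0, 1]%classic.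
have mB : measurable B by exact: measurable_square.
apply: (@le_lt_trans _ _ (leb2 B)); last by rewrite leb2_square// ltry.
have <- : (\int[leb2]_x (\1_B x)%:E = leb2 B)%E by rewrite integral_indic// setIT.
apply: ge0_le_integral => //.
- by move=> x _; rewrite lee_fin.
- by apply/measurable_EFinP; apply: mk => i; exact: measurable_rbary.
- by apply/measurable_EFinP; exact: measurable_indic.
move=> x _; rewrite lee_fin; have [xin|/kn->//] := boolP (inside (rbary x)).
rewrite indicE mem_set.
  by apply: k1 => //; rewrite /rbary/=; ring.
move: xin; rewrite /inside forall_I3 /rbary/= => /and3P[? ? ?].
by split; rewrite /= in_itv/=; apply/andP; split; lra.
Qed.

End ReferenceTriangle.

(** * Reference mass matrices *)

Section ReferenceConstants.
Variable R : realType.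
Local Notation leb := (@lebesgue_measure R).
Local Notation mR := (measurableTypeR R).
Local Notation leb2 := (@leb2 R).
Implicit Types (l : 'I_3 -> R).

Lemma kernel_unitk : ref_kernel (@unitk R).
Proof. by split; [exact: unitk_ge0|exact: measurable_unitk]. Qed.

Lemma kernel_massk i j : ref_kernel (@massk R i j).
Proof.
by split; [exact: massk_ge0|move=> lam mlam; exact: measurable_massk].
Qed.

Lemma kernel_lumpk i j : ref_kernel (@lumpk R i j).
Proof.
by split; [exact: lumpk_ge0|move=> lam mlam; exact: measurable_lumpk].
Qed.

Lemma inside_le1 l : inside l -> l o0 + l o1 + l o2 = 1 -> forall i, 0 < l i <= 1.
Proof.
by rewrite /inside forall_I3 => /and3P[? ? ?] ?; elim/I3P; apply/andP; split; lra.
Qed.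

Lemma unitk_fin : ref_int (@unitk R) \is a fin_num.
Proof.
apply: ref_int_fin; first exact: kernel_unitk.
- by move=> l /negbTE; rewrite /unitk => ->.
- by move=> l; rewrite /unitk => ->.
Qed.

Lemma massk_fin i j : ref_int (@massk R i j) \is a fin_num.
Proof.
apply: ref_int_fin; first exact: kernel_massk.
- by move=> l /negbTE; rewrite /massk => ->.
- move=> l li ls; rewrite /massk li.
  have /andP[? ?] := inside_le1 li ls i; have /andP[? ?] := inside_le1 li ls j.
  by rewrite mulr_ile1// ltW.
Qed.

Lemma lumpk_fin i j : ref_int (@lumpk R i j) \is a fin_num.
Proof.
apply: ref_int_fin; first exact: kernel_lumpk.
- by move=> l /negbTE; rewrite /lumpk => ->.
- move=> l li ls; rewrite /lumpk li/=; case: ifP => // _.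
  by have /andP[] := inside_le1 li ls i.
Qed.

(** The two transpositions generate the symmetric group on the three vertices, which
    has two orbits on pairs of vertices: the diagonal and its complement. *)
Lemma S3_invariant (f : 'I_3 -> 'I_3 -> R) :
  (forall i j, f (swap01 i) (swap01 j) = f i j) ->
  (forall i j, f (swap12 i) (swap12 j) = f i j) ->
  forall i j, f i j = (i == j)%:R * (f o0 o0 - f o0 o1) + f o0 o1.
Proof.
move=> f01 f12.
have := (f01 o0 o0, f12 o1 o1, f01 o0 o1, f12 o0 o1, f12 o1 o0, f01 o0 o2, f01 o2 o0).
rewrite /swap01 /swap12/= => -[[[[[[e1 e2] e3] e4] e5] e6] e7].
have -> : f o0 o0 = f o1 o1 by rewrite e1.
by elim/I3P; elim/I3P => /=; rewrite ?eqxx /=; lra.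
Qed.

Let kernel_swap (k : 'I_3 -> 'I_3 -> ('I_3 -> R) -> R) :
  (forall i j, ref_kernel (k i j)) ->
  (forall s, s = swap01 \/ s = swap12 -> forall i j l, k i j (l \o s) = k (s i) (s j) l) ->
  forall i j, fine (ref_int (k i j)) =
    (i == j)%:R * (fine (ref_int (k o0 o0)) - fine (ref_int (k o0 o1))) + fine (ref_int (k o0 o1)).
Proof.
move=> kk ks; apply: (@S3_invariant (fun i j => fine (ref_int (k i j)))) => i j.
- rewrite -[in RHS](ref_int_sym (kk i j)).1; congr (fine (ref_int _)).
  by apply/funext => l; rewrite ks//; left.
- rewrite -[in RHS](ref_int_sym (kk i j)).2; congr (fine (ref_int _)).
  by apply/funext => l; rewrite ks//; right.
Qed.

Let inside_swap s l : s = swap01 \/ s = swap12 -> inside (l \o s) = inside l.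
Proof.
rewrite /inside !forall_I3 => -[]->; rewrite /swap01 /swap12/=.
  by rewrite andbCA.
by rewrite (andbC (0 < l o2)).
Qed.

Let nearest_swap s j l : s = swap01 \/ s = swap12 -> nearest j (l \o s) = nearest (s j) l.
Proof.
rewrite /nearest !forall_I3 => -[]->; rewrite /swap01 /swap12/=.
  by rewrite andbCA.
by rewrite (andbC (l o2 <= _)).
Qed.

Definition tri_area : R := fine (ref_int (@unitk R)).
(** By symmetry, the mass matrices of the reference triangle have the form [d I + o
    J], where [J] has all entries equal to 1. The signs of these constants and the
    relation [lump_massE] are all that enters the estimates. *)
Definition mass_off : R := fine (ref_int (@massk R o0 o1)).
Definition mass_diag : R := fine (ref_int (@massk R o0 o0)) - mass_off.
Definition lump_off : R := fine (ref_int (@lumpk R o0 o1)).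
Definition lump_diag : R := fine (ref_int (@lumpk R o0 o0)) - lump_off.

Lemma ref_unitkE : ref_int (@unitk R) = tri_area%:E.
Proof. by rewrite fineK// unitk_fin. Qed.

Lemma ref_masskE i j : ref_int (@massk R i j) = ((i == j)%:R * mass_diag + mass_off)%:E.
Proof.
rewrite -(@kernel_swap (fun i j => @massk R i j)) ?fineK ?massk_fin//.
  exact: kernel_massk.
by move=> s hs i' j' l; rewrite /massk inside_swap.
Qed.

Lemma ref_lumpkE i j : ref_int (@lumpk R i j) = ((i == j)%:R * lump_diag + lump_off)%:E.
Proof.
rewrite -(@kernel_swap (fun i j => @lumpk R i j)) ?fineK ?lumpk_fin//.
  exact: kernel_lumpk.
by move=> s hs i' j' l; rewrite /lumpk inside_swap// nearest_swap.
Qed.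

Lemma mass_off_ge0 : 0 <= mass_off.
Proof. by apply/fine_ge0/integral_ge0 => x _; rewrite lee_fin massk_ge0. Qed.

Lemma lump_off_ge0 : 0 <= lump_off.
Proof. by apply/fine_ge0/integral_ge0 => x _; rewrite lee_fin lumpk_ge0. Qed.

Let lincomb_ref (I : Type) (k : I -> ('I_3 -> R) -> R) (w : I -> R) (r : seq I) (c : I -> R) :
  (forall i, ref_kernel (k i)) -> (forall i, ref_int (k i) = (w i)%:E) ->
  leb2.-integrable setT (EFin \o (fun x : mR * mR => \sum_(i <- r) c i * k i (rbary x))) /\
  Rintegral leb2 setT (fun x : mR * mR => \sum_(i <- r) c i * k i (rbary x))
    = \sum_(i <- r) c i * w i.
Proof.
move=> kk kw.
apply: (@Rintegral_lincomb _ _ _ leb2 I (fun i (x : mR * mR) => k i (rbary x)) w) => //.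
- by move=> i; apply: (kk i).2 => j; exact: measurable_rbary.
- by move=> i x; exact: (kk i).1.
Qed.

Let ties : set (mR * mR) :=
  [set x | (-2) * x.1 + (-1) * x.2 + 1 = 0] `|` [set x | (-1) * x.1 + (-2) * x.2 + 1 = 0]
  `|` [set x | 1 * x.1 + (-1) * x.2 + 0 = 0].

Let ties_null : measurable ties /\ leb2 ties = 0%E.
Proof.
have [m1 n1] : _ /\ _ := @leb2_line R (-2) (-1) 1 ltac:(by rewrite oppr_eq0 pnatr_eq0).
have [m2 n2] : _ /\ _ := @leb2_line R (-1) (-2) 1 ltac:(by rewrite oppr_eq0 oner_eq0).
have [m3 n3] : _ /\ _ := @leb2_line R 1 (-1) 0 ltac:(by rewrite oner_eq0).
split; first by apply: measurableU => //; exact: measurableU.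
apply: (@null_set_setU _ _ _ (leb \x leb)%E) => //; first exact: measurableU.
exact: (@null_set_setU _ _ _ (leb \x leb)%E).
Qed.

Let bary_sum (x : R * R) : rbary x o0 + rbary x o1 + rbary x o2 = 1.
Proof. by rewrite /rbary/=; ring. Qed.

(** Both sides are row sums, and every row sum is the integral of a hat function: the
    hat functions add up to 1, and the dual cells partition the triangle up to the
    null set of ties. *)
Lemma lump_massE : lump_diag + 3 * lump_off = mass_diag + 3 * mass_off.
Proof.
have [_ E1] := @lincomb_ref 'I_3 (fun j => @lumpk R o0 j) _ (index_enum 'I_3) (fun=> 1)
  (kernel_lumpk o0) (ref_lumpkE o0).
have [_ E2] := @lincomb_ref 'I_3 (fun j => @massk R o0 j) _ (index_enum 'I_3) (fun=> 1)
  (kernel_massk o0) (ref_masskE o0).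
have : \sum_j 1 * ((o0 == j)%:R * lump_diag + lump_off)
     = \sum_j 1 * ((o0 == j)%:R * mass_diag + mass_off).
  rewrite -E1 -E2 /Rintegral; congr fine.
  apply: (integral_off_null ties_null.1 ties_null.2) => x xt.
  rewrite patch_setT; congr EFin; rewrite !big_I3 !mul1r.
  move: xt (bary_sum x); rewrite /ties /lumpk /massk /nearest !forall_I3.
  set l := rbary x => xt ls.
  have t01 : l o0 != l o1.
    by apply: contra_notN xt => /eqP; rewrite /l /rbary/= => e; left; left => /=; lra.
  have t02 : l o0 != l o2.
    by apply: contra_notN xt => /eqP; rewrite /l /rbary/= => e; left; right => /=; lra.
  have t12 : l o1 != l o2.
    by apply: contra_notN xt => /eqP; rewrite /l /rbary/= => e; right => /=; lra.
  case: (boolP (inside l)) => li; last by rewrite /= !addr0.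
  rewrite -!mulrDr ls mulr1 /= !lexx /=.
  case: (ltgtP (l o0) (l o1)) t01 => // ? _; case: (ltgtP (l o0) (l o2)) t02 => // ? _;
  case: (ltgtP (l o1) (l o2)) t12 => // ? _ /=; lra.
by rewrite !big_I3 /= !mul1r; lra.
Qed.

(** On this square, all barycentric coordinates are positive and the first one is the
    largest. *)
Let square_pos (f : mR * mR -> R) (e : R) : 0 < e ->
  leb2.-integrable setT (EFin \o f) -> (forall x, 0 <= f x) ->
  (forall x, 8^-1 <= x.1 <= 4^-1 -> 8^-1 <= x.2 <= 4^-1 -> e <= f x) ->
  0 < Rintegral leb2 setT f.
Proof.
move=> e0 intf f0 fe.
pose B : set (mR * mR) := `[8^-1, 4^-1]%classic `*` `[8^-1, 4^-1]%classic.
have mB : measurable B by exact: measurable_square.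
have ab : (8^-1 : R) < 4^-1 by lra.
have BE : leb2 B = ((4^-1 - 8^-1) ^+ 2)%:E by exact: leb2_square.
have iB : leb2.-integrable setT (EFin \o (\1_B : mR * mR -> R)).
  apply/integrableP; split; first by apply/measurable_EFinP; exact: measurable_indic.
  under eq_integral do rewrite /= ger0_norm//.
  by rewrite integral_indic// setIT [X in (X < _)%E]BE ltry.
have mi : measurable_fun setT (fun x : mR * mR => \1_B x : R) by exact: measurable_indic.
have <- : Rintegral leb2 setT (fun=> 0) = 0 by rewrite Rintegral_cst// mul0r.
apply: (@lt_le_trans _ _ (Rintegral leb2 setT (fun x => e * \1_B x))).
  rewrite Rintegral_cst// mul0r RintegralZl// mulr_gt0//.
  by rewrite /Rintegral integral_indic// setIT [X in fine X]BE/= exprn_gt0// subr_gt0.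
apply: le_Rintegral => //.
  by have := integrableZl measurableT e iB; apply: eq_integrable.
move=> x _; rewrite indicE; case: (boolP (x \in B)) => [/set_mem|_]; last by rewrite mulr0.
by rewrite /B /= !in_itv/= mulr1 => -[? ?]; exact: fe.
Qed.

(** The quadratic form of the mass matrix at the vector (1, -1, 0) is twice this
    constant, and it is the integral of a square. *)
Lemma mass_diag_gt0 : 0 < mass_diag.
Proof.
pose sgn (p : 'I_3 * 'I_3) : R := if p.1 == p.2 then 1 else -1.
have [iE E] := @lincomb_ref ('I_3 * 'I_3)%type (fun p => @massk R p.1 p.2) _
  [:: (o0, o0); (o0, o1); (o1, o0); (o1, o1)] sgn
  (fun p => kernel_massk p.1 p.2) (fun p => ref_masskE p.1 p.2).
have kE (x : R * R) : \sum_(p <- [:: (o0, o0); (o0, o1); (o1, o0); (o1, o1)])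
    sgn p * @massk R p.1 p.2 (rbary x) =
    if inside (rbary x) then (rbary x o0 - rbary x o1) ^+ 2 else 0.
  rewrite !big_cons big_nil /sgn /massk /=; case: ifP => _; last by rewrite !mulr0 !addr0.
  ring.
have : 0 < 2 * mass_diag.
  have -> : 2 * mass_diag = \sum_(p <- [:: (o0, o0); (o0, o1); (o1, o0); (o1, o1)])
      sgn p * ((p.1 == p.2)%:R * mass_diag + mass_off).
    by rewrite !big_cons big_nil /sgn/=; ring.
  rewrite -E; apply: (@square_pos _ (16^-1)) => //.
    by move=> x; rewrite kE; case: ifP => // _; exact: sqr_ge0.
  move=> x /andP[? ?] /andP[? ?]; rewrite kE ifT; last first.
    by rewrite /inside forall_I3 /rbary/=; apply/and3P; split; lra.
  have h : 4^-1 <= rbary x o0 - rbary x o1 by rewrite /rbary/=; lra.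
  have -> : (16^-1 : R) = 4^-1 ^+ 2 by field.
  by rewrite lerXn2r// nnegrE; lra.
lra.
Qed.

(** On the dual cell of a vertex, the hat function of this vertex dominates the
    others. *)
Lemma lump_diag_gt0 : 0 < lump_diag.
Proof.
pose sgn (i : 'I_3) : R := if i == o0 then 1 else -1.
have [iE E] := @lincomb_ref 'I_3 (fun i => @lumpk R i o0) _ [:: o0; o1] sgn
  (fun i => kernel_lumpk i o0) (fun i => ref_lumpkE i o0).
have kE (x : R * R) : \sum_(i <- [:: o0; o1]) sgn i * @lumpk R i o0 (rbary x) =
    if inside (rbary x) && nearest o0 (rbary x) then rbary x o0 - rbary x o1 else 0.
  rewrite !big_cons big_nil /sgn /lumpk /=; case: ifP => _; last by rewrite !mulr0 !addr0.
  ring.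
have -> : lump_diag = \sum_(i <- [:: o0; o1]) sgn i * ((i == o0)%:R * lump_diag + lump_off).
  by rewrite !big_cons big_nil /sgn/=; ring.
rewrite -E; apply: (@square_pos _ (4^-1)) => //.
  move=> x; rewrite kE; case: ifP => // /andP[_]; rewrite /nearest forall_I3 => /and3P[_ ? _].
  by rewrite subr_ge0.
move=> x /andP[? ?] /andP[? ?]; rewrite kE ifT; first by rewrite /rbary/=; lra.
by rewrite /inside /nearest !forall_I3 /rbary/=; apply/andP; split; apply/and3P; split; lra.
Qed.

Lemma tri_area_gt0 : 0 < tri_area.
Proof.
have [iE E] := @lincomb_ref unit (fun=> @unitk R) _ [:: tt] (fun=> 1)
  (fun=> kernel_unitk) (fun=> ref_unitkE).
have -> : tri_area = \sum_(i <- [:: tt]) 1 * tri_area by rewrite big_seq1 mul1r.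
rewrite -E; apply: (@square_pos _ 1) => //.
  by move=> x; rewrite big_seq1 mul1r unitk_ge0.
move=> x /andP[? ?] /andP[? ?]; rewrite big_seq1 mul1r /unitk ifT//.
by rewrite /inside !forall_I3 /rbary/=; apply/and3P; split; lra.
Qed.

End ReferenceConstants.

(** * Triangles and barycentric coordinates *)

Section Triangles.
Variable R : realType.
Local Notation mR := (measurableTypeR R).
Local Notation leb2 := (@leb2 R).
Local Notation conv := Defs.conv.
Implicit Types (K L : {fset R * R}) (x y : R * R).

(** The numbering of the vertices is the one of the enumeration of [K] and carries no
    meaning. *)
Definition vtx K (i : 'I_3) : R * R := nth (0, 0) (enum_fset K) i.

Lemma big_vtx (V : nmodType) K (F : R * R -> V) : #|` K| = 3%N ->
  \sum_(p <- K) F p = \sum_(i < 3) F (vtx K i).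
Proof. by move=> K3; rewrite (big_nth (0, 0)) K3 big_mkord. Qed.

Lemma vtx_in K i : #|` K| = 3%N -> vtx K i \in K.
Proof. by move=> K3; rewrite /vtx mem_nth// K3. Qed.

Lemma vtx_inj K : #|` K| = 3%N -> injective (vtx K).
Proof.
move=> K3 i j /eqP; rewrite /vtx nth_uniq ?K3//; last exact: fset_uniq.
by move/eqP/val_inj.
Qed.

Lemma vtxP K p : #|` K| = 3%N -> p \in K -> exists i, p = vtx K i.
Proof.
move=> K3 pK; have ip : (index p (enum_fset K) < 3)%N by rewrite -K3 index_mem.
by exists (Ordinal ip); rewrite /vtx/= nth_index.
Qed.

Definition edge1 K : R * R := ((vtx K o1).1 - (vtx K o0).1, (vtx K o1).2 - (vtx K o0).2).
Definition edge2 K : R * R := ((vtx K o2).1 - (vtx K o0).1, (vtx K o2).2 - (vtx K o0).2).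
Definition jac K : R := (edge1 K).1 * (edge2 K).2 - (edge1 K).2 * (edge2 K).1.

(** Cramer's rule for the frame of the two edges at the first vertex. *)
Definition loc K x : R * R :=
  (((x.1 - (vtx K o0).1) * (edge2 K).2 - (x.2 - (vtx K o0).2) * (edge2 K).1) / jac K,
   ((edge1 K).1 * (x.2 - (vtx K o0).2) - (edge1 K).2 * (x.1 - (vtx K o0).1)) / jac K).

Definition lam K x : 'I_3 -> R := rbary (loc K x).

Lemma loc_frame K (s t : R) : jac K != 0 ->
  loc K ((vtx K o0).1 + s * (edge1 K).1 + t * (edge2 K).1,
         (vtx K o0).2 + s * (edge1 K).2 + t * (edge2 K).2) = (s, t).
Proof. by rewrite /loc /jac/= => j0; congr (_, _); field. Qed.

Lemma lam_sum K x : \sum_i lam K x i = 1.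
Proof. by rewrite big_I3 /lam /rbary/=; ring. Qed.

Lemma lam_point K x : jac K != 0 ->
  x.1 = \sum_i lam K x i * (vtx K i).1 /\ x.2 = \sum_i lam K x i * (vtx K i).2.
Proof.
rewrite !big_I3 /lam /rbary/= /jac /edge1 /edge2/= => j0; split; field; exact: j0.
Qed.

Lemma lam_unique K x (w : 'I_3 -> R) : jac K != 0 -> \sum_i w i = 1 ->
  x.1 = \sum_i w i * (vtx K i).1 -> x.2 = \sum_i w i * (vtx K i).2 -> lam K x = w.
Proof.
move=> j0; rewrite !big_I3 => w1 x1 x2; apply/funext.
have w0 : w o0 = 1 - w o1 - w o2 by rewrite -w1; ring.
have E : x = ((vtx K o0).1 + w o1 * (edge1 K).1 + w o2 * (edge2 K).1,
         (vtx K o0).2 + w o1 * (edge1 K).2 + w o2 * (edge2 K).2).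
  by rewrite [LHS]surjective_pairing x1 x2 w0 /edge1 /edge2/=; congr (_, _); ring.
rewrite /lam E loc_frame//; elim/I3P => //=; rewrite /rbary/= ?w0//.
Qed.

Lemma conv_vtx K x : #|` K| = 3%N -> conv K x <-> exists w : 'I_3 -> R,
  [/\ forall i, 0 <= w i, \sum_i w i = 1,
      x.1 = \sum_i w i * (vtx K i).1 & x.2 = \sum_i w i * (vtx K i).2].
Proof.
move=> K3; split=> [[w []]|[w [w0 w1 x1 x2]]].
  rewrite !big_vtx// => w0 w1 x1 x2; exists (w \o vtx K); split => // i.
  by apply: w0; exact: vtx_in.
pose w' p := if [pick i | vtx K i == p] is Some i then w i else 0.
have w'E i : w' (vtx K i) = w i.
  rewrite /w'; case: pickP => [j /eqP/(vtx_inj K3)->//|/(_ i)].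
  by rewrite eqxx.
exists w'; rewrite !big_vtx//; split => //.
- by move=> p _; rewrite /w'; case: pickP.
- by rewrite -w1; apply: eq_bigr => i _.
- by rewrite x1; apply: eq_bigr => i _; rewrite w'E.
- by rewrite x2; apply: eq_bigr => i _; rewrite w'E.
Qed.

Lemma conv_lam K x : #|` K| = 3%N -> jac K != 0 ->
  conv K x <-> forall i, 0 <= lam K x i.
Proof.
move=> K3 j0; rewrite conv_vtx//; split=> [[w [w0 w1 x1 x2]] i|l0].
  by rewrite (lam_unique j0 w1 x1 x2).
exists (lam K x); have [? ?] := lam_point x j0; split => //; exact: lam_sum.
Qed.

Lemma inside_conv K x : #|` K| = 3%N -> jac K != 0 -> inside (lam K x) -> conv K x.
Proof. by move=> K3 j0 /forallP l0; apply/(conv_lam _ K3 j0) => i; exact: ltW. Qed.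

(** The hull of three collinear points lies on a line, and a small displacement of an
    interior point along the normal of this line would stay in the hull. *)
Lemma jac_neq0 K : #|` K| = 3%N -> (conv K)° !=set0 -> jac K != 0.
Proof.
move=> K3 [y]; rewrite /interior => Ky; apply/negP => /eqP j0.
pose n : R * R := (- (edge1 K).2, (edge1 K).1).
have on_line x : conv K x ->
    n.1 * (x.1 - (vtx K o0).1) + n.2 * (x.2 - (vtx K o0).2) = 0.
  rewrite conv_vtx// => -[w [_]]; rewrite !big_I3 => w1 -> ->.
  have -> : w o0 = 1 - w o1 - w o2 by rewrite -w1; ring.
  transitivity (w o2 * jac K); last by rewrite j0 mulr0.
  by rewrite /jac /n /edge1 /edge2/=; ring.
have cn : (fun e : R => (y.1 + e * n.1, y.2 + e * n.2)) @ (0 : R) --> (y.1 + 0 * n.1, y.2 + 0 * n.2).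
  apply: (@cvg_pair _ _ _ (nbhs (0 : R)) (nbhs (y.1 + 0 * n.1)) (nbhs (y.2 + 0 * n.2))); (apply: cvgD; first exact: cvg_cst);
    by apply: cvgM; [exact: cvg_id|exact: cvg_cst].
have : \forall e \near (0 : R), conv K (y.1 + e * n.1, y.2 + e * n.2).
  by apply: cn; rewrite !mul0r !addr0 -surjective_pairing.
move=> /nbhs_ballP[r /= r0 rK].
have h0 := on_line _ (rK 0 (ballxx _ r0)).
have /on_line h1 : conv K (y.1 + (r / 2) * n.1, y.2 + (r / 2) * n.2).
  apply: rK; rewrite -ball_normE/= sub0r normrN gtr0_norm ?divr_gt0//.
  by rewrite ltr_pdivrMr// ltr_pMr// ltr1n.
have nn : n.1 ^+ 2 + n.2 ^+ 2 = 0.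
  apply: (@mulfI _ (r / 2)); first by rewrite gt_eqF// divr_gt0.
  by rewrite mulr0 -[RHS](subrr 0) -{1}h1 -h0/=; ring.
have /andP[/eqP n1 /eqP n2] : (n.1 == 0) && (n.2 == 0).
  by rewrite -(sqrf_eq0 n.1) -(sqrf_eq0 n.2) -paddr_eq0 ?sqr_ge0// nn.
have : vtx K o1 = vtx K o0.
  rewrite [LHS]surjective_pairing [RHS]surjective_pairing.
  move: n1 n2; rewrite /n /edge1/= => n1 n2; congr (_, _); lra.
by move/(vtx_inj K3).
Qed.

Lemma measurable_lam K i : measurable_fun setT (fun x : mR * mR => lam K x i).
Proof.
have m1 : measurable_fun setT (fun x : mR * mR => (loc K x).1).
  by apply: measurable_funM => //; apply: measurable_funB; apply: measurable_funM => //;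
    apply: measurable_funB.
have m2 : measurable_fun setT (fun x : mR * mR => (loc K x).2).
  by apply: measurable_funM => //; apply: measurable_funB; apply: measurable_funM => //;
    apply: measurable_funB.
elim/I3P: i => //; rewrite /lam /rbary/=.
by apply: measurable_funB => //; apply: measurable_funB.
Qed.

Lemma integral_ref_kernel K (k : ('I_3 -> R) -> R) (c : R) : jac K != 0 -> ref_kernel k ->
  ref_int k = c%:E ->
  (\int[leb2]_x (k (lam K x))%:E = (`|jac K| * c)%:E)%E.
Proof.
move=> j0 [k0 mk] kc.
rewrite (@ge0_integral_affine2 _ (vtx K o0) (edge1 K) (edge2 K))//; last 2 first.
- by apply/measurable_EFinP; apply: mk => i; exact: measurable_lam.
- by move=> x; rewrite lee_fin.
rewrite EFinM -kc; congr (_ * _)%E; apply: eq_integral => x _.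
by rewrite /lam loc_frame// -surjective_pairing.
Qed.

Lemma continuous_lam K i : continuous (fun x => lam K x i).
Proof.
have c1 : continuous (fun x : R * R => (loc K x).1).
  move=> x; rewrite /loc/=; apply: cvgM; last exact: cvg_cst.
  apply: cvgB; (apply: cvgM; last exact: cvg_cst); apply: cvgB; try exact: cvg_cst.
    exact: cvg_fst.
  exact: cvg_snd.
have c2 : continuous (fun x : R * R => (loc K x).2).
  move=> x; rewrite /loc/=; apply: cvgM; last exact: cvg_cst.
  apply: cvgB; (apply: cvgM; first exact: cvg_cst); apply: cvgB; try exact: cvg_cst.
    exact: cvg_snd.
  exact: cvg_fst.
elim/I3P: i => //; rewrite /lam /rbary/= => x.
by apply: cvgB; [apply: cvgB; [exact: cvg_cst|exact: c1]|exact: c2].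
Qed.

Lemma open_inside K : open [set x | inside (lam K x)].
Proof.
have -> : [set x | inside (lam K x)] = [set x | 0 < lam K x o0] `&`
    ([set x | 0 < lam K x o1] `&` [set x | 0 < lam K x o2]).
  apply/seteqP; split=> x /=; rewrite /inside forall_I3; last by case=> ? [? ?]; apply/and3P.
  by case/and3P.
have op i : open [set x | 0 < lam K x i].
  apply: (@open_comp _ _ (fun x => lam K x i) [set t | 0 < t]); last exact: open_gt.
  by move=> x _; exact: continuous_lam.
by apply: openI => //; exact: openI.
Qed.

(** Barycentric coordinates are unique, and those of a convex combination without the
    vertex [p] vanish at [p]. *)
Lemma inside_not_conv K S x p : #|` K| = 3%N -> jac K != 0 -> (S `<=` K)%fset ->
  p \in K -> p \notin S -> inside (lam K x) -> ~ conv S x.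
Proof.
move=> K3 j0 SK pK pS /forallP xin [w [w0 w1 x1 x2]].
pose w' q := if q \in S then w q else 0.
have E (F : R * R -> R) : \sum_(i < 3) w' (vtx K i) * F (vtx K i) = \sum_(q <- S) w q * F q.
  rewrite -(big_vtx (fun q => w' q * F q))//.
  rewrite -(big_fset_incl _ SK); first by apply: eq_big_seq => q qS; rewrite /w' qS.
  by move=> q _ /negbTE qS; rewrite /w' qS mul0r.
have [i pE] := vtxP K3 pK.
have lE : lam K x = w' \o vtx K.
  apply: lam_unique; rewrite ?E//.
  rewrite -w1 -[RHS](eq_bigr _ (fun p _ => mulr1 (w p))) -E.
  by apply: eq_bigr => j _; rewrite mulr1.
by have := xin i; rewrite lE /= -pE /w' (negbTE pS) ltxx.
Qed.

End Triangles.

(** * Convex hulls and dual cells *)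

Lemma cvg_sumr (K : numFieldType) (V : normedModType K) (T I : Type) (F : set_system T)
    {FF : Filter F} (r : seq I) (f : I -> T -> V) (l : I -> V) :
  (forall i, f i x @[x --> F] --> l i) ->
  (\sum_(i <- r) f i x) @[x --> F] --> \sum_(i <- r) l i.
Proof.
by move=> fl; apply: cvg_big => //; exact: add_continuous.
Qed.

Section ConvexHulls.
Variable R : realType.
Implicit Types (K L P : {fset R * R}) (x y p : R * R) (T : {fset {fset R * R}}).
Local Notation conv := Defs.conv.

(** The hull is the continuous image of a compact simplex of weights. *)
Lemma conv_closed P : closed (conv P).
Proof.
pose s := enum_fset P; pose n := size s.
pose A : set 'rV[R]_n := [set v | forall i : 'I_n, `[0, 1]%classic (v ord0 i)].
have cA : compact A.
  by apply: (@rV_compact R n (fun=> `[0, 1]%classic)) => i; exact: segment_compact.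
pose lin (c : 'I_n -> R) (v : 'rV[R]_n) : R := \sum_(i < n) v ord0 i * c i.
have clin c : continuous (lin c).
  by move=> v; apply: (@cvg_sumr _ _ _ _ (nbhs v)) => i; apply: cvgM; [exact: (@coord_continuous R 1 n ord0 i v)|exact: cvg_cst].
pose B := A `&` lin (fun=> 1) @^-1` [set 1].
have cB : compact B.
  apply: compact_closedI => //; have := (continuous_closedP (lin (fun=> 1))).1 (clin _) [set 1].
  by apply; exact: closed_eq.
pose f v : R * R := (lin (fun i => (nth (0, 0) s i).1) v, lin (fun i => (nth (0, 0) s i).2) v).
have cf : continuous f.
  by move=> v; apply: (@cvg_pair _ _ _ (nbhs v) (nbhs (lin _ v)) (nbhs (lin _ v))); exact: clin.
have sumE (F : R * R -> R) : \sum_(p <- P) F p = \sum_(i < n) F (nth (0, 0) s i).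
  by rewrite (big_nth (0, 0)) big_mkord.
have -> : conv P = f @` B.
  apply/seteqP; split => [x [w]|_ [v [vA v1] <-]].
    rewrite !sumE => -[w0 w1 x1 x2].
    have w0' (i : 'I_n) : 0 <= w (nth (0, 0) s i) by apply: w0; exact: mem_nth.
    exists (\row_i w (nth (0, 0) s i)); last first.
      rewrite /f /lin [RHS]surjective_pairing x1 x2.
      by congr (_, _); apply: eq_bigr => i _; rewrite mxE.
    split; last by rewrite /lin/= -[RHS]w1; apply: eq_bigr => i _; rewrite mxE mulr1.
    move=> i; rewrite /= in_itv/= mxE w0'/= -[leRHS]w1 (bigD1 i)//= lerDl sumr_ge0//.
  pose w p := if [pick i : 'I_n | nth (0, 0) s i == p] is Some i then v ord0 i else 0.
  have wE (i : 'I_n) : w (nth (0, 0) s i) = v ord0 i.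
    rewrite /w; case: pickP => [j|/(_ i)]; last by rewrite eqxx.
    by rewrite nth_uniq// ?fset_uniq// => /eqP/val_inj ->.
  exists w; rewrite !sumE; split.
  - move=> p _; rewrite /w; case: pickP => // i _.
    by have := vA i; rewrite /= in_itv/= => /andP[].
  - by move: v1; rewrite /lin/= => <-; apply: eq_bigr => i _; rewrite wE mulr1.
  - by apply: eq_bigr => i _; rewrite wE.
  - by apply: eq_bigr => i _; rewrite wE.
apply: compact_closed; first exact: norm_hausdorff.
by apply: continuous_compact => //; exact: continuous_subspaceT.
Qed.

Lemma conv_comb P (r : seq (R * (R * R))) x :
  (forall q, q \in r -> 0 <= q.1 /\ q.2 \in P) -> \sum_(q <- r) q.1 = 1 ->
  x.1 = \sum_(q <- r) q.1 * q.2.1 -> x.2 = \sum_(q <- r) q.1 * q.2.2 -> conv P x.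
Proof.
move=> rP r1 x1 x2; pose w p := \sum_(q <- r | q.2 == p) q.1.
have E (F : R * R -> R) : \sum_(p <- P) w p * F p = \sum_(q <- r) q.1 * F q.2.
  under eq_bigr do rewrite /w big_distrl/=.
  rewrite (exchange_big_dep predT)//=; apply: eq_big_seq => q qr.
  have [_ qP] := rP _ qr.
  rewrite big_mkcond (bigD1_seq q.2) ?fset_uniq//= eqxx big1 ?addr0// => p.
  by rewrite eq_sym => /negbTE ->.
exists w; split; rewrite ?E//.
- by move=> p _; rewrite /w big_seq_cond; apply: sumr_ge0 => q /andP[/rP[]].
- by rewrite -r1 -[LHS](eq_bigr _ (fun p _ => mulr1 (w p))) E; apply: eq_bigr => q _; rewrite mulr1.
Qed.

Lemma lam_comb K P (w : R * R -> R) x i : \sum_(p <- P) w p = 1 ->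
  x.1 = \sum_(p <- P) w p * p.1 -> x.2 = \sum_(p <- P) w p * p.2 ->
  lam K x i = \sum_(p <- P) w p * lam K p i.
Proof.
move=> w1 x1 x2.
pose a : R := lam K (0, 0) i.
pose b : R := lam K (1, 0) i - a.
pose c : R := lam K (0, 1) i - a.
have E y : lam K y i = a + b * y.1 + c * y.2.
  by rewrite /c /b /a; elim/I3P: i {a b c}; rewrite /lam /rbary /loc/=; ring.
rewrite E; under eq_bigr do rewrite E.
rewrite -[X in X + _ + _]mulr1 -w1 x1 x2 !big_distrr -!big_split/=.
by apply: eq_bigr => p _; ring.
Qed.

Lemma lam_midpoint K x y i : lam K (midpoint x y) i = (lam K x i + lam K y i) / 2.
Proof.
by elim/I3P: i; rewrite /lam /rbary /loc/=; move: (jac K)^-1 => j; field.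
Qed.

Lemma lam_vtx K j i : jac K != 0 -> lam K (vtx K j) i = (i == j)%:R.
Proof.
move=> j0; rewrite (@lam_unique _ K (vtx K j) (fun i => (i == j)%:R))// big_I3; elim/I3P: j => /=;
  by rewrite ?mul1r ?mul0r ?addr0 ?add0r.
Qed.

Lemma barycenterE K : #|` K| = 3%N -> barycenter K =
  (((vtx K o0).1 + (vtx K o1).1 + (vtx K o2).1) / 3, ((vtx K o0).2 + (vtx K o1).2 + (vtx K o2).2) / 3).
Proof. by move=> K3; rewrite /barycenter !big_vtx// !big_I3 K3. Qed.

Lemma lam_barycenter K i : #|` K| = 3%N -> jac K != 0 -> lam K (barycenter K) i = 3^-1.
Proof.
move=> K3 j0; suff -> : lam K (barycenter K) = fun=> 3^-1 by [].
by apply: lam_unique => //; rewrite ?barycenterE// !big_I3/=; field.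
Qed.

Definition dual_cell K p : set (R * R) :=
  conv (barycenter K |` [fset midpoint p q | q in K])%fset.

(** From left to right, the corners of the cell satisfy the inequalities, and these
    are preserved by convex combinations. Conversely, let [a >= b >= c] be the
    barycentric coordinates, with [a] at the vertex of the cell: the point is the
    combination of the barycenter with weight [3 c], of the midpoint of the edge
    towards the vertex of [b] with weight [2 (b - c)], and of the vertex of the cell
    with the remaining weight [a - b]. *)
Lemma dual_cell_nearest K i x : #|` K| = 3%N -> jac K != 0 ->
  dual_cell K (vtx K i) x <-> conv K x /\ nearest i (lam K x).
Proof.
move=> K3 j0; split=> [[w [w0 w1 x1 x2]]|[Kx /forallP ni]].
  have lamx k := lam_comb K k w1 x1 x2.
  have q0 q : q \in (barycenter K |` [fset midpoint (vtx K i) q | q in K])%fset ->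
      (forall k, 0 <= lam K q k) /\ forall k, lam K q k <= lam K q i.
    move=> /fset1UP[->|/imfsetP[/= p /(vtxP K3)[j ->] ->]].
      by split=> k; rewrite !lam_barycenter// lexx.
    split=> k; rewrite !lam_midpoint !lam_vtx//.
    rewrite eqxx ler_pM2r// .
    have [->|ik] := eqVneq k i; first by rewrite lexx.
    by rewrite add0r (@le_trans _ _ 1) ?lern1 ?leq_b1// lerDl ler0n.
  split.
    apply/conv_lam => // k; rewrite lamx big_seq; apply: sumr_ge0 => q qP.
    by rewrite mulr_ge0 ?w0//; exact: (q0 _ qP).1.
  apply/forallP => k; rewrite !lamx big_seq [leRHS]big_seq; apply: ler_sum => q qP.
  by rewrite ler_wpM2l ?w0//; exact: (q0 _ qP).2.
have l0 := (conv_lam x K3 j0).1 Kx.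
have [x1 x2] := lam_point x j0.
have ls := lam_sum K x.
rewrite !big_I3 in x1 x2 ls.
have mono (m c0 c1 c2 : R) : 0 <= m -> 0 <= c0 -> 0 <= c1 -> 0 <= c2 ->
    m + c0 + c1 + c2 = 1 ->
    x.1 = m * (barycenter K).1 + c0 * (midpoint (vtx K i) (vtx K o0)).1 +
      c1 * (midpoint (vtx K i) (vtx K o1)).1 + c2 * (midpoint (vtx K i) (vtx K o2)).1 ->
    x.2 = m * (barycenter K).2 + c0 * (midpoint (vtx K i) (vtx K o0)).2 +
      c1 * (midpoint (vtx K i) (vtx K o1)).2 + c2 * (midpoint (vtx K i) (vtx K o2)).2 ->
    dual_cell K (vtx K i) x.
  move=> m0 c00 c10 c20 s1 e1 e2.
  apply: (@conv_comb _ [:: (m, barycenter K); (c0, midpoint (vtx K i) (vtx K o0));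
    (c1, midpoint (vtx K i) (vtx K o1)); (c2, midpoint (vtx K i) (vtx K o2))]).
  - have mid j : midpoint (vtx K i) (vtx K j) \in
        (barycenter K |` [fset midpoint (vtx K i) q | q in K])%fset.
      by apply/fset1UP; right; apply/imfsetP; exists (vtx K j) => //=; exact: vtx_in.
    move=> q; rewrite !in_cons in_nil orbF => /or4P[] /eqP -> /=; split => //.
    by apply/fset1UP; left.
  - by rewrite !big_cons big_nil/= addr0 !addrA.
  - by rewrite !big_cons big_nil/= addr0 !addrA.
  - by rewrite !big_cons big_nil/= addr0 !addrA.
have := (l0 o0, l0 o1, l0 o2) => -[[l00 l01] l02].
have := (ni o0, ni o1, ni o2) => -[[n0 n1] n2].
rewrite barycenterE// in mono.
move: mono n0 n1 n2; elim/I3P: i {ni} => /= mono n0 n1 n2.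
- have [h|/ltW h] := leP (lam K x o1) (lam K x o2).
  + apply: (mono (3 * lam K x o1) (lam K x o0 - lam K x o2) 0 (2 * (lam K x o2 - lam K x o1)));
      rewrite ?x1 ?x2; try lra; by field.
  + apply: (mono (3 * lam K x o2) (lam K x o0 - lam K x o1) (2 * (lam K x o1 - lam K x o2)) 0);
      rewrite ?x1 ?x2; try lra; by field.
- have [h|/ltW h] := leP (lam K x o0) (lam K x o2).
  + apply: (mono (3 * lam K x o0) 0 (lam K x o1 - lam K x o2) (2 * (lam K x o2 - lam K x o0)));
      rewrite ?x1 ?x2; try lra; by field.
  + apply: (mono (3 * lam K x o2) (2 * (lam K x o0 - lam K x o2)) (lam K x o1 - lam K x o0) 0);
      rewrite ?x1 ?x2; try lra; by field.
- have [h|/ltW h] := leP (lam K x o0) (lam K x o1).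
  + apply: (mono (3 * lam K x o0) 0 (2 * (lam K x o1 - lam K x o0)) (lam K x o2 - lam K x o1));
      rewrite ?x1 ?x2; try lra; by field.
  + apply: (mono (3 * lam K x o1) (2 * (lam K x o0 - lam K x o1)) 0 (lam K x o2 - lam K x o0));
      rewrite ?x1 ?x2; try lra; by field.
Qed.

End ConvexHulls.

(** * Inner products as nodal forms *)

Lemma derive1_affine (R : realType) (A B x : R) : derive1 (fun s : R => A * s + B) x = A.
Proof.
rewrite derive1E.
have h : is_derive x (1 : R) (fun s : R => A * s + B) (A * 1 + 0) by apply: is_deriveD.
by rewrite derive_val mulr1 addr0.
Qed.

Section NullUnions.
Context d (T : measurableType d) (R : realType) (mu : {measure set T -> \bar R}).

Lemma null_bigcup_seq (I : eqType) (r : seq I) (A : I -> set T) :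
  (forall i, i \in r -> measurable (A i) /\ mu (A i) = 0%E) ->
  measurable (\bigcup_(i in [set` r]) A i) /\ mu (\bigcup_(i in [set` r]) A i) = 0%E.
Proof.
elim: r => [|i r IH] Ar.
  have -> : \bigcup_(i in [set` [::]]) A i = set0 by apply/seteqP; split=> x // [].
  by rewrite measure0; split.
have [mr nr] : _ /\ _ := IH (fun j jr => Ar j (@mem_behead _ (i :: r) j jr)).
have [mi ni] := Ar i (mem_head _ _).
have -> : \bigcup_(j in [set` i :: r]) A j = A i `|` \bigcup_(j in [set` r]) A j.
  apply/seteqP; split=> [x [j /=]|x [Ai|[j /= jr Aj]]].
  - by rewrite inE => /predU1P[->|jr] Aj; [left|right; exists j].
  - by exists i => //=; exact: mem_head.
  - by exists j => //=; rewrite inE jr orbT.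
by split; [exact: measurableU|exact: null_set_setU].
Qed.

End NullUnions.

Section Forms.
Variable R : realType.
Local Notation conv := Defs.conv.
Local Notation mR := (measurableTypeR R).
Local Notation leb2 := (@leb2 R).
Local Notation fct := (R * R -> R[i]).
Implicit Types (K L : {fset R * R}) (x y p : R * R) (f g : fct) (T : {fset {fset R * R}}).
Implicit Types (W : {fset R * R} -> 'I_3 -> 'I_3 -> R).

(** A form that sees its arguments only through their values at the vertices, triangle
    by triangle. On finite element functions, the three inner products below are of
    this kind. *)
Definition bform T W f g : R[i] :=
  \sum_(K <- T) \sum_(i < 3) \sum_(j < 3) (f (vtx K i) * conjc (g (vtx K j))) * (W K i j)%:C.

(** The barycentric coordinates are affine, so that these differences are their
    constant partial derivatives. *)
Definition dlam1 K i : R := lam K (1, 0) i - lam K (0, 0) i.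
Definition dlam2 K i : R := lam K (0, 1) i - lam K (0, 0) i.

Lemma lamE K x i : lam K x i = dlam1 K i * x.1 + dlam2 K i * x.2 + lam K (0, 0) i.
Proof. by rewrite /dlam1 /dlam2; elim/I3P: i; rewrite /lam /rbary /loc/=; ring. Qed.

(** When the vertices are collinear, the division by zero in [loc] places every point
    at the first vertex of the reference triangle, and no point is inside. *)
Lemma integral_degenerate K (k : ('I_3 -> R) -> R) (c : R) : ref_kernel k ->
  (forall l, ~~ inside l -> k l = 0) -> ref_int k = c%:E ->
  (\int[leb2]_x (k (lam K x))%:E = (`|jac K| * c)%:E)%E.
Proof.
move=> rk k0 kc; have [j0|j0] := eqVneq (jac K) 0; last exact: integral_ref_kernel.
rewrite j0 normr0 mul0r; apply: integral0_eq => x _.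
by rewrite k0// /inside forall_I3 /lam /rbary /loc j0 invr0 !mulr0 /= ltxx /= andbF.
Qed.

Lemma Cintegral_bform T (D N : set (mR * mR)) (s : {fset R * R} -> 'I_3 -> 'I_3 -> R)
    (kk : 'I_3 -> 'I_3 -> ('I_3 -> R) -> R) (c : 'I_3 -> 'I_3 -> R) f g (F : fct) :
  (forall i j, ref_kernel (kk i j)) ->
  (forall i j l, ~~ inside l -> kk i j l = 0) ->
  (forall i j, ref_int (kk i j) = (c i j)%:E) ->
  measurable N -> leb2 N = 0%E ->
  (forall x, ~ N x -> (if x \in D then F x else 0) =
    \sum_(K <- T) \sum_(i < 3) \sum_(j < 3)
      (f (vtx K i) * conjc (g (vtx K j))) * (s K i j)%:C * (kk i j (lam K x))%:C) ->
  Cintegral leb2 D F = bform T (fun K i j => s K i j * (`|jac K| * c i j)) f g.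
Proof.
move=> rk k0 kc mN N0 FE.
pose r := [seq (K, ij) | K <- enum_fset T, ij <- index_enum ('I_3 * 'I_3)%type].
have sumE (h : {fset R * R} -> 'I_3 -> 'I_3 -> R[i]) :
    \sum_(K <- T) \sum_(i < 3) \sum_(j < 3) h K i j =
    \sum_(q <- r) h q.1 q.2.1 q.2.2.
  rewrite /r big_allpairs/=; apply: eq_bigr => K _.
  by rewrite pair_bigA.
rewrite (@Cintegral_lincomb _ _ _ leb2 _ (fun q x => kk q.2.1 q.2.2 (lam q.1 x))
   (fun q => `|jac q.1| * c q.2.1 q.2.2) _ _ _ D N r
   (fun q => (f (vtx q.1 q.2.1) * conjc (g (vtx q.1 q.2.2))) * (s q.1 q.2.1 q.2.2)%:C))//.
- rewrite /bform sumE; apply: eq_bigr => q _.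
  by rewrite -mulrA -rmorphM.
- by move=> q; apply: (rk _ _).2 => i; exact: measurable_lam.
- by move=> q x; exact: (rk _ _).1.
- by move=> q; apply: integral_degenerate => // l; exact: k0.
- by move=> x Nx; rewrite FE// sumE.
Qed.

End Forms.

Section Triangulation.
Variable R : realType.
Local Notation conv := Defs.conv.
Local Notation mR := (measurableTypeR R).
Local Notation leb2 := (@leb2 R).
Local Notation fct := (R * R -> R[i]).
Variables (Omega : set (R * R)) (T : {fset {fset R * R}}).
Hypothesis hOmega : convex_polygonal_domain Omega.
Hypothesis hT : triangulation Omega T.
Implicit Types (K L : {fset R * R}) (x y p : R * R) (f g : fct).

Let T3 K : K \in T -> #|` K| = 3%N.
Proof. by case: hT => h _ _ /h[]. Qed.

Let Tj K : K \in T -> jac K != 0.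
Proof. by move=> KT; apply: jac_neq0; [exact: T3|case: hT => h _ _; exact: (h K KT).2]. Qed.

Lemma conv_closure K x : K \in T -> conv K x -> closure Omega x.
Proof. by move=> KT Kx; case: hT => _ _ <-; exists K. Qed.

(** The open triangle is contained in the closed convex set [conv P], hence in the
    interior of [conv P], which is the domain. *)
Lemma inside_domain K x : K \in T -> inside (lam K x) -> Omega x.
Proof.
move=> KT Kx; case: hOmega => _ [P PE].
have clP : closure Omega `<=` conv P.
  rewrite closureEbigcap => y /(_ (conv P)); apply; split; first exact: conv_closed.
  by rewrite PE; exact: interior_subset.
rewrite PE.
have : [set y | inside (lam K y)] `<=` conv P.
  move=> y /= Ky; apply: clP; apply: (conv_closure KT).
  by apply: inside_conv Ky; [exact: T3|exact: Tj].
rewrite open_subsetE; last exact: open_inside.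
exact.
Qed.

(** If the triangles were distinct, the point would be in the convex hull of their
    common vertices, of which there are at most two. *)
Lemma inside_unique K L x : K \in T -> L \in T -> inside (lam K x) -> conv L x -> K = L.
Proof.
move=> KT LT Kx Lx; have [//|KL] := eqVneq K L.
have Kx' : conv K x by apply: inside_conv Kx; [exact: T3|exact: Tj].
have KLx : conv (K `&` L)%fset x.
  by case: hT => _ h _; rewrite -h.
have /fsubsetPn[p pK pL] : ~~ (K `<=` L)%fset.
  apply: contra KL => KL; rewrite eqEfcard KL !T3//.
exfalso; apply: (@inside_not_conv _ K (K `&` L)%fset x p) KLx => //.
- exact: T3.
- exact: Tj.
- exact: fsubsetIl.
- by rewrite inE (negbTE pL) andbF.
Qed.

(** The lines that carry the edges, not only the edges. *)
Definition skeleton : set (mR * mR) :=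
  \bigcup_(K in [set` T]) \bigcup_(i in [set` index_enum 'I_3]) [set x | lam K x i = 0].

Lemma skeleton_null : measurable skeleton /\ leb2 skeleton = 0%E.
Proof.
apply: (@null_bigcup_seq _ _ _ (lebesgue_measure \x lebesgue_measure)%E) => K KT.
apply: (@null_bigcup_seq _ _ _ (lebesgue_measure \x lebesgue_measure)%E) => i _.
have -> : [set x | lam K x i = 0] =
    [set x | dlam1 K i * x.1 + dlam2 K i * x.2 + lam K (0, 0) i = 0].
  by apply/seteqP; split => x /=; rewrite -lamE.
apply: leb2_line; rewrite -negb_and; apply/negP => /andP[/eqP d1 /eqP d2].
have [j ij] : exists j : 'I_3, j != i by elim/I3P: i {d1 d2}; [exists o1|exists o0|exists o0].
have := lam_vtx j i (Tj KT); have := lam_vtx i i (Tj KT).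
rewrite lamE [X in _ -> X = _ -> _]lamE d1 d2 !mul0r !add0r eqxx eq_sym (negbTE ij) => -> /eqP.
by rewrite oner_eq0.
Qed.

Lemma inside_cover x : ~ skeleton x -> Omega x -> exists2 K, K \in T & inside (lam K x).
Proof.
move=> xN /subset_closure; case: hT => _ _ <- [K /= KT Kx]; exists K => //.
apply/forallP => i; rewrite lt_neqAle (conv_lam x (T3 KT) (Tj KT)).1// andbT eq_sym.
apply/negP => /eqP xi; apply: xN; exists K => //; exists i => //=.
by rewrite mem_index_enum.
Qed.

Lemma domain_decomposition (V : nmodType) (F : R * R -> V) x : ~ skeleton x ->
  (if x \in Omega then F x else 0) = \sum_(K <- T) if inside (lam K x) then F x else 0.
Proof.
move=> xN; case: ifPn => [/set_mem xO|/negP xO]; last first.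
  rewrite big_seq big1// => K KT; case: ifP => // Kx.
  by exfalso; apply: xO; apply/mem_set; exact: inside_domain Kx.
have [K KT Kx] := inside_cover xN xO.
rewrite (bigD1_seq K) ?fset_uniq//= Kx big_seq_cond big1 ?addr0// => L /andP[LT LK].
case: ifP => // Lx; exfalso; move/eqP: LK; apply.
apply: (inside_unique LT KT Lx).
by apply: inside_conv Kx; [exact: T3|exact: Tj].
Qed.

Lemma Vh_nodal f K x : Vh Omega T f -> K \in T -> conv K x ->
  f x = \sum_(i < 3) (lam K x i)%:C * f (vtx K i).
Proof.
move=> [_ _ fK] KT Kx; have [a [b [c fE]]] := fK K KT.
have vK i : conv K (vtx K i).
  apply/conv_lam; [exact: T3|exact: Tj|move=> j].
  by rewrite lam_vtx ?ler0n//; exact: Tj.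
rewrite fE//; under eq_bigr do rewrite fE//.
have [x1 x2] := lam_point x (Tj KT); have ls := lam_sum K x.
have e1 : (x.1)%:C = \sum_i (lam K x i)%:C * ((vtx K i).1)%:C.
  by rewrite {1}x1 rmorph_sum/=; apply: eq_bigr => i _; rewrite rmorphM.
have e2 : (x.2)%:C = \sum_i (lam K x i)%:C * ((vtx K i).2)%:C.
  by rewrite {1}x2 rmorph_sum/=; apply: eq_bigr => i _; rewrite rmorphM.
have e0 : 1 = \sum_i (lam K x i)%:C.
  by rewrite -rmorph_sum ls.
rewrite -[X in X + _ + _]mulr1 e0 e1 e2 !big_distrr -!big_split/=.
by apply: eq_bigr => i _; ring.
Qed.

Definition mass_form := bform T (fun K i j =>
  1 * (`|jac K| * ((i == j)%:R * mass_diag R + mass_off R))).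
Definition lump_form := bform T (fun K i j =>
  1 * (`|jac K| * ((i == j)%:R * lump_diag R + lump_off R))).
Definition grad_form := bform T (fun K i j =>
  (dlam1 K i * dlam1 K j + dlam2 K i * dlam2 K j) * (`|jac K| * tri_area R)).

Let conj_sum (F : 'I_3 -> R[i]) : conjc (\sum_i F i) = \sum_i conjc (F i).
Proof. by rewrite (raddf_sum conjc). Qed.

Let conj_real (a : R) (z : R[i]) : conjc (a%:C * z) = a%:C * conjc z.
Proof. by case: z => u v; rewrite /=; simpc. Qed.

Lemma ip_mass f g : Vh Omega T f -> Vh Omega T g -> ip Omega f g = mass_form f g.
Proof.
move=> Vf Vg; have [mN N0] := skeleton_null.
apply: (@Cintegral_bform _ T Omega skeleton (fun=> fun=> fun=> 1) (@massk R) _ f g) => //.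
- exact: kernel_massk.
- by move=> i j l /negbTE; rewrite /massk => ->.
- exact: ref_masskE.
move=> x xN; rewrite (domain_decomposition (fun x => f x * conjc (g x)) xN).
apply: eq_big_seq => K KT; rewrite /massk; case: ifP => Kx; last first.
  by rewrite big1// => i _; rewrite big1// => j _; rewrite mulr0.
have Kx' : conv K x by apply: inside_conv Kx; [exact: T3|exact: Tj].
rewrite (Vh_nodal Vf KT Kx') (Vh_nodal Vg KT Kx') conj_sum big_distrlr/=.
apply: eq_bigr => i _; apply: eq_bigr => j _; rewrite conj_real rmorphM mulr1; ring.
Qed.

Lemma control_volume_inside K x p : K \in T -> inside (lam K x) ->
  control_volume T p x <-> p \in K /\ dual_cell K p x.
Proof.
move=> KT Kx; split=> [[L [LT pL] Lx]|[pK px]]; last by exists K.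
suff -> : K = L by [].
apply: (inside_unique KT LT Kx).
have [i pE] := vtxP (T3 LT) pL.
by move: Lx; rewrite pE => /(dual_cell_nearest i x (T3 LT) (Tj LT)) [].
Qed.

(** The sum over the interior vertices may be extended to all vertices, because [f]
    vanishes at the others. *)
Lemma Pi_star_inside f K x : Vh Omega T f -> K \in T -> inside (lam K x) ->
  Pi_star Omega T f x = \sum_(j < 3) f (vtx K j) * (if nearest j (lam K x) then 1 else 0).
Proof.
move=> [_ f0 _] KT Kx; rewrite /Pi_star big_mkcond/=.
have Kx' : conv K x by apply: inside_conv Kx; [exact: T3|exact: Tj].
have KV : (K `<=` vertices T)%fset by rewrite /vertices; exact: bigfcup_sup.
rewrite -(big_fset_incl _ KV); last first.
  move=> p _ pK; case: ifP => // _.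
  rewrite indicE memNset ?mulr0// => /(control_volume_inside p KT Kx)[pK' _].
  by rewrite pK' in pK.
rewrite big_vtx ?T3//; apply: eq_bigr => j _.
have -> : (if `[< Omega (vtx K j) >] then f (vtx K j) * (\1_(control_volume T (vtx K j)) x)%:C else 0)
    = f (vtx K j) * (\1_(control_volume T (vtx K j)) x)%:C.
  by case: ifPn => // /asboolPn /f0 ->; rewrite mul0r.
congr (_ * _); rewrite indicE.
have E := control_volume_inside (vtx K j) KT Kx.
have E' := dual_cell_nearest j x (T3 KT) (Tj KT).
case: ifPn => nj.
  by rewrite mem_set//; apply/E; split; [exact: vtx_in (T3 KT)|exact/E'].
by rewrite memNset// => /E[_ /E'[_]]; apply/negP.
Qed.

Lemma ip_lump f g : Vh Omega T f -> Vh Omega T g -> ip_h Omega T f g = lump_form f g.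
Proof.
move=> Vf Vg; have [mN N0] := skeleton_null.
apply: (@Cintegral_bform _ T Omega skeleton (fun=> fun=> fun=> 1) (@lumpk R) _ f g) => //.
- exact: kernel_lumpk.
- by move=> i j l /negbTE; rewrite /lumpk => ->.
- exact: ref_lumpkE.
move=> x xN; rewrite (domain_decomposition (fun x => f x * conjc (Pi_star Omega T g x)) xN).
apply: eq_big_seq => K KT; rewrite /lumpk; case: ifP => Kx; last first.
  by rewrite big1// => i _; rewrite big1// => j _; rewrite mulr0.
have Kx' : conv K x by apply: inside_conv Kx; [exact: T3|exact: Tj].
rewrite (Vh_nodal Vf KT Kx') (Pi_star_inside Vg KT Kx) conj_sum big_distrlr/=.
apply: eq_bigr => i _; apply: eq_bigr => j _; rewrite mulr1.
case: ifP => _; rewrite ?mulr0 ?mulr1 ?conjc0 ?mulr0//; ring.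
Qed.

Let dsum1 f K : R[i] := \sum_i (dlam1 K i)%:C * f (vtx K i).
Let dsum2 f K : R[i] := \sum_i (dlam2 K i)%:C * f (vtx K i).

Let Re_affine (A B : R[i]) (s : R) :
  complex.Re (A * s%:C + B) = complex.Re A * s + complex.Re B.
Proof. by case: A B => [a b] [c d] /=; ring. Qed.

Let Im_affine (A B : R[i]) (s : R) :
  complex.Im (A * s%:C + B) = complex.Im A * s + complex.Im B.
Proof. by case: A B => [a b] [c d] /=; ring. Qed.

(** A point inside a triangle has a neighbourhood in the coordinate direction on which
    [f] is affine. *)
Lemma partial1_inside f K x : Vh Omega T f -> K \in T -> inside (lam K x) ->
  partial1 f x = dsum1 f K.
Proof.
move=> Vf KT Kx.
pose B : R[i] := \sum_i (dlam2 K i * x.2 + lam K (0, 0) i)%:C * f (vtx K i).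
have near_eq : \forall s \near x.1, f (s, x.2) = dsum1 f K * s%:C + B.
  have cs : (fun s : R => (s, x.2)) @ x.1 --> (x.1, x.2).
    by apply: (@cvg_pair _ _ _ (nbhs x.1) (nbhs x.1) (nbhs x.2)); [exact: cvg_id|exact: cvg_cst].
  have : \forall s \near x.1, inside (lam K (s, x.2)).
    have Kn : nbhs (x.1, x.2) [set y | inside (lam K y)].
      by rewrite -surjective_pairing; apply: open_nbhs_nbhs; split => //; exact: open_inside.
    exact: (cs _ Kn).
  apply: filterS => s Ks.
  rewrite (Vh_nodal Vf KT); last by apply: inside_conv Ks; [exact: T3|exact: Tj].
  rewrite /dsum1 /B mulr_suml -big_split/=; apply: eq_bigr => i _.
  by rewrite lamE/= -addrA rmorphD rmorphM/=; ring.
have der (h : R[i] -> R) : (forall A B s, h (A * s%:C + B) = h A * s + h B) ->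
    derive1 (fun s => h (f (s, x.2))) x.1 = h (dsum1 f K).
  move=> hE; rewrite -[RHS](derive1_affine _ (h B) x.1) !derive1E.
  by apply: near_eq_derive; apply: filterS near_eq => s ->.
by rewrite /partial1 !der//; case: (dsum1 f K).
Qed.

Lemma partial2_inside f K x : Vh Omega T f -> K \in T -> inside (lam K x) ->
  partial2 f x = dsum2 f K.
Proof.
move=> Vf KT Kx.
pose B : R[i] := \sum_i (dlam1 K i * x.1 + lam K (0, 0) i)%:C * f (vtx K i).
have near_eq : \forall s \near x.2, f (x.1, s) = dsum2 f K * s%:C + B.
  have cs : (fun s : R => (x.1, s)) @ x.2 --> (x.1, x.2).
    by apply: (@cvg_pair _ _ _ (nbhs x.2) (nbhs x.1) (nbhs x.2)); [exact: cvg_cst|exact: cvg_id].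
  have : \forall s \near x.2, inside (lam K (x.1, s)).
    have Kn : nbhs (x.1, x.2) [set y | inside (lam K y)].
      by rewrite -surjective_pairing; apply: open_nbhs_nbhs; split => //; exact: open_inside.
    exact: (cs _ Kn).
  apply: filterS => s Ks.
  rewrite (Vh_nodal Vf KT); last by apply: inside_conv Ks; [exact: T3|exact: Tj].
  rewrite /dsum2 /B mulr_suml -big_split/=; apply: eq_bigr => i _.
  by rewrite lamE/= addrAC rmorphD /= [(dlam2 K i * s)%:C]rmorphM/=; ring.
have der (h : R[i] -> R) : (forall A B s, h (A * s%:C + B) = h A * s + h B) ->
    derive1 (fun s => h (f (x.1, s))) x.2 = h (dsum2 f K).
  move=> hE; rewrite -[RHS](derive1_affine _ (h B) x.2) !derive1E.
  by apply: near_eq_derive; apply: filterS near_eq => s ->.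
by rewrite /partial2 !der//; case: (dsum2 f K).
Qed.

Let ip_partial (pd : fct -> fct) (dl : {fset R * R} -> 'I_3 -> R) f g :
  (forall f K x, Vh Omega T f -> K \in T -> inside (lam K x) ->
    pd f x = \sum_i (dl K i)%:C * f (vtx K i)) ->
  Vh Omega T f -> Vh Omega T g ->
  ip Omega (pd f) (pd g) =
    bform T (fun K i j => (dl K i * dl K j) * (`|jac K| * tri_area R)) f g.
Proof.
move=> pdE Vf Vg; have [mN N0] := skeleton_null.
apply: (@Cintegral_bform _ T Omega skeleton (fun K i j => dl K i * dl K j)
  (fun=> fun=> @unitk R) (fun=> fun=> tri_area R) f g) => //.
- by move=> _ _; exact: kernel_unitk.
- by move=> _ _ l /negbTE; rewrite /unitk => ->.
- by move=> _ _; exact: ref_unitkE.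
move=> x xN; rewrite (domain_decomposition (fun x => pd f x * conjc (pd g x)) xN).
apply: eq_big_seq => K KT; rewrite /unitk; case: ifP => Kx; last first.
  by rewrite big1// => i _; rewrite big1// => j _; rewrite mulr0.
rewrite (pdE _ _ _ Vf KT Kx) (pdE _ _ _ Vg KT Kx) conj_sum big_distrlr/=.
apply: eq_bigr => i _; apply: eq_bigr => j _; rewrite conj_real rmorphM mulr1; ring.
Qed.

Lemma ip_grad_form f g : Vh Omega T f -> Vh Omega T g -> ip_grad Omega f g = grad_form f g.
Proof.
move=> Vf Vg; rewrite /ip_grad (ip_partial partial1_inside)// (ip_partial partial2_inside)//.
rewrite /grad_form /bform -big_split; apply: eq_bigr => K _.
rewrite -big_split; apply: eq_bigr => i _; rewrite -big_split; apply: eq_bigr => j _ /=.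
by rewrite -mulrDr -rmorphD/=; congr (_ * _%:C); ring.
Qed.

End Triangulation.

(** * Hermitian forms *)

Section HermitianForms.
Variables (R : realType) (X : Type).
Local Notation fct := (X -> R[i]).
Local Notation Re := (@complex.Re R).
Local Notation Im := (@complex.Im R).
Local Notation normc := (@Normc.normc R).
Implicit Types (f g h : fct) (a z : R[i]) (B : fct -> fct -> R[i]).

Lemma normc_sq z : normc z ^+ 2 = Re z ^+ 2 + Im z ^+ 2.
Proof. by case: z => x y; rewrite /Normc.normc/= sqr_sqrtr ?addr_ge0 ?sqr_ge0. Qed.

Lemma normc_ge0 z : 0 <= normc z.
Proof. by case: z => x y; exact: sqrtr_ge0. Qed.

Lemma normr_Re z : `|Re z| <= normc z.
Proof. by rewrite -sqrtr_sqr; case: z => x y /=; rewrite ler_sqrt ?addr_ge0 ?sqr_ge0// lerDl sqr_ge0. Qed.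

Lemma normr_Im z : `|Im z| <= normc z.
Proof. by rewrite -sqrtr_sqr; case: z => x y /=; rewrite ler_sqrt ?addr_ge0 ?sqr_ge0// lerDr sqr_ge0. Qed.

Lemma normc_real (x : R) : normc x%:C = `|x|.
Proof. by rewrite /= expr0n addr0 sqrtr_sqr. Qed.

Lemma normc_eq0 z : normc z = 0 -> z = 0.
Proof. exact: Normc.eq0_normc. Qed.

Lemma normc_le z : normc z <= `|Re z| + `|Im z|.
Proof.
rewrite -ler_sqr ?nnegrE ?normc_ge0 ?addr_ge0// normc_sq sqrrD !real_normK ?num_real//.
by rewrite lerD2r lerDl mulrn_wge0// mulr_ge0.
Qed.

(** The forms live on all functions and are only semidefinite: a nodal form vanishes
    on the functions that are zero at the vertices. *)
Record hermitian_form B : Prop := HermitianForm {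
  form_linear : forall a f g h, B (fun x => a * f x + g x) h = a * B f h + B g h;
  form_conj : forall f g, B g f = conjc (B f g);
  form_ge0 : forall f, 0 <= Re (B f f) }.

Definition fnorm B f : R := Num.sqrt (Re (B f f)).

Lemma fnorm_ge0 B f : 0 <= fnorm B f.
Proof. exact: sqrtr_ge0. Qed.

Section OneForm.
Variables (B : fct -> fct -> R[i]) (hB : hermitian_form B).

Lemma fnorm_sq f : fnorm B f ^+ 2 = Re (B f f).
Proof. by rewrite sqr_sqrtr//; exact: form_ge0. Qed.

Lemma form_diag f : B f f = (fnorm B f ^+ 2)%:C.
Proof.
rewrite fnorm_sq; have := form_conj hB f f; case: (B f f) => x y [E] /=.
by congr (_ +i* _); lra.
Qed.

Lemma form_antilinear a f g h : B h (fun x => a * f x + g x) = conjc a * B h f + B h g.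
Proof.
rewrite (form_conj hB _ h) (form_linear hB) rmorphD rmorphM/=.
by rewrite -!(form_conj hB).
Qed.

Lemma form_zerol g : B (fun=> 0) g = 0.
Proof.
have := form_linear hB (-1) (fun=> 0) (fun=> 0) g.
rewrite [X in B X g](_ : _ = fun=> 0); last by apply/funext => x; rewrite mulr0 addr0.
by move=> ->; rewrite mulN1r addNr.
Qed.

Lemma form_zeror g : B g (fun=> 0) = 0.
Proof. by rewrite (form_conj hB) form_zerol conjc0. Qed.

Lemma form_comb (I : Type) (r : seq I) (c : I -> R[i]) (e : I -> fct) g :
  B (fun x => \sum_(i <- r) c i * e i x) g = \sum_(i <- r) c i * B (e i) g.
Proof.
elim: r => [|i r IH].
  by rewrite big_nil -[RHS](form_zerol g); congr (B _ g); apply/funext => x; rewrite big_nil.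
rewrite big_cons -IH -(form_linear hB); congr (B _ g).
by apply/funext => x; rewrite big_cons.
Qed.

Lemma form_combr (I : Type) (r : seq I) (c : I -> R[i]) (e : I -> fct) g :
  B g (fun x => \sum_(i <- r) c i * e i x) = \sum_(i <- r) conjc (c i) * B g (e i).
Proof.
rewrite (form_conj hB) form_comb rmorph_sum; apply: eq_bigr => i _.
by rewrite rmorphM/= -(form_conj hB).
Qed.

Lemma form_Cauchy f g : normc (B f g) <= fnorm B f * fnorm B g.
Proof.
have key (t : R) : 0 <= t ^+ 2 * normc (B f g) ^+ 2 * fnorm B f ^+ 2
    - 2 * t * normc (B f g) ^+ 2 + fnorm B g ^+ 2.
  have := form_ge0 hB (fun x => (- t%:C * conjc (B f g)) * f x + g x).
  rewrite (form_linear hB) !form_antilinear (form_conj hB f g) !form_diag normc_sq.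
  case: (B f g) => x y; move: (fnorm B f) (fnorm B g) => p q /=; lra.
set n := normc (B f g) in key *.
have n0 : 0 <= n by exact: normc_ge0.
have [p0|p0] := eqVneq (fnorm B f) 0.
  suff -> : n = 0 by rewrite p0 mul0r.
  apply/eqP; apply: contraT => nn.
  have n2 : 0 < n ^+ 2 by rewrite exprn_gt0// lt_def nn.
  have := key ((fnorm B g ^+ 2 + 1) / (2 * n ^+ 2)).
  rewrite p0 expr0n/= mulr0 sub0r.
  have -> : - (2 * ((fnorm B g ^+ 2 + 1) / (2 * n ^+ 2)) * n ^+ 2) + fnorm B g ^+ 2 = -1.
    by field; exact: nn.
  lra.
have p2 : 0 < fnorm B f ^+ 2 by rewrite exprn_gt0// lt_def p0 fnorm_ge0.
rewrite -ler_sqr ?nnegrE ?mulr_ge0 ?fnorm_ge0// exprMn -ler_pdivrMl// .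
have := key (fnorm B f ^+ 2)^-1.
have -> : ((fnorm B f ^+ 2)^-1) ^+ 2 * n ^+ 2 * fnorm B f ^+ 2 - 2 * (fnorm B f ^+ 2)^-1 * n ^+ 2
   + fnorm B g ^+ 2 = fnorm B g ^+ 2 - (fnorm B f ^+ 2)^-1 * n ^+ 2.
  by field; exact: p0.
by rewrite subr_ge0.
Qed.

Lemma fnormD a f g : fnorm B (fun x => a * f x + g x) <= normc a * fnorm B f + fnorm B g.
Proof.
rewrite -ler_sqr ?nnegrE ?fnorm_ge0 ?addr_ge0 ?mulr_ge0 ?normc_ge0 ?fnorm_ge0//.
rewrite fnorm_sq (form_linear hB) !form_antilinear (form_conj hB f g) !form_diag.
have := le_trans (ler_norm _) (le_trans (normr_Re (a * B f g)) _).
rewrite Normc.normcM => /(_ _ (ler_wpM2l (normc_ge0 a) (form_Cauchy f g))).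
rewrite sqrrD exprMn (normc_sq a).
case: (B f g) => x y; case: a => c d; move: (normc _) (fnorm B f) (fnorm B g) => k p q /=.
nra.
Qed.

End OneForm.

(** A nonnegative number cannot cancel a point of a sector that avoids the negative
    real axis: the parallelogram spanned by [z p] and [q] has a diagonal comparable to
    the sum of its sides. The constant is the cosine of half of the extremal angle. *)
Lemma sector_coercive (k : R) (z : R[i]) (p q : R) : 0 <= k < 1 -> - k * normc z <= Re z ->
  0 <= p -> 0 <= q ->
  Num.sqrt ((1 - k) / 2) * (normc z * p + q) <= normc (z * p%:C + q%:C).
Proof.
move=> /andP[k0 k1] hz p0 q0.
have e0 : 0 <= (1 - k) / 2 by lra.
have n0 := normc_ge0 z.
rewrite -ler_sqr ?nnegrE ?normc_ge0 ?mulr_ge0 ?sqrtr_ge0 ?addr_ge0 ?mulr_ge0//.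
rewrite exprMn sqr_sqrtr// normc_sq.
have -> : Re (z * p%:C + q%:C) ^+ 2 + Im (z * p%:C + q%:C) ^+ 2 =
    (normc z * p) ^+ 2 + 2 * (Re z * (p * q)) + q ^+ 2.
  by rewrite exprMn normc_sq; case: z {hz n0} => x y /=; ring.
have h1 : - k * normc z * (p * q) <= Re z * (p * q) by rewrite ler_wpM2r// mulr_ge0.
have h2 : 0 <= (1 + k) * (normc z * p - q) ^+ 2 by rewrite mulr_ge0 ?sqr_ge0//; lra.
move: h1 h2; move: (normc z) (Re z) => n x; nra.
Qed.

End HermitianForms.

(** * Bases and solvability in a finite-dimensional space *)

Section FiniteDimensionalSpace.
Variables (R : realType) (X : eqType).
Local Notation fct := (X -> R[i]).
Implicit Types (f g h : fct) (a z : R[i]).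
Variables (V : set fct) (m : fct -> fct -> R[i]).
Hypothesis V0 : V (fun=> 0).
Hypothesis Vlin : forall a f g, V f -> V g -> V (fun x => a * f x + g x).
Hypothesis hm : hermitian_form m.
Hypothesis m_definite : forall f, V f -> fnorm m f = 0 -> f = fun=> 0.

Lemma subspace_comb (I : Type) (r : seq I) (c : I -> R[i]) (e : I -> fct) :
  (forall i, V (e i)) -> V (fun x => \sum_(i <- r) c i * e i x).
Proof.
move=> Ve; elim: r => [|i r IH].
  by rewrite (_ : (fun _ => _) = fun=> 0)//; apply/funext => x; rewrite big_nil.
have -> : (fun x => \sum_(j <- i :: r) c j * e j x) =
    (fun x => c i * e i x + \sum_(j <- r) c j * e j x).
  by apply/funext => x; rewrite big_cons.
exact: Vlin.
Qed.

Definition orthonormal_basis n (e : 'I_n -> fct) :=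
  [/\ forall i, V (e i), forall i j, m (e i) (e j) = (i == j)%:R &
      forall f, V f -> f = fun x => \sum_i m f (e i) * e i x].

(** The functions of [V] are determined by their values at the points [ps], so that an
    orthonormal family has at most that many members. A family of maximal length
    spans: otherwise the normalised residual of a function outside its span could be
    added. *)
Lemma orthonormal_basis_exists (ps : seq X) :
  (forall f, V f -> (forall p, p \in ps -> f p = 0) -> f = fun=> 0) ->
  exists n (e : 'I_n -> fct), orthonormal_basis e.
Proof.
move=> inj.
pose P n := `[< exists e : 'I_n -> fct,
  (forall i, V (e i)) /\ forall i j, m (e i) (e j) = (i == j)%:R >].
have P0 : exists n, P n.
  by exists 0%N; apply/asboolP; exists (fun=> fun=> 0); split; case.
have Pb n : P n -> (n <= size ps)%N.
  move=> /asboolP[e [Ve eo]].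
  pose A : 'M[R[i]]_(n, size ps) := \matrix_(i, k) e i (tnth (in_tuple ps) k).
  suff fA : row_free A by rewrite -(eqP fA) rank_leq_col.
  apply: inj_row_free => u uA.
  have f0 := inj _ (subspace_comb (index_enum 'I_n) (u ord0) Ve).
  have {}f0 : (fun x => \sum_i u ord0 i * e i x) = fun=> 0.
    apply: f0 => p pps.
    have [k ->] : exists k, p = tnth (in_tuple ps) k by exact/tnthP.
    transitivity ((u *m A) ord0 k); last by rewrite uA mxE.
    by rewrite mxE; apply: eq_bigr => i _; rewrite mxE.
  apply/rowP => j; rewrite mxE.
  have : m (fun x => \sum_i u ord0 i * e i x) (e j) = 0 by rewrite f0 form_zerol.
  rewrite form_comb// (bigD1 j)//= eo eqxx mulr1 big1 ?addr0// => i ij.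
  by rewrite eo (negbTE ij) mulr0.
pose n := ex_maxn P0 Pb.
have [Pn maxn] : P n /\ forall k, P k -> (k <= n)%N.
  by rewrite /n; case: ex_maxnP.
move/asboolP : (Pn) => [e [Ve eo]]; exists n, e; split => // f Vf.
pose g : fct := fun x => \sum_i (- m f (e i)) * e i x.
pose r : fct := fun x => 1 * f x + g x.
have Vr : V r by apply: Vlin => //; exact: subspace_comb.
have rj j : m r (e j) = 0.
  rewrite /r (form_linear hm) mul1r form_comb// (bigD1 j)//= eo eqxx mulr1.
  rewrite big1 ?addr0 ?subrr// => i ij; by rewrite eo (negbTE ij) mulr0.
have [r0|r0] := eqVneq (fnorm m r) 0.
  apply/funext => x; have := congr1 (@^~ x) (m_definite Vr r0).
  rewrite /r /g mul1r /= => /eqP; rewrite addr_eq0 => /eqP ->.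
  by rewrite -sumrN; apply: eq_bigr => i _; rewrite mulNr opprK.
exfalso; suff : P n.+1 by move/maxn; rewrite ltnn.
apply/asboolP.
pose u : fct := fun x => ((fnorm m r)^-1)%:C * r x + 0.
have Vu : V u by exact: Vlin.
have uj j : m u (e j) = 0 by rewrite (form_linear hm) rj mulr0 form_zerol// addr0.
have uu : m u u = 1.
  rewrite /u (form_linear hm) (form_antilinear hm) form_zerol// form_zeror// !addr0 form_diag//.
  rewrite conjc_real -!rmorphM/=.
  by rewrite expr2 mulrA mulrACA mulVf// mulr1.
exists (fun i => if unlift ord_max i is Some j then e j else u); split.
  by move=> i; case: unliftP.
move=> i j; case: unliftP => [i'|] ->; case: unliftP => [j'|] ->.
- by rewrite eo (inj_eq (@lift_inj _ _)).
- by rewrite (form_conj hm) uj conjc0 eq_sym (negbTE (neq_lift _ _)).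
- by rewrite uj (negbTE (neq_lift _ _)).
- by rewrite uu eqxx.
Qed.

Section Solve.
Variables (n : nat) (e : 'I_n -> fct) (he : orthonormal_basis e).

(** The Fredholm alternative in coordinates. It also covers a form [b] that is only
    semidefinite, as long as [l] vanishes on the functions that [b] does not see. *)
Lemma form_solve (b : fct -> fct -> R[i]) (l : fct -> R[i]) :
  (forall a f g h, b (fun x => a * f x + g x) h = a * b f h + b g h) ->
  (forall a f g h, b h (fun x => a * f x + g x) = conjc a * b h f + b h g) ->
  (forall a f g, l (fun x => a * f x + g x) = conjc a * l f + l g) ->
  (forall psi, V psi -> (forall w, V w -> b w psi = 0) -> l psi = 0) ->
  exists2 w, V w & forall psi, V psi -> b w psi = l psi.
Proof.
move=> bl br ll alt; have [Ve _ esp] := he.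
have l0 : l (fun=> 0) = 0.
  have := ll (-1) (fun=> 0) (fun=> 0).
  rewrite [X in l X](_ : _ = fun=> 0); last by apply/funext => x; rewrite mulr0 addr0.
  by rewrite rmorphN1 => ->; rewrite mulN1r addNr.
have b0 h : b h (fun=> 0) = 0.
  have := br (-1) (fun=> 0) (fun=> 0) h.
  rewrite [X in b _ X](_ : _ = fun=> 0); last by apply/funext => x; rewrite mulr0 addr0.
  by rewrite rmorphN1 => ->; rewrite mulN1r addNr.
have b0l h : b (fun=> 0) h = 0.
  have := bl (-1) (fun=> 0) (fun=> 0) h.
  rewrite [X in b X _](_ : _ = fun=> 0); last by apply/funext => x; rewrite mulr0 addr0.
  by move=> ->; rewrite mulN1r addNr.
have consE (r : seq 'I_n) (c : 'I_n -> R[i]) i :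
    (fun x => \sum_(j <- i :: r) c j * e j x) =
    (fun x => c i * e i x + \sum_(j <- r) c j * e j x).
  by apply/funext => x; rewrite big_cons.
have nilE (c : 'I_n -> R[i]) : (fun x => \sum_(j <- [::]) c j * e j x) = fun=> 0.
  by apply/funext => x; rewrite big_nil.
have lc (r : seq 'I_n) c : l (fun x => \sum_(j <- r) c j * e j x) = \sum_(j <- r) conjc (c j) * l (e j).
  by elim: r => [|i r IH]; rewrite ?nilE ?consE ?ll ?big_nil ?big_cons ?IH.
have brc (r : seq 'I_n) c h : b h (fun x => \sum_(j <- r) c j * e j x) = \sum_(j <- r) conjc (c j) * b h (e j).
  by elim: r => [|i r IH]; rewrite ?nilE ?consE ?br ?big_nil ?big_cons ?IH.
have blc (r : seq 'I_n) c h : b (fun x => \sum_(j <- r) c j * e j x) h = \sum_(j <- r) c j * b (e j) h.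
  by elim: r => [|i r IH]; rewrite ?nilE ?consE ?bl ?big_nil ?big_cons ?IH.
pose A : 'M[R[i]]_n := \matrix_(i, j) b (e i) (e j).
pose y : 'rV[R[i]]_n := \row_j l (e j).
have /submxP[c cA] : (y <= A)%MS.
  rewrite submxE; apply/eqP/matrixP => i k; rewrite ord1 [RHS]mxE.
  pose psi : fct := fun x => \sum_j conjc (cokermx A j k) * e j x.
  have Vpsi : V psi by exact: subspace_comb.
  have -> : (y *m cokermx A) ord0 k = l psi.
    rewrite mxE /psi lc; apply: eq_bigr => j _.
    by rewrite conjcK !mxE mulrC.
  apply: alt => // w Vw; rewrite (esp _ Vw) blc big1// => j _.
  suff -> : b (e j) psi = 0 by rewrite mulr0.
  transitivity ((A *m cokermx A) j k); last by rewrite mulmx_coker mxE.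
  rewrite /psi brc [RHS]mxE; apply: eq_bigr => i' _.
  by rewrite conjcK !mxE mulrC.
exists (fun x => \sum_j c ord0 j * e j x); first exact: subspace_comb.
move=> psi Vpsi; rewrite (esp _ Vpsi) brc lc; apply: eq_bigr => j _; congr (_ * _).
rewrite blc; transitivity (y ord0 j); last by rewrite mxE.
by rewrite cA mxE; apply: eq_bigr => i _; rewrite mxE.
Qed.

End Solve.

End FiniteDimensionalSpace.

(** * Estimates at one point of the contour *)

Section ResolventEstimates.
Variables (R : realType) (X : eqType).
Local Notation fct := (X -> R[i]).
Local Notation normc := (@Normc.normc R).
Implicit Types (f g h : fct) (a z : R[i]).
Variables (V : set fct) (m mh s : fct -> fct -> R[i]).
Hypothesis Vlin : forall a f g, V f -> V g -> V (fun x => a * f x + g x).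
Hypotheses (hm : hermitian_form m) (hmh : hermitian_form mh) (hs : hermitian_form s).
Variables (k C0 h c0 : R) (lam : R[i]).
Hypotheses (k0 : 0 <= k) (C00 : 0 <= C0) (h0 : 0 <= h) (c00 : 0 < c0).
Hypothesis m_mh : forall f, fnorm m f <= k * fnorm mh f.
Hypothesis mh_m : forall f, fnorm mh f <= k * fnorm m f.
Hypothesis eps2 : forall f g, normc (mh f g - m f g) <= C0 * h ^+ 2 * fnorm s f * fnorm s g.
Hypothesis eps1 : forall f g, normc (mh f g - m f g) <= C0 * h * fnorm m f * fnorm s g.
Hypothesis coercive : forall p q : R, 0 <= p -> 0 <= q ->
  c0 * (normc lam * p + q) <= normc (lam * p%:C + q%:C).
Local Notation l := (normc lam).
Local Notation r := (Num.sqrt l).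

Let l0 : 0 <= l := normc_ge0 lam.
Let r0 : 0 <= r := sqrtr_ge0 l.
Let rr : r ^+ 2 = l. Proof. exact: sqr_sqrtr. Qed.
Let c0n : 0 <= c0 := ltW c00.
Let ci : 0 <= c0^-1. Proof. by rewrite invr_ge0 ltW. Qed.

(** The equation of [w] is tested with [w] itself; since [lam] lies in a sector, the
    two terms cannot cancel. *)
Lemma energy M w F : hermitian_form M -> normc (lam * M w w + s w w) <= F ->
  c0 * (l * fnorm M w ^+ 2 + fnorm s w ^+ 2) <= F.
Proof.
move=> hM; apply: le_trans; rewrite !form_diag//.
by apply: coercive; exact: sqr_ge0.
Qed.

Let le_cancel (x a : R) : 0 <= x -> 0 <= a -> x ^+ 2 <= a * x -> x <= a.
Proof.
move=> x0 a0; have [->|xn] := eqVneq x 0; first by [].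
by rewrite expr2 ler_pM2r// lt_def xn.
Qed.

(** When the right-hand side of the energy inequality is linear in one of the two
    norms, dividing by that norm bounds both norms, with a power of [l] attached to
    each. *)
Let energy_x (x y A : R) : 0 <= x -> 0 <= y -> 0 <= A ->
  c0 * (l * x ^+ 2 + y ^+ 2) <= A * x -> l * x <= A / c0 /\ r * y <= A / c0.
Proof.
move=> x0 y0 A0 H.
have lx : l * x <= A / c0.
  rewrite ler_pdivlMr//; have [->|xn] := eqVneq x 0; first by rewrite mulr0 mul0r.
  rewrite -(@ler_pM2r _ x) ?lt_def ?xn//; apply: le_trans H.
  have : 0 <= c0 * y ^+ 2 by rewrite mulr_ge0 ?sqr_ge0.
  by lra.
split => //.
have Ac : 0 <= A / c0 := divr_ge0 A0 (ltW c00).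
rewrite -ler_sqr ?nnegrE ?mulr_ge0// exprMn rr.
have y2 : y ^+ 2 <= A / c0 * x.
  rewrite mulrAC ler_pdivlMr//; apply: le_trans H.
  have : 0 <= c0 * (l * x ^+ 2) by rewrite !mulr_ge0 ?sqr_ge0.
  by lra.
apply: (@le_trans _ _ (l * (A / c0 * x))); first by rewrite ler_wpM2l.
rewrite (_ : l * (A / c0 * x) = A / c0 * (l * x)); last by ring.
by rewrite expr2 ler_wpM2l.
Qed.

Let energy_y (x y A : R) : 0 <= x -> 0 <= y -> 0 <= A ->
  c0 * (l * x ^+ 2 + y ^+ 2) <= A * y -> y <= A / c0 /\ r * x <= A / c0.
Proof.
move=> x0 y0 A0 H.
have Ac : 0 <= A / c0 := divr_ge0 A0 (ltW c00).
have yA : y <= A / c0.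
  apply: le_cancel => //; rewrite mulrAC ler_pdivlMr//; apply: le_trans H.
  have : 0 <= c0 * (l * x ^+ 2) by rewrite !mulr_ge0 ?sqr_ge0.
  by lra.
split => //.
rewrite -ler_sqr ?nnegrE ?mulr_ge0// exprMn rr.
apply: (@le_trans _ _ (A / c0 * y)); last by rewrite expr2 ler_wpM2l.
rewrite mulrAC ler_pdivlMr//; apply: le_trans H.
have : 0 <= c0 * y ^+ 2 by rewrite mulr_ge0 ?sqr_ge0.
by lra.
Qed.

Variables (v chi q w : fct).
Hypotheses (Vv : V v) (Vchi : V chi) (Vq : V q) (Vw : V w).
Hypothesis chiE : forall psi, V psi -> lam * m chi psi + s chi psi = - s v psi.
Hypothesis qE : forall psi, V psi -> s q psi = mh chi psi - m chi psi.
Hypothesis wE : forall psi, V psi -> lam * mh w psi + s w psi = s q psi.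

Let chi_energy A : normc (s v chi) <= A ->
  c0 * (l * fnorm m chi ^+ 2 + fnorm s chi ^+ 2) <= A.
Proof. by move=> H; apply: energy => //; rewrite chiE// normcN. Qed.

Lemma chi_bound_smooth f0 : (forall psi, V psi -> mh f0 psi = s v psi) ->
  l * fnorm m chi <= k ^+ 2 / c0 * fnorm m f0 /\ r * fnorm s chi <= k ^+ 2 / c0 * fnorm m f0.
Proof.
move=> f0E; rewrite mulrAC.
have ff := fnorm_ge0 m f0; have A0 : 0 <= k ^+ 2 * fnorm m f0 by rewrite mulr_ge0 ?sqr_ge0.
apply: energy_x; try exact: fnorm_ge0 => //; first exact: A0.
apply: chi_energy; rewrite -f0E//; apply: le_trans (form_Cauchy hmh _ _) _.
rewrite expr2 -[leRHS]mulrA mulrACA (mulrC k) -mulrA.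
by rewrite mulrA ler_pM ?fnorm_ge0// mulrC.
Qed.

Lemma chi_bound_energy : fnorm s chi <= fnorm s v / c0 /\ r * fnorm m chi <= fnorm s v / c0.
Proof.
apply: energy_y; rewrite ?fnorm_ge0//.
by apply: chi_energy; exact: form_Cauchy.
Qed.

(** The function [chi + v] solves the equation of [chi] with right-hand side [lam m
    v], to which the energy inequality applies. *)
Lemma chi_bound_rough : l != 0 -> fnorm m chi <= (c0^-1 + 1) * fnorm m v.
Proof.
move=> ln0; pose u : fct := fun x => 1 * chi x + v x.
have Vu : V u by exact: Vlin.
have E : c0 * (l * fnorm m u ^+ 2 + fnorm s u ^+ 2) <= l * fnorm m v * fnorm m u.
  apply: energy => //.
  have -> : lam * m u u + s u u = lam * m v u.
    rewrite {1 3}/u !(form_linear hm) !(form_linear hs) !mul1r mulrDr.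
    by rewrite addrACA chiE//; ring.
  by rewrite Normc.normcM -mulrA ler_wpM2l// form_Cauchy.
have [ub _] := energy_x (fnorm_ge0 _ _) (fnorm_ge0 _ _) (mulr_ge0 l0 (fnorm_ge0 _ _)) E.
have {}ub : fnorm m u <= fnorm m v / c0.
  by move: ub; rewrite -mulrA ler_pM2l// lt_def ln0.
have -> : chi = fun x => (-1) * v x + u x.
  by apply/funext => x; rewrite /u; ring.
apply: le_trans (fnormD hm _ _ _) _.
have -> : normc (-1) = 1 by rewrite normcN Normc.normc1.
by rewrite mul1r mulrDl mul1r addrC lerD2r mulrC.
Qed.

(** The definition of [q] is tested with [q]. *)
Lemma q_bound : fnorm s q <= C0 * h ^+ 2 * fnorm s chi /\ fnorm s q <= C0 * h * fnorm m chi.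
Proof.
have sq : fnorm s q ^+ 2 = normc (mh chi q - m chi q).
  by rewrite -qE// form_diag// normc_real ger0_norm// sqr_ge0.
split; apply: le_cancel; rewrite ?fnorm_ge0 ?mulr_ge0 ?sqr_ge0 ?fnorm_ge0//; rewrite sq.
  exact: eps2.
exact: eps1.
Qed.

Lemma w_bound : fnorm s w <= fnorm s q / c0 /\ r * fnorm m w <= k * (fnorm s q / c0).
Proof.
have [H1 H2] : fnorm s w <= fnorm s q / c0 /\ r * fnorm mh w <= fnorm s q / c0.
  apply: energy_y; rewrite ?fnorm_ge0//; apply: energy => //.
  by rewrite wE//; exact: form_Cauchy.
split => //; apply: le_trans (_ : r * (k * fnorm mh w) <= _); first by rewrite ler_wpM2l.
by rewrite mulrCA ler_wpM2l.
Qed.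

(** The function [w - q] solves the equation of [w] with right-hand side [- lam mh q]. *)
Lemma w_bound_mass : l != 0 -> fnorm m w <= (1 + k ^+ 2 / c0) * fnorm m q.
Proof.
move=> ln0; pose u : fct := fun x => (-1) * q x + w x.
have Vu : V u by exact: Vlin.
have E : c0 * (l * fnorm mh u ^+ 2 + fnorm s u ^+ 2) <= l * fnorm mh q * fnorm mh u.
  apply: energy => //.
  have -> : lam * mh u u + s u u = - (lam * mh q u).
    rewrite {1 3}/u !(form_linear hmh) !(form_linear hs) mulrDr.
    by rewrite addrACA wE//; ring.
  by rewrite normcN Normc.normcM -mulrA ler_wpM2l// form_Cauchy.
have [ub _] := energy_x (fnorm_ge0 _ _) (fnorm_ge0 _ _) (mulr_ge0 l0 (fnorm_ge0 _ _)) E.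
have {}ub : fnorm mh u <= fnorm mh q / c0.
  by move: ub; rewrite -mulrA ler_pM2l// lt_def ln0.
have -> : w = fun x => 1 * q x + u x.
  by apply/funext => x; rewrite /u; ring.
apply: le_trans (fnormD hm _ _ _) _.
rewrite Normc.normc1 mulrDl lerD2l.
apply: le_trans (m_mh u) _.
apply: (@le_trans _ _ (k * (k * fnorm m q / c0))).
  apply: ler_wpM2l => //; apply: le_trans ub _; exact: ler_wpM2r.
by rewrite (_ : k ^+ 2 / c0 * _ = k * (k * fnorm m q / c0))//; ring.
Qed.

(** Data with the discrete Laplacian [f0] of [v] under control. For the mass norm, the
    factor [l] is spent half on [w] and half on the gradient of [chi]; for the
    gradient norm it is spent on the mass norm of [chi], where the quadrature error
    only gives one power of [h]. *)
Lemma w_estimate_smooth f0 : (forall psi, V psi -> mh f0 psi = s v psi) ->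
  l * (fnorm m w + h * fnorm s w) <=
    C0 * (k + 1) * (k ^+ 2 / c0) / c0 * h ^+ 2 * fnorm m f0.
Proof.
move=> f0E; have [c1 c2] := chi_bound_smooth f0E; have [q1 q2] := q_bound.
have [w1 w2] := w_bound.
set F := k ^+ 2 / c0 * fnorm m f0 in c1 c2.
have -> : C0 * (k + 1) * (k ^+ 2 / c0) / c0 * h ^+ 2 * fnorm m f0 =
  k * (C0 * h ^+ 2 * F / c0) + h * (C0 * h * F / c0) by rewrite /F; ring.
rewrite mulrDr; apply: lerD.
  rewrite -rr expr2 -mulrA; apply: le_trans (ler_wpM2l r0 w2) _.
  rewrite mulrCA ler_wpM2l// mulrA ler_wpM2r// .
  apply: le_trans (ler_wpM2l r0 q1) _.
  by rewrite mulrCA ler_wpM2l// mulr_ge0 ?sqr_ge0.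
rewrite mulrCA ler_wpM2l//; apply: le_trans (ler_wpM2l l0 w1) _.
rewrite mulrA ler_wpM2r//; apply: le_trans (ler_wpM2l l0 q2) _.
by rewrite mulrCA ler_wpM2l// mulr_ge0.
Qed.

(** Data with finite energy. The factor [sqrt l] is spent on [w] for the mass norm,
    and on [chi] for the gradient norm. *)
Lemma w_estimate_energy :
  r * (fnorm m w + h * fnorm s w) <= C0 * (k + 1) / c0 / c0 * h ^+ 2 * fnorm s v.
Proof.
have [c1 c2] := chi_bound_energy; have [q1 q2] := q_bound; have [w1 w2] := w_bound.
have -> : C0 * (k + 1) / c0 / c0 * h ^+ 2 * fnorm s v =
  k * (C0 * h ^+ 2 * (fnorm s v / c0) / c0) + h * (C0 * h * (fnorm s v / c0) / c0) by ring.
rewrite mulrDr; apply: lerD.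
  apply: le_trans w2 _; rewrite ler_wpM2l// ler_wpM2r//; apply: le_trans q1 _.
  by rewrite ler_wpM2l// mulr_ge0 ?sqr_ge0.
rewrite mulrCA ler_wpM2l//; apply: le_trans (ler_wpM2l r0 w1) _.
rewrite [leLHS]mulrA ler_wpM2r//; apply: le_trans (ler_wpM2l r0 q2) _.
by rewrite [leLHS]mulrCA ler_wpM2l// mulr_ge0.
Qed.

(** Rough data leave no power of [l] to be spent; the mass norm of [w] is bounded by
    the one of [q], and this is where a second-order bound of [q] in the mass norm has
    to be assumed. *)
Lemma w_estimate_rough (B : R) : l != 0 -> 0 <= B -> fnorm m q <= B * h ^+ 2 * fnorm m chi ->
  fnorm m w + h * fnorm s w <=
    ((1 + k ^+ 2 / c0) * B + C0 / c0) * (c0^-1 + 1) * h ^+ 2 * fnorm m v.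
Proof.
move=> ln0 B0 qB; have c3 := chi_bound_rough ln0; have [q1 q2] := q_bound; have [w1 _] := w_bound.
have w3 := w_bound_mass ln0.
set F := (c0^-1 + 1) * fnorm m v in c3.
have -> : ((1 + k ^+ 2 / c0) * B + C0 / c0) * (c0^-1 + 1) * h ^+ 2 * fnorm m v =
  (1 + k ^+ 2 / c0) * (B * h ^+ 2 * F) + h * (C0 * h * F / c0) by rewrite /F; ring.
apply: lerD.
  apply: le_trans w3 _; rewrite ler_wpM2l//.
    by rewrite addr_ge0// divr_ge0 ?sqr_ge0.
  by apply: le_trans qB _; rewrite ler_wpM2l// mulr_ge0 ?sqr_ge0.
rewrite ler_wpM2l//; apply: le_trans w1 _; rewrite ler_wpM2r//; apply: le_trans q2 _.
by rewrite ler_wpM2l// mulr_ge0.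
Qed.

End ResolventEstimates.

(** * Comparison of the nodal forms *)

Section FormComparison.
Variable R : realType.
Local Notation fct := (R * R -> R[i]).
Local Notation Re := (@complex.Re R).
Local Notation Im := (@complex.Im R).
Local Notation normc := (@Normc.normc R).
Implicit Types (K L : {fset R * R}) (x y p : R * R) (f g : fct) (T : {fset {fset R * R}}).
Implicit Types (W : {fset R * R} -> 'I_3 -> 'I_3 -> R) (u : 'I_3 -> R).

Definition quad W K u : R := \sum_i \sum_j u i * u j * W K i j.

Let ReE (I : Type) (r : seq I) (F : I -> R[i]) : Re (\sum_(i <- r) F i) = \sum_(i <- r) Re (F i).
Proof. by elim: r => [|i r IH]; rewrite ?big_nil// !big_cons -IH; case: (F i) (\sum_(j <- r) F j) => [? ?] []. Qed.

Let conj_term (a b : R[i]) (w : R) : conjc (a * conjc b * w%:C) = b * conjc a * w%:C.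
Proof. by case: a b => [a1 a2] [b1 b2] /=; apply/eqP; rewrite eq_complex /=; apply/andP; split; apply/eqP; ring. Qed.

Lemma Re_bform T W f : Re (bform T W f f) =
  \sum_(K <- T) (quad W K (fun i => Re (f (vtx K i))) + quad W K (fun i => Im (f (vtx K i)))).
Proof.
rewrite /bform ReE; apply: eq_bigr => K _; rewrite /quad ReE -big_split.
apply: eq_bigr => i _; rewrite ReE -big_split; apply: eq_bigr => j _.
by case: (f (vtx K i)) => a b; case: (f (vtx K j)) => c d /=; ring.
Qed.

Lemma bform_hermitian T W :
  (forall K i j, K \in T -> W K i j = W K j i) ->
  (forall K u, K \in T -> 0 <= quad W K u) -> hermitian_form (bform T W).
Proof.
move=> Wsym Wpos; split=> [a f g h|f g|f].
- rewrite /bform big_distrr -big_split; apply: eq_bigr => K _.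
  rewrite big_distrr -big_split; apply: eq_bigr => i _.
  by rewrite big_distrr -big_split; apply: eq_bigr => j _ /=; ring.
- rewrite /bform rmorph_sum; apply: eq_big_seq => K KT.
  rewrite rmorph_sum exchange_big; apply: eq_bigr => i _ /=.
  by rewrite rmorph_sum; apply: eq_bigr => j _; rewrite [RHS]conj_term Wsym.
- by rewrite Re_bform big_seq; apply: sumr_ge0 => K KT; rewrite addr_ge0// Wpos.
Qed.

Lemma fnorm_bform_le T W W' f (c : R) : 0 <= c ->
  hermitian_form (bform T W) -> hermitian_form (bform T W') ->
  (forall K u, K \in T -> quad W K u <= c ^+ 2 * quad W' K u) ->
  fnorm (bform T W) f <= c * fnorm (bform T W') f.
Proof.
move=> c0 hW hW' H.
rewrite -ler_sqr ?nnegrE ?mulr_ge0 ?fnorm_ge0// exprMn !fnorm_sq// !Re_bform.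
rewrite big_distrr/= big_seq [leRHS]big_seq; apply: ler_sum => K KT.
by rewrite mulrDr lerD// H.
Qed.

Lemma quad_diag K u (w a b : R) :
  quad (fun _ i j => w * ((i == j)%:R * a + b)) K u =
  w * (a * \sum_i u i ^+ 2 + b * (\sum_i u i) ^+ 2).
Proof. by rewrite /quad !big_I3/=; ring. Qed.

Lemma sum_sq_le u : (\sum_i u i) ^+ 2 <= 3 * \sum_i u i ^+ 2.
Proof.
rewrite !big_I3 -subr_ge0.
have -> : 3 * (u o0 ^+ 2 + u o1 ^+ 2 + u o2 ^+ 2) - (u o0 + u o1 + u o2) ^+ 2 =
  (u o0 - u o1) ^+ 2 + (u o0 - u o2) ^+ 2 + (u o1 - u o2) ^+ 2 by ring.
by rewrite !addr_ge0 ?sqr_ge0.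
Qed.

Lemma sum_sq_ge0 u : 0 <= \sum_i u i ^+ 2.
Proof. by apply: sumr_ge0 => i _; exact: sqr_ge0. Qed.

(** The deviation of the nodal values from their mean on each triangle. It is
    controlled by [h] times the gradient, and the two mass forms differ by a multiple
    of it. *)
Definition osc_form T := bform T (fun K i j => `|jac K| * ((i == j)%:R * 1 + (- 3^-1))).

Lemma osc_quadE K u (w : R) :
  quad (fun _ i j => w * ((i == j)%:R * 1 + (- 3^-1))) K u =
  w * (((u o0 - u o1) ^+ 2 + (u o0 - u o2) ^+ 2 + (u o1 - u o2) ^+ 2) / 3).
Proof. by rewrite quad_diag !big_I3; field. Qed.

Let md := mass_diag R. Let mo := mass_off R.
Let ld := lump_diag R. Let lo := lump_off R. Let A := tri_area R.

Let md0 : 0 < md := mass_diag_gt0 R.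
Let ld0 : 0 < ld := lump_diag_gt0 R.
Let mo0 : 0 <= mo := mass_off_ge0 R.
Let lo0 : 0 <= lo := lump_off_ge0 R.
Let A0 : 0 < A := tri_area_gt0 R.

Lemma diag_quad_ge K u (w a b : R) : 0 <= w -> 0 <= b ->
  w * a * \sum_i u i ^+ 2 <= quad (fun _ i j => 1 * (w * ((i == j)%:R * a + b))) K u.
Proof.
move=> w0 b0; rewrite (_ : quad _ K u = quad (fun _ i j => w * ((i == j)%:R * a + b)) K u).
  by rewrite quad_diag -mulrA ler_wpM2l// lerDl mulr_ge0// sqr_ge0.
by rewrite /quad; apply: eq_bigr => i _; apply: eq_bigr => j _; rewrite mul1r.
Qed.

Lemma diag_quad_le K u (w a b : R) : 0 <= w -> 0 <= b ->
  quad (fun _ i j => 1 * (w * ((i == j)%:R * a + b))) K u <= w * (a + 3 * b) * \sum_i u i ^+ 2.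
Proof.
move=> w0 b0; rewrite (_ : quad _ K u = quad (fun _ i j => w * ((i == j)%:R * a + b)) K u).
  rewrite quad_diag -mulrA ler_wpM2l// mulrDl lerD2l -mulrA (mulrCA 3) ler_wpM2l// sum_sq_le//.
by rewrite /quad; apply: eq_bigr => i _; apply: eq_bigr => j _; rewrite mul1r.
Qed.

Lemma hermitian_diag T (a b : R) : 0 <= a -> 0 <= b ->
  hermitian_form (bform T (fun K i j => 1 * (`|jac K| * ((i == j)%:R * a + b)))).
Proof.
move=> a0 b0; apply: bform_hermitian => [K i j _|K u _]; first by rewrite eq_sym.
by apply: le_trans (diag_quad_ge K u a _ b0) => //; rewrite !mulr_ge0// sum_sq_ge0.
Qed.

Lemma mass_hermitian T : hermitian_form (mass_form T).
Proof. by apply: hermitian_diag => //; exact: ltW. Qed.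

Lemma lump_hermitian T : hermitian_form (lump_form T).
Proof. by apply: hermitian_diag => //; exact: ltW. Qed.

Lemma osc_hermitian T : hermitian_form (osc_form T).
Proof.
apply: bform_hermitian => [K i j _|K u _]; first by rewrite eq_sym.
rewrite (_ : quad _ K u = `|jac K| * (((u o0 - u o1) ^+ 2 + (u o0 - u o2) ^+ 2 + (u o1 - u o2) ^+ 2) / 3)).
  by rewrite mulr_ge0// divr_ge0// !addr_ge0// sqr_ge0.
exact: osc_quadE.
Qed.

Lemma grad_quadE K u :
  quad (fun K i j => (dlam1 K i * dlam1 K j + dlam2 K i * dlam2 K j) * (`|jac K| * A)) K u =
  `|jac K| * A * ((\sum_i dlam1 K i * u i) ^+ 2 + (\sum_i dlam2 K i * u i) ^+ 2).
Proof. by rewrite /quad !big_I3; ring. Qed.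

Lemma grad_hermitian T : hermitian_form (grad_form T).
Proof.
apply: bform_hermitian => [K i j _|K u _].
  by rewrite [dlam1 K i * _]mulrC [dlam2 K i * _]mulrC.
by rewrite grad_quadE !mulr_ge0 ?addr_ge0 ?sqr_ge0// ltW.
Qed.

Definition norm_equiv : R := Num.sqrt ((md + 3 * mo) / ld) + Num.sqrt ((ld + 3 * lo) / md).

Let diag_compare T (a b a' b' : R) f : 0 <= a -> 0 <= b -> 0 < a' -> 0 <= b' ->
  fnorm (bform T (fun K i j => 1 * (`|jac K| * ((i == j)%:R * a + b)))) f <=
  Num.sqrt ((a + 3 * b) / a') *
  fnorm (bform T (fun K i j => 1 * (`|jac K| * ((i == j)%:R * a' + b')))) f.
Proof.
move=> a0 b0 a'0 b'0; apply: fnorm_bform_le; first exact: sqrtr_ge0.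
- exact: hermitian_diag.
- by apply: hermitian_diag => //; exact: ltW.
move=> K u _; rewrite sqr_sqrtr; last by rewrite divr_ge0 ?addr_ge0 ?mulr_ge0// ltW.
apply: (@le_trans _ _ (`|jac K| * (a + 3 * b) * \sum_i u i ^+ 2)); first exact: diag_quad_le.
apply: (@le_trans _ _ ((a + 3 * b) / a' * (`|jac K| * a' * \sum_i u i ^+ 2))).
  rewrite (_ : (a + 3 * b) / a' * _ = `|jac K| * (a + 3 * b) * \sum_i u i ^+ 2)//.
  by field; rewrite gt_eqF.
apply: ler_wpM2l; first by rewrite divr_ge0 ?addr_ge0 ?mulr_ge0// ltW.
exact: diag_quad_ge.
Qed.

Lemma mass_le_lump T f : fnorm (mass_form T) f <= norm_equiv * fnorm (lump_form T) f.
Proof.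
apply: le_trans (diag_compare _ _ (ltW md0) mo0 ld0 lo0) _.
by rewrite ler_wpM2r ?fnorm_ge0// lerDl sqrtr_ge0.
Qed.

Lemma lump_le_mass T f : fnorm (lump_form T) f <= norm_equiv * fnorm (mass_form T) f.
Proof.
apply: le_trans (diag_compare _ _ (ltW ld0) lo0 md0 mo0) _.
by rewrite ler_wpM2r ?fnorm_ge0// lerDr sqrtr_ge0.
Qed.

Lemma norm_equiv_ge0 : 0 <= norm_equiv.
Proof. by rewrite addr_ge0// sqrtr_ge0. Qed.

Lemma osc_le_mass T f : fnorm (osc_form T) f <= (Num.sqrt md)^-1 * fnorm (mass_form T) f.
Proof.
apply: fnorm_bform_le; [by rewrite invr_ge0 sqrtr_ge0|exact: osc_hermitian|exact: mass_hermitian|].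
move=> K u _; rewrite exprVn sqr_sqrtr ?(ltW md0)//.
rewrite (_ : quad _ K u = `|jac K| * (((u o0 - u o1) ^+ 2 + (u o0 - u o2) ^+ 2 + (u o1 - u o2) ^+ 2) / 3)); last exact: osc_quadE.
apply: (@le_trans _ _ (md^-1 * (`|jac K| * md * \sum_i u i ^+ 2))); last first.
  by rewrite ler_wpM2l ?invr_ge0 ?(ltW md0)//; apply: diag_quad_ge.
rewrite (_ : md^-1 * _ = `|jac K| * \sum_i u i ^+ 2); last by field; rewrite gt_eqF.
rewrite ler_wpM2l// -subr_ge0 big_I3.
rewrite (_ : _ - _ = ((u o0 + u o1 + u o2) ^+ 2) / 3); last by field.
by rewrite divr_ge0// sqr_ge0.
Qed.

(** The two reference matrices [d I + o J] have equal row sums, so that their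
    difference is a multiple of the projection [I - J / 3] onto the vectors of mean
    zero. *)
Lemma lump_sub_mass T f g :
  lump_form T f g - mass_form T f g = (ld - md)%:C * osc_form T f g.
Proof.
have E : lo - mo = - (ld - md) / 3 by have := lump_massE R; rewrite -/ld -/lo -/md -/mo; lra.
rewrite /lump_form /mass_form /osc_form /bform -sumrB big_distrr; apply: eq_bigr => K _.
rewrite -sumrB big_distrr; apply: eq_bigr => i _; rewrite -sumrB big_distrr.
apply: eq_bigr => j _; rewrite /= -mulrBr -rmorphB/= [RHS]mulrCA -rmorphM/=; congr (_ * _%:C).
rewrite -/ld -/lo -/md -/mo.
have -> : lo = mo - (ld - md) / 3 by move: E; lra.
by field.
Qed.

Section Mesh.
Local Notation edist := Defs.edist.
Variables (Omega : set (R * R)) (T : {fset {fset R * R}}) (h : R).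
Hypothesis hT : triangulation Omega T.
Hypothesis hmesh : mesh_size T = h.
Local Notation conv := Defs.conv.

Let T3 K : K \in T -> #|` K| = 3%N.
Proof. by case: hT => h' _ _ /h'[]. Qed.

Let Tj K : K \in T -> jac K != 0.
Proof. by move=> KT; apply: jac_neq0; [exact: T3|case: hT => h' _ _; exact: (h' K KT).2]. Qed.

Lemma vtx_conv K i : K \in T -> conv K (vtx K i).
Proof.
move=> KT; apply/conv_lam; [exact: T3|exact: Tj|move=> j].
by rewrite lam_vtx ?ler0n//; exact: Tj.
Qed.

Lemma edge_le_mesh K i j : K \in T -> edist (vtx K i) (vtx K j) <= h.
Proof.
move=> KT; rewrite -hmesh /mesh_size.
apply: (@le_trans _ _ (diameter (conv K))); last first.
  exact: (le_bigmax_seq _ _ xpredT (fun K => diameter (conv K)) KT isT).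
rewrite /diameter; apply: ub_le_sup; last by exists (vtx K i), (vtx K j); split => //; exact: vtx_conv.
pose M : R := \sum_(p <- K) (`|p.1| + `|p.2|).
have bnd x : conv K x -> `|x.1| <= M /\ `|x.2| <= M.
  move=> [w [w0 w1 -> ->]].
  have wle p : p \in K -> `|w p| <= 1.
    move=> pK; rewrite ger0_norm ?w0// -w1 (big_fsetD1 p)//= lerDl big_seq.
    by apply: sumr_ge0 => q /fsetD1P[_ /w0].
  split; apply: (le_trans (ler_norm_sum _ _ _)); rewrite /M big_seq [leRHS]big_seq;
    apply: ler_sum => p pK; rewrite normrM.
    by rewrite (le_trans (ler_wpM2r _ (wle p pK)))// mul1r lerDl.
  by rewrite (le_trans (ler_wpM2r _ (wle p pK)))// mul1r lerDr.
exists (Num.sqrt ((2 * M) ^+ 2 + (2 * M) ^+ 2)) => _ [x [y [/bnd[x1 x2] /bnd[y1 y2] ->]]].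
have sq (a b : R) : `|a| <= M -> `|b| <= M -> (a - b) ^+ 2 <= (2 * M) ^+ 2.
  move=> aM bM; rewrite -ler_sqrt ?sqr_ge0// !sqrtr_sqr.
  apply: (le_trans (ler_normB _ _)); apply: le_trans (ler_norm _).
  by rewrite mulr2n mulrDl mul1r lerD.
by rewrite ler_sqrt ?addr_ge0 ?sqr_ge0// lerD// sq.
Qed.

(** Cauchy-Schwarz inequality for the increment of an affine function along an edge,
    whose length is at most [h]. *)
Let nodal_diff K u i j : K \in T ->
  (u i - u j) ^+ 2 <= h ^+ 2 * ((\sum_k dlam1 K k * u k) ^+ 2 + (\sum_k dlam2 K k * u k) ^+ 2).
Proof.
move=> KT.
set p := \sum_k dlam1 K k * u k; set q := \sum_k dlam2 K k * u k.
pose dx := (vtx K i).1 - (vtx K j).1; pose dy := (vtx K i).2 - (vtx K j).2.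
have uE l : u l = p * (vtx K l).1 + q * (vtx K l).2 + \sum_k lam K (0, 0) k * u k.
  transitivity (\sum_k lam K (vtx K l) k * u k).
    rewrite (bigD1 l)//= lam_vtx ?Tj// eqxx mul1r big1 ?addr0// => k kl.
    by rewrite lam_vtx ?Tj// (negbTE kl) mul0r.
  rewrite /p /q !big_distrl -!big_split/=; apply: eq_bigr => k _.
  by rewrite lamE; ring.
have -> : u i - u j = p * dx + q * dy by rewrite (uE i) (uE j) /dx /dy; ring.
have h0 : 0 <= h by apply: le_trans (edge_le_mesh i j KT); exact: sqrtr_ge0.
have dh : dx ^+ 2 + dy ^+ 2 <= h ^+ 2.
  have := edge_le_mesh i j KT; rewrite /edist -/dx -/dy -(@ler_sqr _ _ h) ?nnegrE ?sqrtr_ge0//.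
  by rewrite sqr_sqrtr ?addr_ge0 ?sqr_ge0.
apply: (@le_trans _ _ ((dx ^+ 2 + dy ^+ 2) * (p ^+ 2 + q ^+ 2))).
  rewrite -subr_ge0 (_ : _ - _ = (p * dy - q * dx) ^+ 2); last by ring.
  exact: sqr_ge0.
by rewrite ler_wpM2r// addr_ge0 ?sqr_ge0.
Qed.

Lemma osc_le_grad f : 0 <= h ->
  fnorm (osc_form T) f <= h * (Num.sqrt A)^-1 * fnorm (grad_form T) f.
Proof.
move=> h0; apply: fnorm_bform_le;
  [by rewrite mulr_ge0// invr_ge0 sqrtr_ge0|exact: osc_hermitian|exact: grad_hermitian|].
move=> K u KT; rewrite exprMn exprVn sqr_sqrtr ?(ltW A0)// grad_quadE.
rewrite (_ : quad _ K u = `|jac K| * (((u o0 - u o1) ^+ 2 + (u o0 - u o2) ^+ 2 + (u o1 - u o2) ^+ 2) / 3)); last exact: osc_quadE.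
set G := (\sum_i dlam1 K i * u i) ^+ 2 + (\sum_i dlam2 K i * u i) ^+ 2.
rewrite (_ : h ^+ 2 / A * _ = `|jac K| * (h ^+ 2 * G)); last by field; rewrite gt_eqF.
rewrite ler_wpM2l//.
have := (nodal_diff u o0 o1 KT, nodal_diff u o0 o2 KT, nodal_diff u o1 o2 KT) => -[[]].
rewrite -/G; lra.
Qed.

Definition quadrature_const : R := `|ld - md| * (A^-1 + (Num.sqrt md)^-1 * (Num.sqrt A)^-1).

Lemma quadrature_const_ge0 : 0 <= quadrature_const.
Proof. by rewrite mulr_ge0// addr_ge0 ?mulr_ge0 ?invr_ge0 ?sqrtr_ge0// ltW. Qed.

Let eps_osc f g : normc (lump_form T f g - mass_form T f g) <=
  `|ld - md| * (fnorm (osc_form T) f * fnorm (osc_form T) g).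
Proof.
rewrite lump_sub_mass Normc.normcM normc_real ler_wpM2l//.
by apply: form_Cauchy; exact: osc_hermitian.
Qed.

(** Both factors of the oscillation form are bounded by their gradients; in the next
    inequality this is done for the second factor only, at the price of one power of
    [h]. *)
Lemma quadrature_error2 f g : 0 <= h -> normc (lump_form T f g - mass_form T f g) <=
  quadrature_const * h ^+ 2 * fnorm (grad_form T) f * fnorm (grad_form T) g.
Proof.
move=> h0; apply: le_trans (eps_osc f g) _; rewrite /quadrature_const -!mulrA ler_wpM2l//.
apply: (@le_trans _ _ ((h * (Num.sqrt A)^-1 * fnorm (grad_form T) f) *
   (h * (Num.sqrt A)^-1 * fnorm (grad_form T) g))).
  by apply: ler_pM; rewrite ?fnorm_ge0 ?osc_le_grad.
rewrite [leLHS](_ : _ = (Num.sqrt A ^+ 2)^-1 * (h * (h * (fnorm (grad_form T) f * fnorm (grad_form T) g)))).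
  rewrite sqr_sqrtr ?(ltW A0)// ler_wpM2r ?mulr_ge0 ?fnorm_ge0//.
  by rewrite lerDl mulr_ge0 ?invr_ge0 ?sqrtr_ge0.
by field; rewrite gt_eqF// sqrtr_gt0.
Qed.

Lemma quadrature_error1 f g : 0 <= h -> normc (lump_form T f g - mass_form T f g) <=
  quadrature_const * h * fnorm (mass_form T) f * fnorm (grad_form T) g.
Proof.
move=> h0; apply: le_trans (eps_osc f g) _; rewrite /quadrature_const -!mulrA ler_wpM2l//.
apply: (@le_trans _ _ (((Num.sqrt md)^-1 * fnorm (mass_form T) f) *
   (h * (Num.sqrt A)^-1 * fnorm (grad_form T) g))).
  by apply: ler_pM; rewrite ?fnorm_ge0 ?osc_le_grad ?osc_le_mass.
rewrite [leLHS](_ : _ = ((Num.sqrt md)^-1 * (Num.sqrt A)^-1) *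
   (h * (fnorm (mass_form T) f * fnorm (grad_form T) g))); last by ring.
rewrite ler_wpM2r ?mulr_ge0 ?fnorm_ge0//.
by rewrite lerDr invr_ge0 ltW.
Qed.

Lemma Vh_zero f : Vh Omega T f -> (forall K i, K \in T -> f (vtx K i) = 0) -> f = fun=> 0.
Proof.
move=> Vf fv; apply/funext => x.
have [xO|xO] := pselect (closure Omega x); last first.
  by case: Vf => _ f0 _; apply: f0 => /subset_closure.
case: (hT) => _ _; move/seteqP => [_ /(_ x xO)] [K /= KT Kx].
rewrite (Vh_nodal hT Vf KT Kx) big1// => i _; by rewrite fv// mulr0.
Qed.

Lemma mass_definite f : Vh Omega T f -> fnorm (mass_form T) f = 0 -> f = fun=> 0.
Proof.
move=> Vf f0; apply: (Vh_zero Vf) => K i KT.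
have := fnorm_sq (mass_hermitian T) f; rewrite f0 expr0n/= Re_bform => /esym/eqP.
have q0 L u : 0 <= quad (fun K i j => 1 * (`|jac K| * ((i == j)%:R * md + mo))) L u.
  by apply: le_trans (diag_quad_ge L u md _ mo0) => //; rewrite !mulr_ge0 ?sum_sq_ge0// ltW.
rewrite psumr_eq0; last by move=> L _; rewrite addr_ge0//; exact: q0.
move/allP => /(_ K KT) /=.
rewrite paddr_eq0; [|exact: q0|exact: q0] => /andP[/eqP e1 /eqP e2].
have jp : 0 < `|jac K| * md by rewrite mulr_gt0// normr_gt0 Tj.
have z (u : 'I_3 -> R) : quad (fun K i j => 1 * (`|jac K| * ((i == j)%:R * md + mo))) K u = 0 -> u i = 0.
  move=> e; have := diag_quad_ge K u md (normr_ge0 (jac K)) mo0; rewrite [X in _ <= X -> _]e.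
  rewrite pmulr_rle0// => s0.
  have : \sum_k u k ^+ 2 == 0 by rewrite eq_le s0 sum_sq_ge0.
  rewrite psumr_eq0; last by move=> k _; exact: sqr_ge0.
  by move/allP => /(_ i); rewrite mem_index_enum sqrf_eq0 => /(_ isT)/eqP.
have := (z _ e1, z _ e2) => -[]; case: (f (vtx K i)) => a b /= -> ->.
by [].
Qed.

Lemma Vh_vertices_zero f : Vh Omega T f -> (forall p, p \in (vertices T : seq _) -> f p = 0) ->
  f = fun=> 0.
Proof.
move=> Vf fv; apply: (Vh_zero Vf) => K i KT; apply: fv.
have KV : (K `<=` vertices T)%fset by rewrite /vertices; exact: bigfcup_sup.
by apply: (fsubsetP KV); exact: vtx_in (T3 KT).
Qed.

Lemma Vh0 : Vh Omega T (fun=> 0).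
Proof.
split => //; first by move=> x; exact: cst_continuous.
by move=> K KT; exists 0, 0, 0 => x _; rewrite !mul0r !addr0.
Qed.

Lemma Vh_linear (a : R[i]) f g : Vh Omega T f -> Vh Omega T g ->
  Vh Omega T (fun x => a * f x + g x).
Proof.
move=> [cf f0 fK] [cg g0 gK]; split.
- move=> x; apply: (@cvgD _ R[i]^o); last exact: cg.
  by apply: cvgM; [exact: cvg_cst|exact: cf].
- by move=> x xO; rewrite f0// g0// mulr0 addr0.
move=> K KT; have [a1 [b1 [c1 e1]]] := fK K KT; have [a2 [b2 [c2 e2]]] := gK K KT.
exists (a * a1 + a2), (a * b1 + b2), (a * c1 + c2) => x Kx.
by rewrite e1// e2//; ring.
Qed.

End Mesh.

End FormComparison.

(** * Limits of complex numbers and matrices *)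

Section ComplexTopology.
Variable R : realType.
Local Notation C := (R[i]^o).
Local Notation Re := (@complex.Re R).
Local Notation Im := (@complex.Im R).
Local Notation normc := (@Normc.normc R).

Lemma ltc_norm (z : R[i]) (e : R) : (`|z| < e%:C) = (normc z < e).
Proof. by rewrite -ltcR; case: z. Qed.

Context (T : Type) (F : set_system T) {FF : Filter F}.
Implicit Types (f g : T -> C).

Lemma cvg_complex_norm f (z : C) : f x @[x --> F] --> z ->
  forall e : R, 0 < e -> \forall x \near F, normc (z - f x) < e.
Proof.
move=> /cvgr_dist_lt fz e e0.
have e0' : (0 : C) < e%:C by rewrite ltcR.
by apply: filterS (fz _ e0') => x; rewrite ltc_norm.
Qed.

Lemma norm_cvg_complex f (z : C) :
  (forall e : R, 0 < e -> \forall x \near F, normc (z - f x) < e) -> f x @[x --> F] --> z.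
Proof.
move=> fz; apply/cvgrPdist_lt => e e0.
have [e1 e2] : e = (Re e)%:C /\ 0 < Re e.
  by move: e0; rewrite ltcE /=; case: e => a b /= /andP[/eqP -> ->].
rewrite e1; apply: filterS (fz _ e2) => x; by rewrite ltc_norm.
Qed.

Lemma cvg_Re f (z : C) : f x @[x --> F] --> z -> Re (f x) @[x --> F] --> Re z.
Proof.
move=> fz; apply/cvgrPdist_lt => e e0; apply: filterS (cvg_complex_norm fz e0) => x.
apply: le_lt_trans; rewrite (_ : Re z - Re (f x) = Re (z - f x)); first exact: normr_Re.
by case: z {fz} => a b; case: (f x).
Qed.

Lemma cvg_Im f (z : C) : f x @[x --> F] --> z -> Im (f x) @[x --> F] --> Im z.
Proof.
move=> fz; apply/cvgrPdist_lt => e e0; apply: filterS (cvg_complex_norm fz e0) => x.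
apply: le_lt_trans; rewrite (_ : Im z - Im (f x) = Im (z - f x)); first exact: normr_Im.
by case: z {fz} => a b; case: (f x).
Qed.

Lemma cvg_normc f (z : C) : f x @[x --> F] --> z -> normc (f x) @[x --> F] --> normc z.
Proof.
move=> fz; apply/cvgrPdist_lt => e e0; apply: filterS (cvg_complex_norm fz e0) => x.
apply: le_lt_trans; rewrite ler_norml; apply/andP; split.
  have := le_normcD z (- (z - f x)); rewrite normcN opprB addrC subrK => H.
  lra.
have := le_normcD (z - f x) (f x); rewrite subrK => H; lra.
Qed.

Lemma cvg_complex f (z : C) : Re (f x) @[x --> F] --> Re z -> Im (f x) @[x --> F] --> Im z ->
  f x @[x --> F] --> z.
Proof.
move=> fR fI; apply: norm_cvg_complex => e e0.
have e2 : 0 < e / 2 by rewrite divr_gt0.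
move/cvgr_dist_lt : fR => /(_ _ e2) fR; move/cvgr_dist_lt : fI => /(_ _ e2) fI.
apply: filterS2 fR fI => x xR xI.
apply: le_lt_trans (normc_le _) _.
rewrite (_ : Re (z - f x) = Re z - Re (f x)); last by case: z {xR xI}; case: (f x).
rewrite (_ : Im (z - f x) = Im z - Im (f x)); last by case: z {xR xI}; case: (f x).
by rewrite (splitr e) ltrD.
Qed.

End ComplexTopology.

Section MatrixLimits.
Variables (K : numFieldType) (T : Type) (F : set_system T).
Context {FF : Filter F}.

Lemma cvg_prodr (I : Type) (r : seq I) (f : I -> T -> K^o) (l : I -> K^o) :
  (forall i, f i x @[x --> F] --> l i) ->
  (\prod_(i <- r) (f i x : K)) @[x --> F] --> (\prod_(i <- r) (l i : K) : K^o).
Proof.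
move=> fl; apply: (@cvg_big K^o I *%R 1 xpredT _ T F r f l) => //.
exact: mul_continuous.
Qed.

Lemma cvg_det n (A : T -> 'M[K]_n) (A0 : 'M[K]_n) :
  (forall i j, (A x i j : K^o) @[x --> F] --> (A0 i j : K^o)) ->
  (\det (A x) : K^o) @[x --> F] --> (\det A0 : K^o).
Proof.
move=> AA; rewrite /determinant.
apply: (@cvg_sumr K K^o) => s; apply: cvgM; first exact: cvg_cst.
by apply: cvg_prodr => i; exact: AA.
Qed.

(** The inverse is the adjugate divided by the determinant, and these are polynomials
    in the entries. *)
Lemma cvg_invmx n (A : T -> 'M[K]_n) (A0 : 'M[K]_n) :
  (forall i j, (A x i j : K^o) @[x --> F] --> (A0 i j : K^o)) ->
  (\forall x \near F, A x \in unitmx) -> A0 \in unitmx ->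
  forall i j, (invmx (A x) i j : K^o) @[x --> F] --> (invmx A0 i j : K^o).
Proof.
move=> AA Au A0u i j.
have E (B : 'M[K]_n) : B \in unitmx -> invmx B i j = (\det B)^-1 * cofactor B j i.
  by move=> Bu; rewrite /invmx Bu !mxE.
rewrite E//.
apply: (@cvg_trans _ (((\det (A x))^-1 * cofactor (A x) j i : K^o) @[x --> F])).
  by apply: near_eq_cvg; apply: filterS Au => x /E ->.
apply: cvgM.
  apply: cvgV; first by rewrite -unitfE -unitmxE.
  exact: cvg_det.
rewrite /cofactor; apply: cvgM; first exact: cvg_cst.
apply: cvg_det => k l; under eq_cvg do rewrite !mxE.
rewrite !mxE; exact: AA.
Qed.

Lemma cvg_mulmx m n p (A : T -> 'M[K]_(m, n)) (B : T -> 'M[K]_(n, p))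
    (A0 : 'M[K]_(m, n)) (B0 : 'M[K]_(n, p)) :
  (forall i j, (A x i j : K^o) @[x --> F] --> (A0 i j : K^o)) ->
  (forall i j, (B x i j : K^o) @[x --> F] --> (B0 i j : K^o)) ->
  forall i j, ((A x *m B x) i j : K^o) @[x --> F] --> ((A0 *m B0) i j : K^o).
Proof.
move=> AA BB i j; rewrite mxE; under eq_cvg do rewrite mxE.
by apply: (@cvg_sumr K K^o) => k; apply: cvgM; [exact: AA|exact: BB].
Qed.

Lemma cvg_pencil m n (lam : T -> K^o) (lam0 : K^o) (A B : 'M[K]_(m, n)) :
  lam x @[x --> F] --> lam0 ->
  forall i j, ((lam x *: A + B) i j : K^o) @[x --> F] --> ((lam0 *: A + B) i j : K^o).
Proof.
move=> cl i j; under eq_cvg do rewrite !mxE.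
rewrite !mxE; apply: cvgD; last exact: cvg_cst.
by apply: cvgM; [exact: cl|exact: cvg_cst].
Qed.

(** The integrand at one point of the contour has coordinates of this form, where [A]
    and [B] are the two mass matrices and [S] is the stiffness matrix. *)
Lemma cvg_rational_vector n (lam : T -> K^o) (lam0 : K^o) (y : 'rV[K]_n) (A B D S : 'M[K]_n) :
  lam x @[x --> F] --> lam0 ->
  (\forall x \near F, lam x *: A + S \in unitmx) -> lam0 *: A + S \in unitmx ->
  (\forall x \near F, lam x *: B + S \in unitmx) -> lam0 *: B + S \in unitmx ->
  forall i j, (((lam x *: (y *m invmx (lam x *: A + S)) - y) *m D *m invmx (lam x *: B + S)) i j
     : K^o) @[x --> F] -->
    (((lam0 *: (y *m invmx (lam0 *: A + S)) - y) *m D *m invmx (lam0 *: B + S)) i j : K^o).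
Proof.
move=> cl uA uA0 uB uB0; apply: cvg_mulmx; last by apply: cvg_invmx => //; exact: cvg_pencil.
apply: cvg_mulmx; last by move=> i j; exact: cvg_cst.
have cH : forall i j, ((y *m invmx (lam x *: A + S)) i j : K^o) @[x --> F] -->
    ((y *m invmx (lam0 *: A + S)) i j : K^o).
  apply: cvg_mulmx; first by move=> i j; exact: cvg_cst.
  by apply: cvg_invmx => //; exact: cvg_pencil.
move=> i j.
have matE l (M : 'rV[K]_n) : (l *: M - y) i j = l * M i j - y i j by rewrite !mxE.
under eq_cvg do rewrite matE.
rewrite matE; apply: cvgB; last exact: cvg_cst.
by apply: cvgM; [exact: cl|exact: cH].
Qed.

End MatrixLimits.

(** * Integrals of complex functions *)

Section ComplexIntegrals.
Context (R : realType).
Local Notation C := (R[i]^o).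
Local Notation Re := (@complex.Re R).
Local Notation Im := (@complex.Im R).
Local Notation normc := (@Normc.normc R).
Local Notation leb := (@lebesgue_measure R).
Local Notation mR := (measurableTypeR R).

Section OnDomain.
Variables (D : set mR) (mD : measurable D).
Implicit Types (G : mR -> R[i]) (k : mR -> R).

Definition Cintegrable G :=
  leb.-integrable D (EFin \o (fun x => Re (G x))) /\
  leb.-integrable D (EFin \o (fun x => Im (G x))).

Lemma CintegrableZ G (b : R[i]) : Cintegrable G -> Cintegrable (fun x => G x * b).
Proof.
move=> [iR iI]; split.
- have -> : EFin \o (fun x => Re (G x * b)) =
     (fun x => (Re b)%:E * (Re (G x))%:E + (- Im b)%:E * (Im (G x))%:E)%E.
    by apply/funext => x /=; rewrite -!EFinM -EFinD; congr EFin; case: (G x) b => ? ? [? ?] /=; ring.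
  by apply: integrableD => //; exact: integrableZl.
- have -> : EFin \o (fun x => Im (G x * b)) =
     (fun x => (Im b)%:E * (Re (G x))%:E + (Re b)%:E * (Im (G x))%:E)%E.
    by apply/funext => x /=; rewrite -!EFinM -EFinD; congr EFin; case: (G x) b => ? ? [? ?] /=; ring.
  by apply: integrableD => //; exact: integrableZl.
Qed.

Lemma CintegrableD G1 G2 : Cintegrable G1 -> Cintegrable G2 -> Cintegrable (fun x => G1 x + G2 x).
Proof.
move=> [iR1 iI1] [iR2 iI2]; split.
- have -> : EFin \o (fun x => Re (G1 x + G2 x)) = (fun x => (Re (G1 x))%:E + (Re (G2 x))%:E)%E.
    by apply/funext => x /=; rewrite -EFinD; congr EFin; case: (G1 x) (G2 x) => ? ? [].
  exact: integrableD.
- have -> : EFin \o (fun x => Im (G1 x + G2 x)) = (fun x => (Im (G1 x))%:E + (Im (G2 x))%:E)%E.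
    by apply/funext => x /=; rewrite -EFinD; congr EFin; case: (G1 x) (G2 x) => ? ? [].
  exact: integrableD.
Qed.

Lemma CintegralD G1 G2 : Cintegrable G1 -> Cintegrable G2 ->
  Cintegral leb D (fun x => G1 x + G2 x) = Cintegral leb D G1 + Cintegral leb D G2.
Proof.
move=> [iR1 iI1] [iR2 iI2]; rewrite /Cintegral.
rewrite [LHS](_ : _ = (Rintegral leb D (fun x => Re (G1 x) + Re (G2 x))) +i*
   (Rintegral leb D (fun x => Im (G1 x) + Im (G2 x)))).
  by rewrite !RintegralD.
by congr (_ +i* _); apply: eq_Rintegral => x _; case: (G1 x) (G2 x) => ? ? [].
Qed.

Lemma CintegralZ G (b : R[i]) : Cintegrable G ->
  Cintegral leb D (fun x => G x * b) = Cintegral leb D G * b.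
Proof.
move=> [iR iI]; rewrite /Cintegral.
have iZ (f : mR -> R) (e : R) : leb.-integrable D (EFin \o f) ->
    leb.-integrable D (EFin \o (fun x => e * f x)).
  by move=> /(integrableZl mD e); apply: eq_integrable.
rewrite [LHS](_ : _ = (Rintegral leb D (fun x => Re b * Re (G x) + (- Im b) * Im (G x))) +i*
   (Rintegral leb D (fun x => Im b * Re (G x) + Re b * Im (G x)))).
  rewrite !RintegralD ?RintegralZl//; try exact: iZ.
  by case: b => b1 b2 /=; apply/eqP; rewrite eq_complex/=; apply/andP; split; apply/eqP; ring.
by congr (_ +i* _); apply: eq_Rintegral => x _; case: (G x) b => ? ? [? ?] /=; ring.
Qed.

Lemma Cintegral_comb (I : Type) (r : seq I) (G : I -> mR -> R[i]) (b : I -> R[i]) :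
  (forall i, Cintegrable (G i)) ->
  Cintegrable (fun x => \sum_(i <- r) G i x * b i) /\
  Cintegral leb D (fun x => \sum_(i <- r) G i x * b i) = \sum_(i <- r) Cintegral leb D (G i) * b i.
Proof.
move=> iG; elim: r => [|i r [IH1 IH2]].
  have E : (fun x => \sum_(i <- [::]) G i x * b i) = fun=> 0.
    by apply/funext => x; rewrite big_nil.
  rewrite E big_nil; split; first by split; exact: integrable0.
  by rewrite /Cintegral /= !Rintegral_cst// !mul0r.
have E : (fun x => \sum_(j <- i :: r) G j x * b j) =
    (fun x => G i x * b i + \sum_(j <- r) G j x * b j).
  by apply/funext => x; rewrite big_cons.
rewrite E big_cons; have iGb := CintegrableZ (b i) (iG i).
split; first exact: CintegrableD.
by rewrite CintegralD// IH2 CintegralZ.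
Qed.

(** The factor 2 comes from estimating the real and imaginary parts separately. *)
Lemma Cintegral_le G k : Cintegrable G -> leb.-integrable D (EFin \o k) ->
  (forall x, D x -> normc (G x) <= k x) -> normc (Cintegral leb D G) <= 2 * Rintegral leb D k.
Proof.
move=> [iR iI] ik Gk; apply: le_trans (normc_le _) _; rewrite mulr_natl mulr2n /=.
have bnd (f : mR -> R) : leb.-integrable D (EFin \o f) -> (forall x, D x -> `|f x| <= k x) ->
    `|Rintegral leb D f| <= Rintegral leb D k.
  move=> fi fk; apply: le_trans (le_normr_Rintegral mD fi) _.
  by apply: le_Rintegral => //; have := integrable_norm fi; apply: eq_integrable.
apply: lerD; apply: bnd => // x Dx; apply: le_trans (Gk x Dx).
- exact: normr_Re.
- exact: normr_Im.
Qed.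

Lemma Cintegrable_dominated G k : leb.-integrable D (EFin \o k) ->
  (forall x, D x -> (G y : C) @[y --> within D (nbhs x)] --> (G x : C)) ->
  (forall x, D x -> normc (G x) <= k x) -> Cintegrable G.
Proof.
move=> ik cG Gk.
have dom (p : R[i] -> R) : (forall x, D x -> p (G y) @[y --> within D (nbhs x)] --> p (G x)) ->
    (forall z, `|p z| <= normc z) -> leb.-integrable D (EFin \o (fun x => p (G x))).
  move=> cp pn; apply: (le_integrable mD) ik.
    apply/measurable_EFinP; apply: subspace_continuous_measurable_fun => //.
    exact/subspace_continuousP.
  move=> x Dx; rewrite /= lee_fin; apply: le_trans (pn _) _.
  by apply: le_trans (Gk x Dx) (ler_norm _).
split; apply: dom.
- by move=> x Dx; apply: cvg_Re; exact: cG.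
- exact: normr_Re.
- by move=> x Dx; apply: cvg_Im; exact: cG.
- exact: normr_Im.
Qed.

End OnDomain.

End ComplexIntegrals.

(** * Sectors *)

Section Sectors.
Context (R : realType).
Local Notation C := (R[i]^o).
Local Notation Re := (@complex.Re R).
Local Notation Im := (@complex.Im R).
Local Notation normc := (@Normc.normc R).

(** The rays of the contour lie on the boundary of the sector, where the hypotheses on
    [beta] have to be recovered by continuity. The apex is left out. *)
Definition closed_sector (theta : R) : set R[i] :=
  [set z | exists rho psi : R, [/\ 0 < rho, `|psi| <= theta & z = rho%:C * cis psi]].

Lemma normc_cis (psi : R) : normc (cis psi) = 1.
Proof. by rewrite /= cos2Dsin2 sqrtr1. Qed.

Lemma normc_polar (rho psi : R) : 0 <= rho -> normc (rho%:C * cis psi) = rho.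
Proof. by move=> r0; rewrite Normc.normcM normc_cis mulr1 normc_real ger0_norm. Qed.

Lemma Re_polar (rho psi : R) : Re (rho%:C * cis psi) = rho * cos psi.
Proof. by rewrite /=; ring. Qed.

Lemma Im_polar (rho psi : R) : Im (rho%:C * cis psi) = rho * sin psi.
Proof. by rewrite /=; ring. Qed.

Lemma normc_cexp (z : R[i]) : normc (cexp z) = expR (Re z).
Proof. by rewrite Normc.normcM normc_cis mulr1 normc_real ger0_norm// expR_ge0. Qed.

Lemma closed_sector_slit theta z : theta < pi -> closed_sector theta z -> slit_plane z.
Proof.
move=> thpi [rho [psi [rho0 psith ->]]]; rewrite /slit_plane/= => -[].
have := Im_polar rho psi; have := Re_polar rho psi => /= -> -> /eqP.
rewrite mulf_eq0 gt_eqF//= => /eqP s0.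
rewrite pmulr_rle0// leNgt; apply/negP; rewrite negbK.
have [->|p0] := eqVneq psi 0; first by rewrite cos0.
have : 0 < sin `|psi|.
  by apply: sin_gt0_pi; rewrite normr_gt0 p0 (le_lt_trans psith thpi).
case: (ltrgtP psi 0) p0 => // p0 _.
  by rewrite (ltr0_norm p0) sinN s0 oppr0 ltxx.
by rewrite (gtr0_norm p0) s0 ltxx.
Qed.

Lemma cvg_cis (T : Type) (F : set_system T) {FF : Filter F} (f : T -> R) (a : R) :
  f x @[x --> F] --> a -> (cis (f x) : C) @[x --> F] --> (cis a : C).
Proof.
move=> fa; apply: cvg_complex => /=.
- exact: (cvg_comp _ _ fa (@continuous_cos R a)).
- exact: (cvg_comp _ _ fa (@continuous_sin R a)).
Qed.

Lemma cvg_realc (T : Type) (F : set_system T) {FF : Filter F} (f : T -> R) (a : R) :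
  f x @[x --> F] --> a -> ((f x)%:C : C) @[x --> F] --> (a%:C : C).
Proof. by move=> fa; apply: cvg_complex => //=; exact: cvg_cst. Qed.

Lemma cvg_cexp (T : Type) (F : set_system T) {FF : Filter F} (f : T -> C) (a : C) :
  f x @[x --> F] --> a -> (cexp (f x) : C) @[x --> F] --> (cexp a : C).
Proof.
move=> fa; apply: cvgM.
  apply: cvg_realc; exact: (cvg_comp _ _ (cvg_Re fa) (@continuous_expR R (Re a))).
by apply: cvg_cis; exact: cvg_Im.
Qed.

(** A point of a boundary ray is the limit of the points with the same modulus and a
    smaller argument. *)
Lemma sector_closure_ge0 (theta : R) (Phi : R[i] -> R) z : 0 < theta ->
  Phi w @[w --> (z : C)] --> Phi z -> (forall w, sector theta w -> 0 <= Phi w) ->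
  closed_sector theta z -> 0 <= Phi z.
Proof.
move=> th0 cPhi Phi0 [rho [psi [rho0 psith zE]]].
pose gam (s : R) : C := rho%:C * cis (s * psi).
have cg : gam s @[s --> (1:R)^'-] --> (z : C).
  rewrite zE -[psi in cis psi]mul1r; apply: cvgM; first exact: cvg_cst.
  apply: cvg_cis; apply: cvgM; last exact: cvg_cst.
  exact: cvg_at_left_filter.
have cP : Phi (gam s) @[s --> (1:R)^'-] --> Phi z by exact: (cvg_comp _ _ cg cPhi).
rewrite -(cvg_lim _ cP)//; apply: limr_ge; first by apply/cvg_ex; exists (Phi z).
near=> s; apply: Phi0; exists rho, (s * psi); split => //.
have s1 : s < 1 by [].
have s0 : 0 < s by near: s; apply: nbhs_left_gt.
rewrite normrM gtr0_norm//; have [->|p0] := eqVneq psi 0; first by rewrite normr0 mulr0.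
by apply: lt_le_trans psith; rewrite gtr_pMl// normr_gt0.
Unshelve. all: by end_near. Qed.

Section Assumptions.
Variables (theta theta' : R) (g beta : R[i] -> R[i]).
Hypotheses (htheta : pi / 2 < theta < pi) (htheta' : pi / 2 < theta' < pi).
Hypothesis hg : standing_assumption theta theta' g beta.

Let th0 : 0 < theta.
Proof. by case/andP: htheta => h _; apply: lt_trans h; rewrite divr_gt0// pi_gt0. Qed.

Lemma beta_continuous z : closed_sector theta z -> beta w @[w --> (z : C)] --> (beta z : C).
Proof.
move=> hz; have [_ _ [ana _] _] := hg.
have sz : slit_plane z by apply: closed_sector_slit hz; case/andP: htheta.
apply: (@differentiable_continuous _ C C).
by apply/derivable1_diffP; exact: ana.
Qed.

Lemma beta_neq0 z : closed_sector theta z -> beta z != 0.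
Proof.
move=> hz; have [_ _ [_ nz] _] := hg.
by apply: nz; apply: closed_sector_slit hz; case/andP: htheta.
Qed.

Lemma closed_sector_neq0 z : closed_sector theta z -> z != 0.
Proof.
move=> [rho [psi [rho0 _ ->]]]; apply/negP => /eqP h.
have := normc_polar psi (ltW rho0); rewrite h Normc.normc0 => h'.
by rewrite -h' ltxx in rho0.
Qed.

Lemma zbeta_continuous z : closed_sector theta z ->
  (w * beta w) @[w --> (z : C)] --> (z * beta z : C).
Proof.
move=> hz; apply: (@cvgM _ C (nbhs (z : C)) _ (fun w => w) beta z (beta z)); first exact: cvg_id.
exact: beta_continuous.
Qed.

Lemma zbeta_sector z : closed_sector theta z -> cos theta' * normc (z * beta z) <= Re (z * beta z).
Proof.
move=> hz; rewrite -subr_ge0.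
apply: (@sector_closure_ge0 theta (fun w => Re (w * beta w) - cos theta' * normc (w * beta w))) => //.
- have c := zbeta_continuous hz.
  apply: (@cvgB R R C (nbhs (z : C))); first exact: (cvg_Re c).
  by apply: (@cvgM R C (nbhs (z : C))); [exact: cvg_cst|exact: (cvg_normc c)].
move=> w hw; have [_ _ _ /(_ w hw) [r [psi [r0 pth ->]]]] := hg.
rewrite Re_polar normc_polar ?(ltW r0)// [cos theta' * _]mulrC -mulrBr mulr_ge0 ?(ltW r0)// subr_ge0.
have [/andP[h1 h2]] : pi / 2 < theta' < pi by [].
have t0 : 0 <= theta' by apply: ltW; apply: lt_trans h1; rewrite divr_gt0// pi_gt0.
rewrite -(cos_norm psi) ltW// ltr_cos// in_itv/= ?t0 ?(ltW h2)//.
by rewrite normr_ge0 ltW// (lt_trans pth).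
Qed.

Lemma beta_growth_closed mu B z : beta_growth theta mu B beta ->
  closed_sector theta z -> normc (beta z) <= B * normc z `^ mu.
Proof.
move=> hB hz; rewrite -subr_ge0.
apply: (@sector_closure_ge0 theta (fun w => B * normc w `^ mu - normc (beta w))) => //.
- apply: (@cvgB R R C (nbhs (z : C))); last exact: (cvg_normc (beta_continuous hz)).
  apply: (@cvgM R C (nbhs (z : C))); first exact: cvg_cst.
  have nz : 0 < normc z.
    by case: hz => rho [psi [rho0 _ ->]]; rewrite normc_polar// ltW.
  have cn : normc w @[w --> (z : C)] --> normc z by apply: (@cvg_normc R C (nbhs (z : C))); exact: cvg_id.
  have d : derivable (@powR R ^~ mu) (normc z) 1.
    by apply: derivable_powR; rewrite in_itv/= andbT.
  have /differentiable_continuous c := (derivable1_diffP _ _).1 d.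
  exact: (cvg_comp (fun w : C => normc w) (@powR R ^~ mu) cn c).
by move=> w hw; rewrite subr_ge0; exact: hB.
Qed.

End Assumptions.

End Sectors.

(** * Contour integrals *)

Section Contour.
Context (R : realType).
Local Notation C := (R[i]^o).
Local Notation Re := (@complex.Re R).
Local Notation normc := (@Normc.normc R).
Local Notation leb := (@lebesgue_measure R).
Local Notation mR := (measurableTypeR R).

Lemma integrable_constant (D : set mR) (c : R) : measurable D -> (leb D < +oo)%E ->
  leb.-integrable D (EFin \o (fun=> c)).
Proof.
move=> mD Dfin; apply/integrableP; split; first exact/measurable_EFinP.
rewrite /= integral_cst//; apply: lte_mul_pinfty => //.
Qed.

(** The power is bounded by one with an integer exponent [n], and [y <= expR y] is
    raised to the power [n]. *)
Lemma powR_le_exp (a c : R) : 0 < c ->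
  exists2 K : R, 0 <= K & forall x : R, 1 <= x -> x `^ a <= K * expR (c * x).
Proof.
move=> c0; pose n := (Num.bound `|a|).+1.
have an : a <= n%:R.
  apply: le_trans (ler_norm _) _; apply: le_trans (ltW (archi_boundP (normr_ge0 a))) _.
  by rewrite ler_nat.
exists ((n%:R / c) ^+ n) => [|x x1]; first by rewrite exprn_ge0// divr_ge0// ltW.
apply: (@le_trans _ _ (x ^+ n)).
  by rewrite -powR_mulrn ?(le_trans _ x1)//; apply: ler_powR.
have n0 : 0 < n%:R :> R by rewrite ltr0n.
have -> : expR (c * x) = expR (c * x / n%:R) ^+ n.
  by rewrite -expRM_natl; congr expR; field; rewrite gt_eqF.
rewrite -exprMn; apply: lerXn2r; rewrite ?nnegrE ?(le_trans _ x1)//.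
  by rewrite mulr_ge0 ?expR_ge0// divr_ge0// ltW.
have := expR_ge1Dx (c * x / n%:R) => h.
have h' : c * x / n%:R <= expR (c * x / n%:R) by apply: le_trans h; rewrite lerDr.
rewrite -(ler_pM2l (divr_gt0 c0 n0)).
rewrite (_ : c / n%:R * (n%:R / c * expR (c * x / n%:R)) = expR (c * x / n%:R)); last first.
  by field; rewrite !gt_eqF.
by apply: le_trans h'; rewrite mulrAC.
Qed.

(** Where [t rho >= 1], half of the exponential decay absorbs the power of [t rho].
    What remains is a multiple of an exponential probability density. *)
Lemma ray_majorant (a c : R) : 0 < c -> exists2 K : R, 0 <= K &
  forall t M : R, 0 < t -> 0 <= M -> exists k : mR -> R,
  [/\ leb.-integrable `[t^-1, +oo[ (EFin \o k),
      Rintegral leb `[t^-1, +oo[ k <= K * M * t `^ (- (a + 1)) &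
      forall rho, t^-1 <= rho -> M * expR (- (c * (t * rho))) * rho `^ a <= k rho].
Proof.
move=> c0; have c20 : 0 < c / 2 by rewrite divr_gt0.
have [Ka Ka0 HK] := powR_le_exp a c20.
exists (Ka * (2 / c)) => [|t M t0 M0]; first by rewrite mulr_ge0// divr_ge0// ltW.
pose rate := c / 2 * t; have rate0 : 0 < rate by rewrite mulr_gt0.
pose A := M * Ka * t `^ (- a) / rate.
have rate0' := ltW rate0.
have A0 : 0 <= A by rewrite /A !mulr_ge0 ?powR_ge0 ?invr_ge0.
have ti0 : 0 < t^-1 by rewrite invr_gt0.
pose k : mR -> R := fun x => A * exponential_pdf rate x.
have ik : leb.-integrable setT (EFin \o k).
  have := integrableZl measurableT A (integrable_exponential_pdf rate0).
  exact: eq_integrable.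
have ikD : leb.-integrable `[t^-1, +oo[ (EFin \o k) by apply: integrableS ik.
have k0 x : 0 <= k x by rewrite mulr_ge0 ?exponential_pdf_ge0.
exists k; split => //.
- apply: (@le_trans _ _ (Rintegral leb setT k)).
    apply: fine_le; [exact: integrable_fin_num|exact: integrable_fin_num|].
    apply: ge0_subset_integral => //; last by move=> x _; rewrite lee_fin.
    by apply/measurable_int; exact: ik.
  rewrite RintegralZl//; last exact: integrable_exponential_pdf.
  rewrite /Rintegral integral_exponential_pdf//= mulr1 /A /rate.
  rewrite opprD powRD; last by rewrite (gt_eqF t0) implybT.
  rewrite powR_inv1 ?(ltW t0)// le_eqVlt; apply/orP; left; apply/eqP.
  by field; rewrite !gt_eqF.
move=> rho hr; have rho0 : 0 < rho by exact: lt_le_trans hr.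
rewrite /k /A exponential_pdfE ?(ltW rho0)//.
have x1 : 1 <= t * rho by rewrite -ler_pdivrMl// mulr1.
have := HK _ x1; rewrite powRM ?(ltW t0) ?(ltW rho0)// => h.
have e1 : expR (- (c * (t * rho))) = expR (- rate * rho) * (expR (c / 2 * (t * rho)))^-1.
  by rewrite -expRN -expRD; congr expR; rewrite /rate; field.
have ta : 0 < t `^ a by rewrite powR_gt0.
rewrite e1 powRN.
rewrite (_ : M * Ka * (t `^ a)^-1 / rate * (rate * expR (- rate * rho)) =
   M * expR (- rate * rho) * (Ka / t `^ a)); last by field; rewrite !gt_eqF.
rewrite mulrA -mulrA ler_wpM2l ?mulr_ge0 ?expR_ge0//.
rewrite ler_pdivlMr// -[leLHS]mulrA ler_pdivrMl ?expR_gt0// mulrC.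
by apply: le_trans h _; rewrite mulrC.
Qed.

Definition on_contour (theta delta : R) : set R[i] := [set z |
  (exists rho psi, [/\ delta <= rho, psi = theta \/ psi = - theta & z = rho%:C * cis psi]) \/
  (exists2 psi, `|psi| <= theta & z = delta%:C * cis psi)].

Definition ray_integrand (F : R[i] -> R[i]) (psi : R) : mR -> R[i] :=
  fun rho => F (rho%:C * cis psi) * cis psi.
Definition arc_integrand (delta : R) (F : R[i] -> R[i]) : mR -> R[i] :=
  fun psi => F (delta%:C * cis psi) * ((0 +i* 1) * (delta%:C * cis psi)).

Definition contour_integrable (theta delta : R) (F : R[i] -> R[i]) :=
  [/\ Cintegrable `[delta, +oo[ (ray_integrand F theta),
      Cintegrable `[delta, +oo[ (ray_integrand F (- theta)) &
      Cintegrable `[- theta, theta] (arc_integrand delta F)].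

Lemma contour_integralE theta delta F : contour_integral theta delta F =
  - Cintegral leb `[delta, +oo[ (ray_integrand F (- theta))
  + Cintegral leb `[- theta, theta] (arc_integrand delta F)
  + Cintegral leb `[delta, +oo[ (ray_integrand F theta).
Proof. by []. Qed.

Lemma contour_integral_comb (I : Type) (r : seq I) theta delta (F : I -> R[i] -> R[i]) (b : I -> R[i]) :
  (forall i, contour_integrable theta delta (F i)) ->
  contour_integrable theta delta (fun z => \sum_(i <- r) F i z * b i) /\
  contour_integral theta delta (fun z => \sum_(i <- r) F i z * b i) =
    \sum_(i <- r) contour_integral theta delta (F i) * b i.
Proof.
move=> iF.
have rE psi : ray_integrand (fun z => \sum_(i <- r) F i z * b i) psi =
    fun x => \sum_(i <- r) ray_integrand (F i) psi x * b i.
  by apply/funext => x; rewrite /ray_integrand big_distrl; apply: eq_bigr => i _ /=; ring.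
have aE : arc_integrand delta (fun z => \sum_(i <- r) F i z * b i) =
    fun x => \sum_(i <- r) arc_integrand delta (F i) x * b i.
  by apply/funext => x; rewrite /arc_integrand big_distrl; apply: eq_bigr => i _; rewrite mulrAC.
have [p1 e1] := @Cintegral_comb R `[delta, +oo[ (measurable_itv _) I r
  (fun i => ray_integrand (F i) theta) b (fun i => let: And3 h _ _ := iF i in h).
have [p2 e2] := @Cintegral_comb R `[delta, +oo[ (measurable_itv _) I r
  (fun i => ray_integrand (F i) (- theta)) b (fun i => let: And3 _ h _ := iF i in h).
have [p3 e3] := @Cintegral_comb R `[- theta, theta] (measurable_itv _) I r
  (fun i => arc_integrand delta (F i)) b (fun i => let: And3 _ _ h := iF i in h).
split; first by rewrite /contour_integrable !rE aE.
rewrite contour_integralE !rE aE e1 e2 e3 -sumrN -!big_split.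
by apply: eq_bigr => i _; rewrite contour_integralE /= !mulrDl mulNr.
Qed.

Lemma contour_closed_sector theta delta z : 0 < delta -> 0 < theta ->
  on_contour theta delta z -> closed_sector theta z.
Proof.
move=> d0 th0 [[rho [psi [dr hpsi ->]]]|[psi hpsi ->]].
  exists rho, psi; split => //; first exact: lt_le_trans dr.
  by case: hpsi => ->; rewrite ?normrN gtr0_norm.
by exists delta, psi.
Qed.

Section Estimate.
Variables (theta a : R).
Hypothesis htheta : pi / 2 < theta < pi.

Let th0 : 0 < theta.
Proof. by case/andP: htheta => h _; apply: lt_trans h; rewrite divr_gt0// pi_gt0. Qed.

Let cth : 0 < - cos theta.
Proof.
case/andP: htheta => h1 h2.
have p1 : 0 <= pi / 2 :> R by rewrite divr_ge0 ?pi_ge0.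
have p2 : pi / 2 <= pi :> R by rewrite ler_pdivrMr// ler_peMr ?pi_ge0// ler1n.
by rewrite oppr_gt0 -cos_pihalf ltr_cos// in_itv/= ?(ltW th0) ?(ltW h2) ?p1 ?p2.
Qed.

Let majorants : exists2 K : R, 0 <= K & forall t M : R, 0 < t -> 0 <= M ->
  exists k : mR -> R,
  [/\ leb.-integrable `[t^-1, +oo[ (EFin \o k),
      Rintegral leb `[t^-1, +oo[ k <= K * M * t `^ (- (a + 1)) &
   forall F : R[i] -> R[i], (forall z, on_contour theta t^-1 z ->
      normc (F z) <= M * expR (t * Re z) * normc z `^ a) ->
    [/\ forall rho, t^-1 <= rho -> normc (ray_integrand F theta rho) <= k rho,
        forall rho, t^-1 <= rho -> normc (ray_integrand F (- theta) rho) <= k rho &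
        forall psi, `|psi| <= theta ->
          normc (arc_integrand t^-1 F psi) <= expR 1 * M * t `^ (- (a + 1))]].
Proof.
have [K K0 HK] := ray_majorant a cth; exists K => // t M t0 M0.
have [k [ik kI kM]] := HK t M t0 M0; exists k; split => // F FM.
have ti0 : 0 < t^-1 by rewrite invr_gt0.
have ray psi : psi = theta \/ psi = - theta ->
    forall rho, t^-1 <= rho -> normc (ray_integrand F psi rho) <= k rho.
  move=> hpsi rho hr; have rho0 : 0 < rho by exact: lt_le_trans hr.
  rewrite /ray_integrand Normc.normcM normc_cis mulr1.
  apply: le_trans (FM _ _) _; first by left; exists rho, psi.
  rewrite normc_polar ?(ltW rho0)// Re_polar; apply: le_trans (kM rho hr).
  have -> : cos psi = cos theta by case: hpsi => ->; rewrite ?cosN.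
  by rewrite (_ : t * (rho * cos theta) = - (- cos theta * (t * rho))); last by ring.
split; [by apply: ray; left|by apply: ray; right|move=> psi hpsi].
rewrite /arc_integrand 2!Normc.normcM normc_polar ?(ltW ti0)//.
have -> : normc (0 +i* 1) = 1 by rewrite /= expr0n expr1n add0r sqrtr1.
rewrite mul1r; apply: le_trans (ler_wpM2r (ltW ti0) (FM _ _)) _; first by right; exists psi.
rewrite normc_polar ?(ltW ti0)// Re_polar mulrA divff ?gt_eqF// mul1r.
have -> : t^-1 `^ a = t `^ (- a).
  by rewrite -[t^-1]powR_inv1 ?(ltW t0)// -powRrM mulN1r.
rewrite opprD powRD; last by rewrite (gt_eqF t0) implybT.
rewrite powR_inv1 ?(ltW t0)// mulrA ler_wpM2r ?(ltW ti0)// ler_wpM2r ?powR_ge0//.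
by rewrite [leRHS]mulrC ler_wpM2l// ler_expR cos_le1.
Qed.

(** On the arc and on the rays, the integral of [|z|^a |dz|], damped by the
    exponential, scales like [t^-a * t^-1]. *)
Lemma contour_bound : exists2 K : R, 0 <= K & forall (t M : R) (F : R[i] -> R[i]),
  0 < t -> 0 <= M -> contour_integrable theta t^-1 F ->
  (forall z, on_contour theta t^-1 z -> normc (F z) <= M * expR (t * Re z) * normc z `^ a) ->
  normc (contour_integral theta t^-1 F) <= K * M * t `^ (- (a + 1)).
Proof.
have [K K0 HK] := majorants.
exists (4 * K + 2 * (2 * theta * expR 1)) => [|t M F t0 M0 [i1 i2 i3] FM].
  by rewrite addr_ge0 ?mulr_ge0 ?expR_ge0// ltW.
have [k [ik kI /(_ F FM) [k1 k2 k3]]] := HK t M t0 M0.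
have E1 : normc (Cintegral leb `[t^-1, +oo[ (ray_integrand F theta)) <= 2 * (K * M * t `^ (- (a + 1))).
  apply: le_trans (Cintegral_le (measurable_itv _) i1 ik _) _; last by rewrite ler_wpM2l.
  by move=> x; rewrite /= in_itv/= andbT; exact: k1.
have E2 : normc (Cintegral leb `[t^-1, +oo[ (ray_integrand F (- theta))) <= 2 * (K * M * t `^ (- (a + 1))).
  apply: le_trans (Cintegral_le (measurable_itv _) i2 ik _) _; last by rewrite ler_wpM2l.
  by move=> x; rewrite /= in_itv/= andbT; exact: k2.
have fin : (leb `[(- theta)%R, theta]%classic < +oo)%E.
  by rewrite lebesgue_measure_itv/=; case: ifP => // _; rewrite ltry.
have ic : leb.-integrable `[- theta, theta] (EFin \o (fun=> expR 1 * M * t `^ (- (a + 1)))).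
  by apply: integrable_constant.
have E3 : normc (Cintegral leb `[- theta, theta] (arc_integrand t^-1 F)) <=
    2 * ((expR 1 * M * t `^ (- (a + 1))) * (2 * theta)).
  apply: le_trans (Cintegral_le (measurable_itv _) i3 ic _) _.
    by move=> x; rewrite /= in_itv/= -ler_norml; exact: k3.
  rewrite ler_wpM2l// Rintegral_cst//= lebesgue_measure_itv/= lte_fin.
  by rewrite ifT ?opprK ?mulr2n ?mulrDl ?mul1r// gtrN.
rewrite contour_integralE; apply: le_trans (le_normcD _ _) _.
apply: le_trans (lerD (le_normcD _ _) E1) _; rewrite normcN.
apply: le_trans (lerD (lerD E2 E3) (lexx _)) _.
by rewrite le_eqVlt; apply/orP; left; apply/eqP; ring.
Qed.

(** The majorants that bound the integral also dominate the integrand. *)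
Lemma contour_integrable_continuous (t M : R) (F : R[i] -> R[i]) : 0 < t -> 0 <= M ->
  (forall z, closed_sector theta z ->
    (F w : C) @[w --> within (closed_sector theta) (nbhs (z : C))] --> (F z : C)) ->
  (forall z, on_contour theta t^-1 z -> normc (F z) <= M * expR (t * Re z) * normc z `^ a) ->
  contour_integrable theta t^-1 F.
Proof.
move=> t0 M0 cF FM; have [K K0 HK] := majorants.
have [k [ik kI /(_ F FM) [k1 k2 k3]]] := HK t M t0 M0.
have ti0 : 0 < t^-1 by rewrite invr_gt0.
have fin : (leb `[(- theta)%R, theta]%classic < +oo)%E.
  by rewrite lebesgue_measure_itv/=; case: ifP => // _; rewrite ltry.
have comp (D : set R) (gam : R -> C) (x : R) : D x ->
    (forall y, D y -> closed_sector theta (gam y)) -> gam y @[y --> x] --> gam x ->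
    (F (gam y) : C) @[y --> within D (nbhs x)] --> (F (gam x) : C).
  move=> Dx Dg cg; apply: (@cvg_comp _ _ _ gam F _ _ _ _ (cF _ (Dg _ Dx))).
  move=> A nA; have := cg _ nA.
  rewrite /nbhs/= /within/= => nx; apply: (@filterS _ (nbhs x) _ _ _ _ nx) => y h Dy.
  by apply: h; exact: Dg.
have ray psi : psi = theta \/ psi = - theta ->
    (forall rho, t^-1 <= rho -> normc (ray_integrand F psi rho) <= k rho) ->
    Cintegrable `[t^-1, +oo[ (ray_integrand F psi).
  move=> hpsi kp; apply: (Cintegrable_dominated (measurable_itv _) ik).
    move=> x Dx; apply: (@cvgM R[i] _ (within `[t^-1, +oo[%classic (nbhs (x : R)))); last exact: cvg_cst.
    apply: (comp _ (fun y => y%:C * cis psi)) => //.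
      move=> y; rewrite /= in_itv/= andbT => ty; apply: (contour_closed_sector ti0 th0).
      by left; exists y, psi.
    by apply: (@cvgM R[i] R (nbhs x)); [apply: cvg_realc; exact: cvg_id|exact: cvg_cst].
  by move=> x; rewrite /= in_itv/= andbT; exact: kp.
split; [by apply: ray => //; left|by apply: ray => //; right|].
apply: (@Cintegrable_dominated _ _ (measurable_itv _) _ (fun=> expR 1 * M * t `^ (- (a + 1)))).
- exact: integrable_constant.
- have cg (x : R) : (t^-1)%:C * cis y @[y --> x] --> ((t^-1)%:C * cis x : C).
    by apply: (@cvgM R[i] R (nbhs x)); [exact: cvg_cst|apply: cvg_cis; exact: cvg_id].
  move=> x Dx; apply: (@cvgM R[i] _ (within `[- theta, theta]%classic (nbhs (x : R)))).
    apply: (comp _ (fun y => (t^-1)%:C * cis y)) => //.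
    move=> y; rewrite /= in_itv/= -ler_norml => ty; apply: (contour_closed_sector ti0 th0).
    by right; exists y.
  apply: cvg_within_filter; apply: (@cvgM R[i] R (nbhs x)); [exact: cvg_cst|exact: cg].
- by move=> x; rewrite /= in_itv/= -ler_norml; exact: k3.
Qed.

End Estimate.

End Contour.

(** * The discrete operators *)

Section DiscreteOperators.
Variable R : realType.
Local Notation C := (R[i]^o).
Local Notation fct := (R * R -> R[i]).
Local Notation normc := (@Normc.normc R).
Variables (Omega : set (R * R)) (T : {fset {fset R * R}}) (h : R).
Hypothesis hOmega : convex_polygonal_domain Omega.
Hypothesis hT : triangulation Omega T.
Hypothesis hmesh : mesh_size T = h.
Hypothesis h0 : 0 < h.
Implicit Types (f g v w chi psi : fct).
Local Notation V := (Vh Omega T).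
Local Notation m := (mass_form T).
Local Notation mh := (lump_form T).
Local Notation s := (grad_form T).

Let hm : hermitian_form m := mass_hermitian T.
Let hmh : hermitian_form mh := lump_hermitian T.
Let hs : hermitian_form s := grad_hermitian T.
Let V0 : V (fun=> 0) := Vh0 Omega T.
Let Vlin a f g : V f -> V g -> V (fun x => a * f x + g x).
Proof. exact: Vh_linear. Qed.
Let mdef f : V f -> fnorm m f = 0 -> f = fun=> 0.
Proof. exact: mass_definite. Qed.
Let mhdef f : V f -> fnorm mh f = 0 -> f = fun=> 0.
Proof.
move=> Vf f0; apply: mdef => //; apply/eqP; rewrite eq_le fnorm_ge0 andbT.
by apply: le_trans (mass_le_lump T f) _; rewrite f0 mulr0.
Qed.

Variables (n : nat) (e : 'I_n -> fct).
Hypothesis he : orthonormal_basis V m e.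

Let fnorm_eq0 (B : fct -> fct -> R[i]) f : hermitian_form B -> B f f = 0 -> fnorm B f = 0.
Proof. by move=> hB f0; rewrite /fnorm f0 sqrtr0. Qed.

Section Riesz.
Variables (M ipM : fct -> fct -> R[i]).
Hypotheses (hM : hermitian_form M) (Mdef : forall f, V f -> fnorm M f = 0 -> f = fun=> 0).
Hypothesis ipME : forall f g, V f -> V g -> ipM f g = M f g.

(** The common pattern of [A_h] and [Abar_h]: the gradient form is represented through
    the inner product [ipM], which coincides with the nodal form [M] on [V]. *)
Definition riesz psi : fct :=
  xget 0 [set w | V w /\ forall chi, V chi -> ipM w chi = ip_grad Omega psi chi].

Lemma riesz_spec psi : V psi ->
  V (riesz psi) /\ forall chi, V chi -> M (riesz psi) chi = s psi chi.
Proof.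
move=> Vp; have [w Vw wE] : exists2 w, V w & forall chi, V chi -> M w chi = s psi chi.
  apply: (form_solve V0 Vlin he (b := M) (l := s psi)).
  - exact: form_linear.
  - by move=> a f g u; exact: form_antilinear.
  - by move=> a f g; exact: form_antilinear.
  move=> chi Vc /(_ chi Vc)/(fnorm_eq0 hM)/(Mdef Vc) ->.
  exact: form_zeror.
have ex : exists w, V w /\ forall chi, V chi -> ipM w chi = ip_grad Omega psi chi.
  by exists w; split => // chi Vc; rewrite ipME// (ip_grad_form hOmega hT)// wE.
have [Vr rE] := xgetPex 0 ex; split => // chi Vc.
by rewrite -ipME// rE// (ip_grad_form hOmega hT).
Qed.

Lemma resolvent_in lambda f : V (resolvent Omega T riesz lambda f).
Proof. by rewrite /resolvent; case: xgetP => [w -> []|]. Qed.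

Lemma resolvent_spec lambda f (c0 : R) : 0 < c0 -> lambda != 0 ->
  (forall p q : R, 0 <= p -> 0 <= q ->
    c0 * (normc lambda * p + q) <= normc (lambda * p%:C + q%:C)) -> V f ->
  forall psi, V psi -> lambda * M (resolvent Omega T riesz lambda f) psi +
    s (resolvent Omega T riesz lambda f) psi = M f psi.
Proof.
move=> c00 l0 coer Vf.
have nl0 : 0 < normc lambda.
  rewrite lt_def normc_ge0 andbT; apply: contra l0 => /eqP/normc_eq0 ->.
  by rewrite eqxx.
have [w Vw wE] : exists2 w, V w & forall psi, V psi -> lambda * M w psi + s w psi = M f psi.
  apply: (form_solve V0 Vlin he (b := fun w psi => lambda * M w psi + s w psi) (l := M f)).
  - by move=> a u1 u2 u; rewrite (form_linear hM) (form_linear hs); ring.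
  - by move=> a u1 u2 u; rewrite (form_antilinear hM) (form_antilinear hs); ring.
  - by move=> a u1 u2; exact: form_antilinear.
  move=> psi Vp /(_ psi Vp) E.
  suff -> : psi = fun=> 0 by rewrite form_zeror.
  apply: Mdef => //.
  have := coer (fnorm M psi ^+ 2) (fnorm s psi ^+ 2) (sqr_ge0 _) (sqr_ge0 _).
  rewrite -!form_diag// E normc_real normr0 pmulr_rle0// => H.
  apply/eqP; rewrite -sqrf_eq0 eq_le sqr_ge0 andbT -(pmulr_rle0 _ nl0).
  by apply: le_trans H; rewrite lerDl sqr_ge0.
have ex : exists w, V w /\ forall x, lambda * w x + riesz w x = f x.
  exists w; split => // x; have [Vr rE] := riesz_spec Vw.
  pose u : fct := fun x => (-1) * f x + (lambda * w x + riesz w x).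
  have Vu : V u by apply: (@Vlin (-1) f (fun x => lambda * w x + riesz w x)) => //; exact: Vlin.
  have u0 : u = fun=> 0.
    apply: Mdef => //; apply: fnorm_eq0 => //.
    rewrite {1}/u (form_linear hM (-1) f (fun x => lambda * w x + riesz w x)).
    by rewrite (form_linear hM) rE// wE// mulN1r addNr.
  by have := congr1 (@^~ x) u0; rewrite /u mulN1r => /eqP; rewrite addrC subr_eq0 => /eqP.
have [Vr rE] := xgetPex 0 ex; rewrite -/(resolvent Omega T riesz lambda f) in Vr rE.
move=> psi Vp; set r := resolvent _ _ _ _ _ in Vr rE *.
have -> : f = fun x => lambda * r x + riesz r x by apply/funext => x; rewrite rE.
by rewrite (form_linear hM) (riesz_spec Vr).2.
Qed.

End Riesz.

Lemma Abar_spec psi : V psi ->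
  V (Abar_h Omega T psi) /\ forall chi, V chi -> mh (Abar_h Omega T psi) chi = s psi chi.
Proof. by apply: riesz_spec => // f g; exact: ip_lump. Qed.

Lemma Q_spec chi : V chi ->
  V (Q_h Omega T chi) /\ forall psi, V psi -> s (Q_h Omega T chi) psi = mh chi psi - m chi psi.
Proof.
move=> Vc; have [w Vw wE] : exists2 w, V w & forall psi, V psi -> s w psi = mh chi psi - m chi psi.
  apply: (form_solve V0 Vlin he (b := s) (l := fun psi => mh chi psi - m chi psi)).
  - exact: form_linear.
  - by move=> a f g u; exact: form_antilinear.
  - by move=> a f g; rewrite !form_antilinear//; ring.
  (* the quadrature error vanishes on the kernel of the gradient form *)
  move=> psi Vp /(_ psi Vp)/(fnorm_eq0 hs) p0.
  apply: normc_eq0; apply/eqP; rewrite eq_le normc_ge0 andbT.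
  apply: le_trans (quadrature_error2 hT hmesh chi psi (ltW h0)) _.
  by rewrite p0 mulr0.
have ex : exists w, V w /\ forall psi, V psi ->
    ip_grad Omega w psi = ip_h Omega T chi psi - ip Omega chi psi.
  exists w; split => // psi Vp.
  by rewrite (ip_grad_form hOmega hT)// (ip_lump hOmega hT)// (ip_mass hOmega hT)// wE.
have [Vr rE] := xgetPex 0 ex; rewrite -/(Q_h Omega T chi) in Vr rE; split => // psi Vp.
by rewrite -(ip_grad_form hOmega hT)// rE// (ip_lump hOmega hT)// (ip_mass hOmega hT).
Qed.

Lemma l2norm_mass f : V f -> l2norm Omega f = fnorm m f.
Proof. by move=> Vf; rewrite /l2norm (ip_mass hOmega hT). Qed.

Lemma l2norm_grad_form f : V f -> l2norm_grad Omega f = fnorm s f.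
Proof. by move=> Vf; rewrite /l2norm_grad (ip_grad_form hOmega hT). Qed.

Section AtPoint.
Variables (beta : R[i] -> R[i]) (v : fct).
Hypothesis Vv : V v.

(** The integrand of [xi] at the point [z] is [cexp (z t) * beta z * w_z z], where
    [w_z z] is obtained in three steps, each of them a variational problem on [V] for
    nodal forms. *)
Definition chi_z z : fct := ut_hat Omega T beta v z.
Definition q_z z : fct := Q_h Omega T (chi_z z).
Definition w_z z : fct :=
  resolvent Omega T (Abar_h Omega T) (z * beta z) (Abar_h Omega T (q_z z)).

Let w1 z : fct := resolvent Omega T (A_h Omega T) (z * beta z) v.

Lemma w_z_in z : V (w_z z).
Proof. exact: (@resolvent_in (ip_h Omega T)). Qed.

Let w1_in z : V (w1 z).
Proof. exact: (@resolvent_in (ip Omega)). Qed.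

Let chi_eq z : chi_z z = fun x => (z * beta z) * w1 z x + (-1) * v x.
Proof. by apply/funext => x; rewrite /chi_z /ut_hat mulN1r. Qed.

Lemma chi_z_in z : V (chi_z z).
Proof.
rewrite chi_eq; apply: Vlin; first exact: w1_in.
have -> : (fun x => -1 * v x) = (fun x => -1 * v x + 0) by apply/funext => x; rewrite addr0.
exact: Vlin.
Qed.

Variables (z : R[i]) (c0 : R).
Hypotheses (c00 : 0 < c0) (l0 : z * beta z != 0).
Hypothesis coer : forall p q : R, 0 <= p -> 0 <= q ->
    c0 * (normc (z * beta z) * p + q) <= normc (z * beta z * p%:C + q%:C).

Lemma w1_spec psi : V psi -> (z * beta z) * m (w1 z) psi + s (w1 z) psi = m v psi.
Proof.
move=> Vp; apply: (@resolvent_spec m (ip Omega) hm mdef _ (z * beta z) v c0 c00 l0 coer Vv psi Vp).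
by move=> f g; exact: ip_mass.
Qed.

Lemma chi_spec psi : V psi -> (z * beta z) * m (chi_z z) psi + s (chi_z z) psi = - s v psi.
Proof.
move=> Vp; rewrite chi_eq.
have E B : hermitian_form B -> B (fun x => z * beta z * w1 z x + -1 * v x) psi =
    z * beta z * B (w1 z) psi - B v psi.
  move=> hB; rewrite (form_linear hB (z * beta z) (w1 z) (fun x => -1 * v x)); congr (_ + _).
  have -> : (fun x => -1 * v x) = (fun x => -1 * v x + 0) by apply/funext => x; rewrite addr0.
  by rewrite (form_linear hB) form_zerol// addr0 mulN1r.
rewrite !E//; have := w1_spec Vp => <-; ring.
Qed.

Lemma w_spec psi : V psi -> (z * beta z) * mh (w_z z) psi + s (w_z z) psi = s (q_z z) psi.
Proof.
move=> Vp; have [Vq _] := Q_spec (chi_z_in z); have [Vf fE] := Abar_spec Vq.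
rewrite -fE//.
apply: (@resolvent_spec mh (ip_h Omega T) hmh mhdef _ (z * beta z) _ c0 c00 l0 coer Vf psi Vp).
by move=> f g; exact: ip_lump.
Qed.

Definition coords f : 'rV[R[i]]_n := \row_i m f (e i).
Definition stiffness : 'M[R[i]]_n := \matrix_(i, j) s (e i) (e j).
Definition lumped_mass : 'M[R[i]]_n := \matrix_(i, j) mh (e i) (e j).

Lemma coords_form B f j : hermitian_form B -> V f ->
  B f (e j) = (coords f *m \matrix_(i, j) B (e i) (e j)) ord0 j.
Proof.
move=> hB Vf; have [_ _ esp] := he; rewrite {1}(esp f Vf) form_comb// mxE.
by apply: eq_bigr => i _; rewrite !mxE.
Qed.

(** A vector in the kernel is the coordinate vector of a function with zero energy. *)
Lemma pencil_unit M : hermitian_form M -> (forall f, V f -> fnorm M f = 0 -> f = fun=> 0) ->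
  (z * beta z) *: (\matrix_(i, j) M (e i) (e j)) + stiffness \in unitmx.
Proof.
move=> hM Mdef; rewrite -row_free_unit; apply: inj_row_free => y yA.
have [Ve eo _] := he.
pose u : fct := fun x => \sum_i y ord0 i * e i x.
have Vu : V u by exact: (subspace_comb V0 Vlin).
have yE : coords u = y.
  apply/rowP => j; rewrite mxE /u form_comb// (bigD1 j)//= eo eqxx mulr1 big1 ?addr0// => i ij.
  by rewrite eo (negbTE ij) mulr0.
have uj j : z * beta z * M u (e j) + s u (e j) = 0.
  rewrite !coords_form// yE.
  transitivity ((y *m (z * beta z *: (\matrix_(i, j) M (e i) (e j)) + stiffness)) ord0 j).
    by rewrite mulmxDr -scalemxAr !mxE.
  by rewrite yA mxE.
suff u0 : u = fun=> 0.
  by rewrite -yE; apply/rowP => j; rewrite !mxE u0 form_zerol.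
have uu : z * beta z * M u u + s u u = 0.
  have E B : hermitian_form B -> B u u = \sum_j conjc (y ord0 j) * B u (e j).
    by move=> hB; rewrite {2}/u form_combr.
  rewrite !E// big_distrr -big_split big1// => j _ /=.
  by rewrite mulrCA -mulrDr uj mulr0.
apply: Mdef => //.
have := coer (sqr_ge0 (fnorm M u)) (sqr_ge0 (fnorm s u)).
rewrite -!form_diag// uu normc_real normr0 pmulr_rle0// => H.
have nl0 : 0 < normc (z * beta z).
  rewrite lt_def normc_ge0 andbT; apply: contra l0 => /eqP/normc_eq0 ->.
  by rewrite eqxx.
apply/eqP; rewrite -sqrf_eq0 eq_le sqr_ge0 andbT -(pmulr_rle0 _ nl0).
by apply: le_trans H; rewrite lerDl sqr_ge0.
Qed.

(** In coordinates, the resolvents are inverses of matrices, and the dependence on [z]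
    becomes explicit. *)
Lemma coords_w : coords (w_z z) =
  (z * beta z *: (coords v *m invmx (z * beta z *: 1%:M + stiffness)) - coords v)
  *m (lumped_mass - 1%:M) *m invmx (z * beta z *: lumped_mass + stiffness).
Proof.
have [Ve eo _] := he.
have I1 : \matrix_(i, j) m (e i) (e j) = 1%:M :> 'M[R[i]]_n.
  by apply/matrixP => i j; rewrite !mxE eo.
have U1 : z * beta z *: 1%:M + stiffness \in unitmx by rewrite -I1; exact: pencil_unit.
have U2 : z * beta z *: lumped_mass + stiffness \in unitmx by exact: pencil_unit.
have mulA (x : 'rV[R[i]]_n) (M : 'M[R[i]]_n) j :
    (x *m (z * beta z *: M + stiffness)) ord0 j =
    z * beta z * (x *m M) ord0 j + (x *m stiffness) ord0 j.
  by rewrite mulmxDr -scalemxAr !mxE.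
have E1 : coords (w1 z) *m (z * beta z *: 1%:M + stiffness) = coords v.
  apply/rowP => j; rewrite mulA -I1 -!coords_form//.
  by rewrite w1_spec// mxE.
have E2 : coords (chi_z z) = z * beta z *: coords (w1 z) - coords v.
  apply/rowP => j; rewrite chi_eq !mxE.
  rewrite (form_linear hm (z * beta z) (w1 z) (fun x => -1 * v x)); congr (_ + _).
  have -> : (fun x => -1 * v x) = (fun x => -1 * v x + 0) by apply/funext => x; rewrite addr0.
  by rewrite (form_linear hm) form_zerol// addr0 mulN1r.
have E3 : coords (w_z z) *m (z * beta z *: lumped_mass + stiffness) =
    coords (chi_z z) *m (lumped_mass - 1%:M).
  apply/rowP => j; rewrite mulA -!coords_form//; last 2 first.
  - exact: w_z_in.
  - exact: w_z_in.
  rewrite w_spec// (Q_spec (chi_z_in z)).2// mulmxBr mulmx1 mxE; congr (_ + _).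
    by rewrite -coords_form//; exact: chi_z_in.
  by rewrite !mxE.
have E0 : coords v *m invmx (z * beta z *: 1%:M + stiffness) = coords (w1 z).
  by rewrite -E1 mulmxK.
by rewrite E0 -E2 -E3 mulmxK.
Qed.

End AtPoint.

End DiscreteOperators.

(** * The error as a contour integral *)

Section ErrorEstimate.
Variable R : realType.
Local Notation C := (R[i]^o).
Local Notation fct := (R * R -> R[i]).
Local Notation Re := (@complex.Re R).
Local Notation normc := (@Normc.normc R).
Variables (Omega : set (R * R)) (T : {fset {fset R * R}}) (h : R).
Hypothesis hOmega : convex_polygonal_domain Omega.
Hypothesis hT : triangulation Omega T.
Hypothesis hmesh : mesh_size T = h.
Hypothesis h0 : 0 < h.
Implicit Types (f chi psi : fct) (z w : R[i]).
Local Notation V := (Vh Omega T).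
Local Notation m := (mass_form T).
Local Notation mh := (lump_form T).
Local Notation s := (grad_form T).
Variables (theta theta' : R) (g beta : R[i] -> R[i]).
Hypotheses (htheta : pi / 2 < theta < pi) (htheta' : pi / 2 < theta' < pi).
Hypothesis hg : standing_assumption theta theta' g beta.
Variable v : fct.
Hypothesis Vv : V v.

Let hm : hermitian_form m := mass_hermitian T.
Let hmh : hermitian_form mh := lump_hermitian T.
Let hs : hermitian_form s := grad_hermitian T.

Local Notation w_z := (w_z Omega T beta v).

(** The constant of [sector_coercive] in the sector of half-angle [theta']. *)
Definition coercivity : R := Num.sqrt ((1 + cos theta') / 2).

Let cosN : cos theta' < 0.
Proof.
have /andP[h1 h2] := htheta'.
have p1 : 0 <= pi / 2 :> R by rewrite divr_ge0 ?pi_ge0.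
have p2 : pi / 2 <= pi :> R by rewrite ler_pdivrMr// ler_peMr ?pi_ge0// ler1n.
have t0 : 0 <= theta' by apply: le_trans p1 (ltW h1).
by rewrite -cos_pihalf ltr_cos// in_itv/= ?t0 ?(ltW h2) ?p1 ?p2.
Qed.

Let cosN1 : -1 < cos theta'.
Proof.
have /andP[h1 h2] := htheta'.
have p1 : 0 <= pi / 2 :> R by rewrite divr_ge0 ?pi_ge0.
have t0 : 0 <= theta' by apply: le_trans p1 (ltW h1).
by rewrite -cospi ltr_cos// in_itv/= ?t0 ?(ltW h2) ?lexx ?pi_ge0.
Qed.

Lemma coercivity_gt0 : 0 < coercivity.
Proof. by rewrite sqrtr_gt0 divr_gt0//; move: cosN1; lra. Qed.

Lemma zbeta_coercive z : closed_sector theta z -> forall p q : R, 0 <= p -> 0 <= q ->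
  coercivity * (normc (z * beta z) * p + q) <= normc (z * beta z * p%:C + q%:C).
Proof.
move=> hz p q p0 q0; rewrite /coercivity -[cos theta']opprK.
apply: sector_coercive => //.
  by apply/andP; split; move: cosN cosN1; lra.
by rewrite opprK; exact: (zbeta_sector htheta htheta' hg).
Qed.

Lemma zbeta_neq0 z : closed_sector theta z -> z * beta z != 0.
Proof.
by move=> hz; rewrite mulf_neq0 ?(closed_sector_neq0 hz)// (beta_neq0 htheta hg hz).
Qed.

Section Basis.
Variables (n : nat) (e : 'I_n -> fct).
Hypothesis he : orthonormal_basis V m e.
Variable t : R.
Hypothesis t0 : 0 < t.

Let coef i z : R[i] := cexp (z * t%:C) * (beta z * m (w_z z) (e i)).
Let kc : R[i] := - (2 * pi%:C * (0 +i* 1))^-1.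

Let normc_cexp_t z : normc (cexp (z * t%:C)) = expR (t * Re z).
Proof. by rewrite normc_cexp; congr expR; case: z => x y /=; ring. Qed.

Let coef_continuous i z : closed_sector theta z ->
  (coef i w : C) @[w --> within (closed_sector theta) (nbhs (z : C))] --> (coef i z : C).
Proof.
move=> hz; pose F := within (closed_sector theta) (nbhs (z : C)).
pose lam w := w * beta w.
have cid : (fun w : C => w) w @[w --> F] --> (z : C) by apply: cvg_within_filter; exact: cvg_id.
have cbeta : (beta w : C) @[w --> F] --> (beta z : C).
  by apply: cvg_within_filter; exact: (beta_continuous htheta hg).
have clam : (lam w : C) @[w --> F] --> (lam z : C) by exact: (@cvgM R[i] R[i] F _ (fun w => w) beta _ _ cid cbeta).
have [Ve eo _] := he.
have I1 : \matrix_(i, j) m (e i) (e j) = 1%:M :> 'M[R[i]]_n.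
  by apply/matrixP => i1 j1; rewrite !mxE eo.
have U1 w : closed_sector theta w -> lam w *: 1%:M + stiffness T e \in unitmx.
  move=> hw; rewrite -I1.
  apply: (pencil_unit he coercivity_gt0 (zbeta_neq0 hw) (zbeta_coercive hw) hm).
  by move=> f; exact: mass_definite.
have U2 w : closed_sector theta w -> lam w *: lumped_mass T e + stiffness T e \in unitmx.
  move=> hw; apply: (pencil_unit he coercivity_gt0 (zbeta_neq0 hw) (zbeta_coercive hw) hmh).
  move=> f Vf f0; apply: (mass_definite hT Vf); apply/eqP; rewrite eq_le fnorm_ge0 andbT.
  by apply: le_trans (mass_le_lump T f) _; rewrite f0 mulr0.
pose G w := (lam w *: (coords T e v *m invmx (lam w *: 1%:M + stiffness T e)) - coords T e v)
  *m (lumped_mass T e - 1%:M) *m invmx (lam w *: lumped_mass T e + stiffness T e).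
have cG j : (G w ord0 j : C) @[w --> F] --> (G z ord0 j : C).
  apply: (cvg_rational_vector (F := F) (lam := lam) (lam0 := lam z)) => //; [|exact: U1| |exact: U2].
    by rewrite /F; apply: filterS (withinT _ _) => w; exact: U1.
  by rewrite /F; apply: filterS (withinT _ _) => w; exact: U2.
have wG w : closed_sector theta w -> m (w_z w) (e i) = G w ord0 i.
  move=> hw; have := coords_w hOmega hT hmesh h0 he Vv coercivity_gt0 (zbeta_neq0 hw) (zbeta_coercive hw).
  by move/(congr1 (fun M : 'rV_n => M ord0 i)); rewrite mxE.
apply: (@cvg_trans _ ((cexp (w * t%:C) * (beta w * G w ord0 i) : C) @[w --> F])).
  apply: near_eq_cvg; rewrite /F; apply: filterS (withinT _ _) => w hw.
  by rewrite /coef wG.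
rewrite /coef (wG z hz).
have ce : (cexp (w * t%:C) : C) @[w --> F] --> (cexp (z * t%:C) : C).
  apply: cvg_cexp.
  exact: (@cvgM R[i] R[i] F _ (fun w => w) (fun=> t%:C) _ _ cid (cvg_cst _)).
exact: (@cvgM R[i] R[i] F _ _ _ _ _ ce
  (@cvgM R[i] R[i] F _ beta (fun w => G w ord0 i) _ _ cbeta (cG i))).
Qed.

(** The norms pass under the contour integral by duality. Since [xi] is a finite
    combination of basis functions whose coefficients are contour integrals, [B xi xi]
    is, up to a constant factor, the contour integral of the scalar function [B
    (integrand) xi], which is at most [fnorm B (integrand) * fnorm B xi]; one factor
    [fnorm B xi] is then cancelled. *)
Lemma xi_estimate (a K M : R) : 0 <= K -> 0 <= M ->
  (forall (t M : R) (F : R[i] -> R[i]), 0 < t -> 0 <= M ->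
    contour_integrable theta t^-1 F ->
    (forall z, on_contour theta t^-1 z -> normc (F z) <= M * expR (t * Re z) * normc z `^ a) ->
    normc (contour_integral theta t^-1 F) <= K * M * t `^ (- (a + 1))) ->
  (forall z, closed_sector theta z ->
    normc (beta z) * (fnorm m (w_z z) + h * fnorm s (w_z z)) <= M * normc z `^ a) ->
  V (xi Omega T theta beta v t) /\
  fnorm m (xi Omega T theta beta v t) + h * fnorm s (xi Omega T theta beta v t) <=
    2 * normc kc * K * M * t `^ (- (a + 1)).
Proof.
move=> K0 M0 HK Hw; have [Ve eo esp] := he.
have ti0 : 0 < t^-1 by rewrite invr_gt0.
have th0 : 0 < theta.
  by case/andP: htheta => h1 _; apply: lt_trans h1; rewrite divr_gt0// pi_gt0.
have cs z : on_contour theta t^-1 z -> closed_sector theta z.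
  exact: contour_closed_sector.
have Hm z : closed_sector theta z -> normc (beta z) * fnorm m (w_z z) <= M * normc z `^ a.
  move=> hz; apply: le_trans (Hw z hz); rewrite ler_wpM2l ?normc_ge0//.
  by rewrite lerDl mulr_ge0 ?fnorm_ge0// ltW.
have Hs z : closed_sector theta z -> normc (beta z) * fnorm s (w_z z) <= M / h * normc z `^ a.
  move=> hz; rewrite mulrAC ler_pdivlMr//; apply: le_trans (Hw z hz).
  by rewrite -mulrA ler_wpM2l ?normc_ge0// [leLHS]mulrC lerDr fnorm_ge0.
have Mh0 : 0 <= M / h by rewrite divr_ge0// ltW.
have ie i : fnorm m (e i) = 1 by rewrite /fnorm eo eqxx /= sqrtr1.
have int_coef i : contour_integrable theta t^-1 (coef i).
  apply: (contour_integrable_continuous htheta t0 M0 (a := a)).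
    by move=> z; exact: coef_continuous.
  move=> z /cs hz; rewrite /coef Normc.normcM normc_cexp_t Normc.normcM.
  rewrite [M * _]mulrC -mulrA ler_wpM2l ?expR_ge0//.
  apply: le_trans (Hm z hz); rewrite ler_wpM2l ?normc_ge0//.
  by apply: le_trans (form_Cauchy hm _ _) _; rewrite ie mulr1.
have xiE : xi Omega T theta beta v t =
    fun x => \sum_i (kc * contour_integral theta t^-1 (coef i)) * e i x.
  apply/funext => x; rewrite /xi -/kc.
  have [_ cE] := contour_integral_comb (index_enum 'I_n) (e ^~ x) int_coef.
  rewrite -[LHS]/(kc * contour_integral theta t^-1 (fun z => cexp (z * t%:C) * (beta z * w_z z x))).
  transitivity (kc * contour_integral theta t^-1 (fun z => \sum_i coef i z * e i x)).
    congr (_ * contour_integral _ _ _); apply/funext => z.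
    have Vw : V (w_z z) by exact: w_z_in.
    rewrite {1}(esp _ Vw) !big_distrr; apply: eq_bigr => i _.
    by rewrite /coef /= !mulrA.
  by rewrite cE big_distrr; apply: eq_bigr => i _; rewrite /= mulrA.
have Vxi : V (xi Omega T theta beta v t).
  by rewrite xiE; apply: subspace_comb => //; [exact: Vh0|exact: Vh_linear].
split => //; set X := xi _ _ _ _ _ _ in xiE Vxi *.
have bound B MB : hermitian_form B -> 0 <= MB ->
    (forall z, closed_sector theta z -> normc (beta z) * fnorm B (w_z z) <= MB * normc z `^ a) ->
    fnorm B X <= normc kc * (K * MB * t `^ (- (a + 1))).
  move=> hB MB0 HB.
  have [iE cE] := contour_integral_comb (index_enum 'I_n) (fun i => B (e i) X) int_coef.
  have BX : B X X = kc * contour_integral theta t^-1 (fun z => \sum_i coef i z * B (e i) X).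
    rewrite cE {1}xiE form_comb// big_distrr; apply: eq_bigr => i _ /=.
    by rewrite mulrA.
  have MX0 : 0 <= MB * fnorm B X by rewrite mulr_ge0 ?fnorm_ge0.
  have := HK t (MB * fnorm B X) _ t0 MX0 iE.
  have hyp z : on_contour theta t^-1 z -> normc (\sum_i coef i z * B (e i) X) <=
      MB * fnorm B X * expR (t * Re z) * normc z `^ a.
    move=> /cs hz.
    have -> : \sum_i coef i z * B (e i) X = cexp (z * t%:C) * (beta z * B (w_z z) X).
      have Vw : V (w_z z) by exact: w_z_in.
      rewrite {1}(esp _ Vw) form_comb// !big_distrr; apply: eq_bigr => i _.
      by rewrite /coef /= !mulrA.
    rewrite Normc.normcM normc_cexp_t Normc.normcM.
    rewrite (_ : MB * fnorm B X * expR (t * Re z) * normc z `^ a =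
       expR (t * Re z) * (MB * normc z `^ a * fnorm B X)); last by ring.
    rewrite ler_wpM2l ?expR_ge0//.
    apply: (@le_trans _ _ (normc (beta z) * (fnorm B (w_z z) * fnorm B X))).
      by rewrite ler_wpM2l ?normc_ge0// form_Cauchy.
    by rewrite mulrA ler_wpM2r ?fnorm_ge0// HB.
  move=> /(_ hyp) H.
  have sq : fnorm B X * fnorm B X <= normc kc * (K * MB * t `^ (- (a + 1))) * fnorm B X.
    rewrite -expr2 (_ : fnorm B X ^+ 2 = normc (B X X)); last first.
      by rewrite form_diag// normc_real ger0_norm// sqr_ge0.
    rewrite BX Normc.normcM -mulrA ler_wpM2l ?normc_ge0//.
    by apply: le_trans H _; rewrite le_eqVlt; apply/orP; left; apply/eqP; ring.
  have [->|X0] := eqVneq (fnorm B X) 0.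
    by rewrite !mulr_ge0 ?normc_ge0 ?powR_ge0.
  by rewrite -(@ler_pM2r _ (fnorm B X)) ?lt_def ?X0 ?fnorm_ge0.
have b1 := bound m M hm M0 Hm; have b2 := bound s (M / h) hs Mh0 Hs.
apply: le_trans (lerD b1 (ler_wpM2l (ltW h0) b2)) _.
by rewrite le_eqVlt; apply/orP; left; apply/eqP; field; rewrite gt_eqF.
Qed.

End Basis.

End ErrorEstimate.

(** * Estimates of the transformed error *)

Section FinalEstimates.
Variable R : realType.
Local Notation fct := (R * R -> R[i]).
Local Notation normc := (@Normc.normc R).
Variables (theta theta' : R).
Hypotheses (htheta : pi / 2 < theta < pi) (htheta' : pi / 2 < theta' < pi).
Local Notation k := (norm_equiv R).
Local Notation C0 := (quadrature_const R).
Local Notation c0 := (coercivity theta').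

Definition smooth_const : R := C0 * (k + 1) * (k ^+ 2 / c0) / c0.
Definition energy_const : R := C0 * (k + 1) / c0 / c0.
Definition rough_const (B : R) : R := ((1 + k ^+ 2 / c0) * B + C0 / c0) * (c0^-1 + 1).

Let c00 : 0 < c0 := coercivity_gt0 htheta'.
Let c0i : 0 <= c0^-1. Proof. by rewrite invr_ge0 ltW. Qed.
Let k0 : 0 <= k := norm_equiv_ge0 R.
Let C00 : 0 <= C0 := quadrature_const_ge0 R.
Let k1 : 0 <= k + 1. Proof. by rewrite addr_ge0. Qed.
Let k2 : 0 <= k ^+ 2 / c0. Proof. by rewrite mulr_ge0 ?sqr_ge0. Qed.

Lemma smooth_const_ge0 : 0 <= smooth_const.
Proof. by exact: (mulr_ge0 (mulr_ge0 (mulr_ge0 C00 k1) k2) c0i). Qed.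

Lemma energy_const_ge0 : 0 <= energy_const.
Proof. by exact: (mulr_ge0 (mulr_ge0 (mulr_ge0 C00 k1) c0i) c0i). Qed.

Lemma rough_const_ge0 B : 0 <= B -> 0 <= rough_const B.
Proof.
move=> B0; apply: mulr_ge0; last by rewrite addr_ge0.
apply: addr_ge0; apply: mulr_ge0 => //.
by apply: addr_ge0; [exact: ler01|exact: k2].
Qed.

Section Mesh.
Variables (Omega : set (R * R)) (T : {fset {fset R * R}}) (h : R).
Hypothesis hOmega : convex_polygonal_domain Omega.
Hypothesis hT : triangulation Omega T.
Hypothesis hmesh : mesh_size T = h.
Hypothesis h0 : 0 < h.
Local Notation V := (Vh Omega T).
Local Notation m := (mass_form T).
Local Notation s := (grad_form T).

Lemma Vh_basis : exists n (e : 'I_n -> fct), orthonormal_basis V m e.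
Proof.
apply: (orthonormal_basis_exists (Vh0 Omega T) _ (mass_hermitian T) _ (ps := vertices T)).
- by move=> a f g; exact: Vh_linear.
- by move=> f; exact: mass_definite.
by move=> f; exact: Vh_vertices_zero.
Qed.

Variables (g beta : R[i] -> R[i]).
Hypothesis hg : standing_assumption theta theta' g beta.
Variable v : fct.
Hypothesis Vv : V v.
Local Notation w_z := (w_z Omega T beta v).
Local Notation chi_z := (chi_z Omega T beta v).
Local Notation q_z := (q_z Omega T beta v).

Section Point.
Variable z : R[i].
Hypothesis hz : closed_sector theta z.
Let coer := zbeta_coercive htheta htheta' hg hz.
Let l0 : z * beta z != 0 := zbeta_neq0 htheta hg hz.
Let Vlin a f g' : V f -> V g' -> V (fun x => a * f x + g' x).
Proof. exact: Vh_linear. Qed.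
Let eps2 f g' := quadrature_error2 hT hmesh f g' (ltW h0).
Let eps1 f g' := quadrature_error1 hT hmesh f g' (ltW h0).

Lemma w_z_smooth : normc (z * beta z) * (fnorm m (w_z z) + h * fnorm s (w_z z)) <=
  smooth_const * h ^+ 2 * fnorm m (Abar_h Omega T v).
Proof.
have [n [e he]] := Vh_basis.
apply: (w_estimate_smooth (mass_hermitian T) (lump_hermitian T) (grad_hermitian T) k0 C00
  (ltW h0) c00 (mass_le_lump T) (lump_le_mass T) eps2 eps1 coer
  (chi_z_in beta Vv z) (Q_spec hOmega hT hmesh h0 he (chi_z_in beta Vv z)).1
  (w_z_in Omega T beta v z) (chi_spec hOmega hT he Vv c00 l0 coer)
  (Q_spec hOmega hT hmesh h0 he (chi_z_in beta Vv z)).2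
  (w_spec hOmega hT hmesh h0 he Vv c00 l0 coer) (Abar_spec hOmega hT he Vv).2).
Qed.

Lemma w_z_energy :
  Num.sqrt (normc (z * beta z)) * (fnorm m (w_z z) + h * fnorm s (w_z z)) <=
  energy_const * h ^+ 2 * fnorm s v.
Proof.
have [n [e he]] := Vh_basis.
apply: (w_estimate_energy (mass_hermitian T) (lump_hermitian T) (grad_hermitian T) k0 C00
  (ltW h0) c00 (mass_le_lump T) eps2 eps1 coer
  (chi_z_in beta Vv z) (Q_spec hOmega hT hmesh h0 he (chi_z_in beta Vv z)).1
  (w_z_in Omega T beta v z) (chi_spec hOmega hT he Vv c00 l0 coer)
  (Q_spec hOmega hT hmesh h0 he (chi_z_in beta Vv z)).2
  (w_spec hOmega hT hmesh h0 he Vv c00 l0 coer)).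
Qed.

Lemma w_z_rough B : 0 <= B -> fnorm m (q_z z) <= B * h ^+ 2 * fnorm m (chi_z z) ->
  fnorm m (w_z z) + h * fnorm s (w_z z) <= rough_const B * h ^+ 2 * fnorm m v.
Proof.
have [n [e he]] := Vh_basis.
apply: (w_estimate_rough Vlin (mass_hermitian T) (lump_hermitian T) (grad_hermitian T) k0 C00
  (ltW h0) c00 (mass_le_lump T) (lump_le_mass T) eps2 eps1 coer Vv
  (chi_z_in beta Vv z) (Q_spec hOmega hT hmesh h0 he (chi_z_in beta Vv z)).1
  (w_z_in Omega T beta v z) (chi_spec hOmega hT he Vv c00 l0 coer)
  (Q_spec hOmega hT hmesh h0 he (chi_z_in beta Vv z)).2
  (w_spec hOmega hT hmesh h0 he Vv c00 l0 coer)).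
by apply: contra l0 => /eqP/normc_eq0 ->.
Qed.

End Point.
End Mesh.

(** The constant depends on the exponent and on [theta] alone, and is chosen before
    the mesh, the kernel and the data. *)
Lemma xi_bound (a : R) : exists2 K : R, 0 <= K &
  forall (Omega : set (R * R)) (T : {fset {fset R * R}}) (h : R) (g beta : R[i] -> R[i])
    (v : fct) (t M : R),
  convex_polygonal_domain Omega -> triangulation Omega T -> mesh_size T = h -> 0 < h ->
  standing_assumption theta theta' g beta -> Vh Omega T v -> 0 < t -> 0 <= M ->
  (forall z, closed_sector theta z ->
    normc (beta z) * (fnorm (mass_form T) (w_z Omega T beta v z) +
      h * fnorm (grad_form T) (w_z Omega T beta v z)) <= M * normc z `^ a) ->
  l2norm Omega (xi Omega T theta beta v t) + h * l2norm_grad Omega (xi Omega T theta beta v t)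
    <= K * M * t `^ (- (a + 1)).
Proof.
have [K K0 HK] := contour_bound a htheta.
exists (2 * normc (- (2 * pi%:C * (0 +i* 1))^-1) * K); first by rewrite !mulr_ge0// normc_ge0.
move=> Omega T h g beta v t M hOmega hT hmesh h0 hg Vv t0 M0 HM.
have [n [e he]] := Vh_basis hT.
have [Vx H] := xi_estimate hOmega hT hmesh h0 htheta htheta' hg Vv he t0 K0 M0 HK HM.
by rewrite (l2norm_mass hOmega hT Vx) (l2norm_grad_form hOmega hT Vx).
Qed.

End FinalEstimates.

(** * Rates of decay and the main estimate *)

Section Rates.
Variable R : realType.
Implicit Types (b r B mu X E : R).

Lemma rate_smooth b r X E : 0 < r -> r * b * X <= E -> b * X <= E * r `^ (-1).
Proof.
move=> r0 H; rewrite powR_inv1 ?(ltW r0)// ler_pdivlMr//.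
by apply: le_trans H; rewrite le_eqVlt; apply/orP; left; apply/eqP; ring.
Qed.

(** One factor [sqrt b] is bounded by the growth condition, the other one completes
    [sqrt r] to [sqrt (r * b)]. *)
Lemma rate_energy b r B mu X E : 0 < r -> 0 <= b -> 0 <= X -> b <= B * r `^ mu ->
  Num.sqrt (r * b) * X <= E -> b * X <= Num.sqrt `|B| * E * r `^ ((mu - 1) / 2).
Proof.
move=> r0 b0 X0 bB H; have r0' := ltW r0.
have sb : Num.sqrt b <= Num.sqrt `|B| * r `^ (mu / 2).
  have -> : r `^ (mu / 2) = Num.sqrt (r `^ mu).
    by rewrite powRrM powR12_sqrt// powR_ge0.
  rewrite -sqrtrM// ler_sqrt ?mulr_ge0 ?powR_ge0//.
  by apply: le_trans bB _; rewrite ler_wpM2r ?powR_ge0// ler_norm.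
have sX : Num.sqrt b * X <= E * r `^ (- 2^-1).
  rewrite powRN powR12_sqrt// ler_pdivlMr ?sqrtr_gt0//; apply: le_trans H.
  rewrite sqrtrM//; by rewrite le_eqVlt; apply/orP; left; apply/eqP; ring.
have -> : b * X = Num.sqrt b * (Num.sqrt b * X) by rewrite mulrA -expr2 sqr_sqrtr.
have -> : (mu - 1) / 2 = mu / 2 + (- 2^-1) by field.
rewrite powRD; last by rewrite (gt_eqF r0) implybT.
have -> : Num.sqrt `|B| * E * (r `^ (mu / 2) * r `^ (- 2^-1)) =
  (Num.sqrt `|B| * r `^ (mu / 2)) * (E * r `^ (- 2^-1)) by ring.
by apply: ler_pM => //; rewrite ?sqrtr_ge0// mulr_ge0 ?sqrtr_ge0.
Qed.

Lemma rate_rough b r B mu X E : 0 <= b -> 0 <= X -> b <= B * r `^ mu -> X <= E ->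
  b * X <= `|B| * E * r `^ mu.
Proof.
move=> b0 X0 bB XE.
rewrite mulrAC; apply: ler_pM => //; apply: le_trans bB _.
by rewrite ler_wpM2r ?powR_ge0// ler_norm.
Qed.

Lemma absorb_const K (c c' w h N y : R) : 0 <= w -> 0 <= N ->
  K * c <= c' -> y <= K * (c * h ^+ 2 * N) * w -> y <= c' * w * h ^+ 2 * N.
Proof.
move=> w0 N0 cc; move=> /le_trans; apply.
have -> : K * (c * h ^+ 2 * N) * w = K * c * w * h ^+ 2 * N by ring.
by rewrite !ler_wpM2r ?sqr_ge0.
Qed.

End Rates.

Theorem theorem6p2 (R : realType) (Omega : set (R * R))
  (Hs : set R) (Th : R -> {fset {fset R * R}}) (theta theta' : R)
  (hOmega : convex_polygonal_domain Omega)
  (hHs : forall h, Hs h -> 0 < h < 1)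
  (hTh : forall h, Hs h -> triangulation Omega (Th h) /\ mesh_size (Th h) = h)
  (hreg : shape_regular Hs Th)
  (htheta : pi / 2 < theta < pi) (htheta' : pi / 2 < theta' < pi) :
  [/\ exists2 C : R, 0 < C &
        forall g beta : R[i] -> R[i],
        standing_assumption theta theta' g beta ->
        forall (h : R) (v : R * R -> R[i]) (t : R),
        Hs h -> Vh Omega (Th h) v -> 0 < t ->
        let e := xi Omega (Th h) theta beta v t in
        l2norm Omega e + h * l2norm_grad Omega e
          <= C * h ^+ 2 * l2norm Omega (Abar_h Omega (Th h) v),
      forall mu B : R, mu < 1 ->
        exists2 C : R, 0 < C &
        forall g beta : R[i] -> R[i],
        standing_assumption theta theta' g beta ->
        beta_growth theta mu B beta ->
        forall (h : R) (v : R * R -> R[i]) (t : R),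
        Hs h -> Vh Omega (Th h) v -> 0 < t ->
        let e := xi Omega (Th h) theta beta v t in
        l2norm Omega e + h * l2norm_grad Omega e
          <= C * t `^ (- ((mu + 1) / 2)) * h ^+ 2 * l2norm_grad Omega v &
      forall mu B B' : R, mu < 1 ->
        (forall (h : R) (chi : R * R -> R[i]),
           Hs h -> Vh Omega (Th h) chi ->
           l2norm Omega (Q_h Omega (Th h) chi)
             <= B' * h ^+ 2 * l2norm Omega chi) ->
        exists2 C : R, 0 < C &
        forall g beta : R[i] -> R[i],
        standing_assumption theta theta' g beta ->
        beta_growth theta mu B beta ->
        forall (h : R) (v : R * R -> R[i]) (t : R),
        Hs h -> Vh Omega (Th h) v -> 0 < t ->
        let e := xi Omega (Th h) theta beta v t in
        l2norm Omega e + h * l2norm_grad Omega e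
          <= C * t `^ (- (mu + 1)) * h ^+ 2 * l2norm Omega v].
Proof.
have nz z : closed_sector theta z -> 0 < Normc.normc z.
  by case=> rho [psi [rho0 _ ->]]; rewrite normc_polar// ltW.
have pos : forall h, Hs h -> 0 < h by move=> h /hHs/andP[].
have X0 h f : Hs h -> 0 <= fnorm (mass_form (Th h)) f + h * fnorm (grad_form (Th h)) f.
  by move=> /pos/ltW h0; rewrite addr_ge0 ?mulr_ge0 ?fnorm_ge0.
have E0 (c h N : R) : 0 <= c -> 0 <= N -> 0 <= c * h ^+ 2 * N.
  by move=> c0 N0; exact: (mulr_ge0 (mulr_ge0 c0 (sqr_ge0 h)) N0).
have lt1 (x : R) : 0 <= x -> 0 < x + 1 /\ x <= x + 1 by move=> x0; split; lra.
split.
- have [K K0 HK] := xi_bound htheta htheta' (-1).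
  have c0 := smooth_const_ge0 htheta'.
  have [C0 Cle] := lt1 _ (mulr_ge0 K0 c0).
  exists (K * smooth_const theta' + 1) => // g beta hg h v t Hh Vv t0 /=.
  have h0 := pos h Hh; have [hT hmesh] := hTh h Hh.
  have [n [e he]] := Vh_basis hT.
  rewrite (l2norm_mass hOmega hT (Abar_spec hOmega hT he Vv).1).
  set N := fnorm _ (Abar_h _ _ _).
  have N0 : 0 <= N by exact: fnorm_ge0.
  rewrite -[_ + 1]mulr1; apply: (@absorb_const R K (smooth_const theta')) => //.
  (* [|beta| / |z beta| = 1 / |z|] gives the exponent [-1] *)
  have -> : 1 = t `^ (- (-1 + 1)) by rewrite addNr oppr0 powRr0.
  apply: (HK _ _ _ _ _ _ _ _ hOmega hT hmesh h0 hg Vv t0 (E0 _ _ _ c0 N0)) => z hz.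
  apply: (rate_smooth (nz z hz)); rewrite -Normc.normcM.
  exact: (w_z_smooth htheta htheta' hOmega hT hmesh h0 hg Vv hz).
- move=> mu B _; have [K K0 HK] := xi_bound htheta htheta' ((mu - 1) / 2).
  have c0 : 0 <= Num.sqrt `|B| * energy_const theta'.
    by rewrite mulr_ge0 ?sqrtr_ge0//; exact: energy_const_ge0.
  have [C0 Cle] := lt1 _ (mulr_ge0 K0 c0).
  exists (K * (Num.sqrt `|B| * energy_const theta') + 1) => // g beta hg hB h v t Hh Vv t0 /=.
  have h0 := pos h Hh; have [hT hmesh] := hTh h Hh.
  rewrite (l2norm_grad_form hOmega hT Vv); set N := fnorm _ v.
  have N0 : 0 <= N by exact: fnorm_ge0.
  apply: (@absorb_const R K (Num.sqrt `|B| * energy_const theta')) => //; first exact: powR_ge0.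
  have -> : (mu + 1) / 2 = (mu - 1) / 2 + 1 by field.
  apply: (HK _ _ _ _ _ _ _ _ hOmega hT hmesh h0 hg Vv t0 (E0 _ _ _ c0 N0)) => z hz.
  rewrite -(mulrA (Num.sqrt _)) -(mulrA (Num.sqrt _)).
  apply: (rate_energy (nz z hz) (normc_ge0 _) (X0 _ _ Hh) (beta_growth_closed htheta hg hB hz)).
  rewrite -Normc.normcM.
  exact: (w_z_energy htheta htheta' hOmega hT hmesh h0 hg Vv hz).
move=> mu B B' _ hQ; have [K K0 HK] := xi_bound htheta htheta' mu.
have c0 : 0 <= `|B| * rough_const theta' `|B'|.
  by rewrite mulr_ge0//; exact: rough_const_ge0.
have [C0 Cle] := lt1 _ (mulr_ge0 K0 c0).
exists (K * (`|B| * rough_const theta' `|B'|) + 1) => // g beta hg hB h v t Hh Vv t0 /=.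
have h0 := pos h Hh; have [hT hmesh] := hTh h Hh.
have [n [e he]] := Vh_basis hT.
rewrite (l2norm_mass hOmega hT Vv); set N := fnorm _ v.
have N0 : 0 <= N by exact: fnorm_ge0.
apply: (@absorb_const R K (`|B| * rough_const theta' `|B'|)) => //; first exact: powR_ge0.
apply: (HK _ _ _ _ _ _ _ _ hOmega hT hmesh h0 hg Vv t0 (E0 _ _ _ c0 N0)) => z hz.
rewrite -(mulrA `|B|) -(mulrA `|B|).
apply: (rate_rough (normc_ge0 _) (X0 _ _ Hh) (beta_growth_closed htheta hg hB hz)).
apply: (w_z_rough htheta htheta' hOmega hT hmesh h0 hg Vv hz) => //.
have Vc := chi_z_in beta Vv z.
have [Vq _] := Q_spec hOmega hT hmesh h0 he Vc.
rewrite -(l2norm_mass hOmega hT Vq) -(l2norm_mass hOmega hT Vc).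
apply: le_trans (hQ _ _ Hh Vc) _.
by rewrite ler_wpM2r ?sqrtr_ge0// ler_wpM2r ?sqr_ge0// ler_norm.
Qed.
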